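(* Let $\pi:M\to B$ be a fibre bundle with fibre $F$ of dimension $p$ and structure group $G$. Suppose that $M$ and $B$ are compact and that the fibre $F$ admits a $G$-invariant Riemannian metric $\hat g$ with $\mathrm{Riem}(\hat g)>t$ for some $t\in[0,p(p-1)/2)$. Then $\mathbf{Riem}(M)>t$.
   Context: Throughout, manifolds are smooth, closed (compact without boundary) and connected. For a Riemannian metric $g$ on an $n$-manifold $M$, $R$ denotes the Riemann curvature tensor, viewed as a symmetric bilinear form on $\Lambda^2TM$ (the curvature operator, normalized to be the identity when the sectional curvature is $1$), and $\mathrm{Scal}$ is the scalar curvature (twice the trace of the curvature operator). For $t\in\mathbb{R}$ put $\mathrm{Riem}_t(g):=\mathrm{Scal}\,\frac{g^2}{2}-2tR$, where $g^2$ is the Kulkarni-Nomizu square of $g$ (so $g^2/2$ is the inner product induced by $g$ on $\Lambda^2TM$). $\mathrm{Riem}_t(g)>0$ means that this form is positive definite at every point. If $\mathrm{Scal}(g)>0$ everywhere, the metric invariant is $\mathrm{Riem}(g):=\sup\{t\in(0,n(n-1)/2):\mathrm{Riem}_t(g)>0\}$ (equivalently $\mathrm{Riem}(g)=\inf_M \frac{\mathrm{Scal}}{2\lambda_{\max}}$, with $\lambda_{\max}$ the maximal eigenvalue of the curvature operator at a point); otherwise $\mathrm{Riem}(g):=0$. The smooth invariant is $\mathbf{Riem}(M):=\sup_g\mathrm{Riem}(g)$ over all Riemannian metrics $g$ on $M$; it is $0$ if $M$ has no metric of positive scalar curvature. *)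

(* Defs.v *)
From HB Require Import structures.
From mathcomp Require Import all_boot all_order all_algebra.
From mathcomp Require Import all_classical all_reals all_analysis.
Import Order.TTheory GRing.Theory Num.Theory.
Import numFieldNormedType.Exports.

Set Implicit Arguments.
Unset Strict Implicit.
Unset Printing Implicit Defensive.

Local Open Scope classical_set_scope.
Local Open Scope ring_scope.

Section Calculus.
Variables (R : realType) (n : nat).

Definition partial (W : normedModType R) (i : 'I_n) (f : 'rV[R]_n -> W)
    (x : 'rV[R]_n) : W :=
  'D_(delta_mx 0 i) f x.

Fixpoint class_C (W : normedModType R) (k : nat) (U : set 'rV[R]_n)
    (f : 'rV[R]_n -> W) : Prop :=
  {in U, continuous f} /\
  if k is k'.+1 then
    forall i : 'I_n,
      {in U, forall x, derivable f x (delta_mx 0 i)} /\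
      class_C k' U (partial i f)
  else True.

(* Only used on open sets [U]. *)
Definition smooth_in (W : normedModType R) (U : set 'rV[R]_n)
    (f : 'rV[R]_n -> W) : Prop :=
  forall k, class_C k U f.

End Calculus.

(* A family of charts; [chart_map a] and [chart_inv a] are total functions
   that are only meaningful on [chart_dom a] and on its image. *)
Record atlas (R : realType) (n : nat) (T : Type) := Atlas {
  chart_ix : Type;
  chart_dom : chart_ix -> set T;
  chart_map : chart_ix -> T -> 'rV[R]_n;
  chart_inv : chart_ix -> 'rV[R]_n -> T }.

Arguments chart_ix {R n T} A : rename.
Arguments chart_dom {R n T} A a : rename.
Arguments chart_map {R n T} A a x : rename.
Arguments chart_inv {R n T} A a y : rename.

Definition chart_img (R : realType) n T (A : atlas R n T) (a : chart_ix A) :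
    set 'rV[R]_n :=
  chart_map A a @` chart_dom A a.

Definition prod_atlas (R : realType) m n S T (A : atlas R m S)
    (B : atlas R n T) : atlas R (m + n) (S * T) := {|
  chart_ix := chart_ix A * chart_ix B;
  chart_dom := fun c => chart_dom A c.1 `*` chart_dom B c.2;
  chart_map := fun c x =>
    row_mx (chart_map A c.1 x.1) (chart_map B c.2 x.2);
  chart_inv := fun c y =>
    (chart_inv A c.1 (lsubmx y), chart_inv B c.2 (rsubmx y)) |}.

Definition coord_map (R : realType) m n S T (A : atlas R m S)
    (B : atlas R n T) (f : S -> T) (a : chart_ix A) (b : chart_ix B) :
    'rV[R]_m -> 'rV[R]_n :=
  chart_map B b \o f \o chart_inv A a.

Definition coord_dom (R : realType) m n S T (A : atlas R m S)
    (B : atlas R n T) (U : set S) (f : S -> T) (a : chart_ix A)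
    (b : chart_ix B) : set 'rV[R]_m :=
  [set y | [/\ chart_img a y, U (chart_inv A a y)
             & chart_dom B b (f (chart_inv A a y))]].

(* Smoothness of [f] on an open set [U]; outside [U], [f] is arbitrary. *)
Definition smooth_on (R : realType) m n (S T : topologicalType)
    (A : atlas R m S) (B : atlas R n T) (U : set S) (f : S -> T) : Prop :=
  {in U, continuous f} /\
  forall (a : chart_ix A) (b : chart_ix B),
    smooth_in (coord_dom U f a b) (coord_map f a b).

Record is_manifold (R : realType) n (T : topologicalType)
    (A : atlas R n T) : Prop := {
  mfd_hausdorff : hausdorff_space T;
  mfd_second_countable : @second_countable T;
  mfd_cover : forall x, exists a, chart_dom A a x;
  mfd_dom_open : forall a, open (chart_dom A a);
  mfd_img_open : forall a : chart_ix A, open (chart_img a);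
  mfd_mapK : forall a, {in chart_dom A a, cancel (chart_map A a) (chart_inv A a)};
  mfd_map_cont : forall a, {in chart_dom A a, continuous (chart_map A a)};
  mfd_inv_cont : forall a : chart_ix A,
    {in chart_img a, continuous (chart_inv A a)};
  mfd_compat : smooth_on A A setT idfun }.

Record is_closed_manifold (R : realType) n (T : topologicalType)
    (A : atlas R n T) : Prop := {
  cmfd_manifold : is_manifold A;
  cmfd_nonempty : [set: T] !=set0;
  cmfd_compact : compact [set: T];
  cmfd_connected : connected [set: T] }.

Section LocalCurvature.
Variables (R : realType) (n : nat) (h : 'rV[R]_n -> 'M[R]_n).
Implicit Types (i j k l m : 'I_n) (x : 'rV[R]_n).

Definition christoffel k i j x : R :=
  2^-1 * \sum_l invmx (h x) k l *
    (partial i (fun y => h y j l) x + partial j (fun y => h y i l) x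
     - partial l (fun y => h y i j) x).

(* dx^l (R(d_i, d_j) d_k), with R(X,Y) = [D_X, D_Y] - D_[X,Y]. *)
Definition curv_endo l i j k x : R :=
  partial i (christoffel l j k) x - partial j (christoffel l i k) x
  + \sum_m (christoffel l i m x * christoffel m j k x
            - christoffel l j m x * christoffel m i k x).

(* R(d_i ^ d_j, d_k ^ d_l) = h(R(d_i, d_j) d_l, d_k): the sign for which
   R(v ^ w, v ^ w) is the sectional curvature of an orthonormal pair. *)
Definition curv i j k l x : R := \sum_m curv_endo m i j l x * h x m k.

(* The sum over all (i, j), not only i < j, accounts for the factor 2 in
   "twice the trace of the curvature operator". *)
Definition scal x : R :=
  \sum_i \sum_j \sum_k \sum_l
    invmx (h x) i k * invmx (h x) j l * curv i j k l x.

End LocalCurvature.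

(* (a . b)(e_i ^ e_j, e_k ^ e_l) for the Kulkarni-Nomizu product. *)
Definition kulkarni_nomizu (R : realType) n (a b : 'M[R]_n)
    (i j k l : 'I_n) : R :=
  a i k * b j l + a j l * b i k - a i l * b j k - a j k * b i l.

(* A bivector sum_(i < j) w_ij e_i ^ e_j is encoded by the antisymmetric
   matrix of its coordinates. *)
Definition posdef_bivectors (R : realType) n
    (Q : 'I_n -> 'I_n -> 'I_n -> 'I_n -> R) : Prop :=
  forall w : 'M[R]_n, w^T = - w -> w != 0 ->
    0 < \sum_(i < n) \sum_(j < n | (i < j)%N)
        \sum_(k < n) \sum_(l < n | (k < l)%N)
          Q i j k l * w i j * w k l.

Definition riem_form (R : realType) n (t : R) (h : 'rV[R]_n -> 'M[R]_n)
    (x : 'rV[R]_n) (i j k l : 'I_n) : R :=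
  scal h x * (kulkarni_nomizu (h x) (h x) i j k l / 2)
  - 2 * t * curv h i j k l x.

Section Metrics.
Variables (R : realType) (n : nat) (T : topologicalType) (A : atlas R n T).

(* The Gram matrices of a metric in the coordinate frames of the charts. *)
Definition metric_field := chart_ix A -> 'rV[R]_n -> 'M[R]_n.

(* f^* g = g. The Jacobian ['J] acts on row vectors from the right. *)
Definition preserves_metric (g : metric_field) (f : T -> T) : Prop :=
  forall (a b : chart_ix A) (y : 'rV[R]_n), coord_dom setT f a b y ->
    let J := 'J (coord_map f a b) y in
    g a y = J *m g b (coord_map f a b y) *m J^T.

Record is_riemannian (g : metric_field) : Prop := {
  metric_smooth : forall a, smooth_in (chart_img a) (g a);
  metric_sym : forall a y, chart_img a y -> (g a y)^T = g a y;
  metric_posdef : forall a y, chart_img a y ->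
    forall v : 'rV[R]_n, v != 0 -> 0 < (v *m g a y *m v^T) 0 0;
  metric_compat : preserves_metric g idfun }.

Definition scal_pos (g : metric_field) : Prop :=
  forall a y, chart_img a y -> 0 < scal (g a) y.

Definition riem_pos (t : R) (g : metric_field) : Prop :=
  forall a y, chart_img a y -> posdef_bivectors (riem_form t (g a) y).

Definition riem (g : metric_field) : R :=
  if `[< scal_pos g >] then
    sup [set t | 0 < t < n%:R * (n%:R - 1) / 2 /\ riem_pos t g]
  else 0.

(* On a closed manifold this set is nonempty and bounded above by
   n(n-1)/2, so the conventional value of [sup] plays no role. *)
Definition smooth_riem : R := sup [set riem g | g in is_riemannian].

End Metrics.

#[short(type="topologicalGroupType")]
HB.structure Definition TopologicalGroup :=
  {G of Group G & Topological G}.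

Record is_lie_group (R : realType) r (G : topologicalGroupType)
    (AG : atlas R r G) : Prop := {
  lie_manifold : is_manifold AG;
  lie_mul_smooth :
    smooth_on (prod_atlas AG AG) AG setT (fun x : G * G => (x.1 * x.2)%g);
  lie_inv_smooth : smooth_on AG AG setT (fun x : G => (x^-1)%g) }.

Record is_smooth_action (R : realType) r p (G : topologicalGroupType)
    (F : topologicalType) (AG : atlas R r G) (AF : atlas R p F)
    (act : G -> F -> F) : Prop := {
  act_one : forall f, act 1%g f = f;
  act_mul : forall a b f, act (a * b)%g f = act a (act b f);
  act_smooth :
    smooth_on (prod_atlas AG AF) AF setT (fun x : G * F => act x.1 x.2) }.

(* [triv i] is a trivialization of the part of the total space over
   [triv_dom i], with inverse [triv_inv i]; [trans i j] is the transition
   cocycle, meaningful over the overlap only. *)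
Record bundle_atlas (M B F G : Type) := BundleAtlas {
  triv_ix : Type;
  triv_dom : triv_ix -> set B;
  triv : triv_ix -> M -> B * F;
  triv_inv : triv_ix -> B * F -> M;
  trans : triv_ix -> triv_ix -> B -> G }.

Arguments triv_ix {M B F G} E : rename.
Arguments triv_dom {M B F G} E i : rename.
Arguments triv {M B F G} E i x : rename.
Arguments triv_inv {M B F G} E i x : rename.
Arguments trans {M B F G} E i j b : rename.

(* The action is not required to be effective, whence the explicit cocycle
   condition (automatic in the effective case). *)
Record is_fibre_bundle (R : realType) n q p r (M B F : topologicalType)
    (G : topologicalGroupType) (AM : atlas R n M) (AB : atlas R q B)
    (AF : atlas R p F) (AG : atlas R r G) (act : G -> F -> F)
    (pi : M -> B) (E : bundle_atlas M B F G) : Prop := {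
  proj_smooth : smooth_on AM AB setT pi;
  triv_cover : forall b, exists i, triv_dom E i b;
  triv_open : forall i, open (triv_dom E i);
  triv_proj : forall i x, triv_dom E i (pi x) -> (triv E i x).1 = pi x;
  triv_invK : forall i x, triv_dom E i (pi x) ->
    triv_inv E i (triv E i x) = x;
  proj_triv_inv : forall i b f, triv_dom E i b -> pi (triv_inv E i (b, f)) = b;
  trivK : forall i b f, triv_dom E i b ->
    triv E i (triv_inv E i (b, f)) = (b, f);
  triv_smooth : forall i,
    smooth_on AM (prod_atlas AB AF) (pi @^-1` triv_dom E i) (triv E i);
  triv_inv_smooth : forall i,
    smooth_on (prod_atlas AB AF) AM (triv_dom E i `*` setT) (triv_inv E i);
  trans_smooth : forall i j,
    smooth_on AB AG (triv_dom E i `&` triv_dom E j) (trans E i j);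
  transE : forall i j b f, triv_dom E i b -> triv_dom E j b ->
    triv E i (triv_inv E j (b, f)) = (b, act (trans E i j b) f);
  trans_cocycle : forall i j k b,
    triv_dom E i b -> triv_dom E j b -> triv_dom E k b ->
    (trans E i j b * trans E j k b)%g = trans E i k b }.

(* Main.v *)
Require Import Defs.
From HB Require Import structures.
From mathcomp Require Import all_boot all_order all_algebra.
From mathcomp Require Import all_classical all_reals all_analysis.
Import Order.TTheory GRing.Theory Num.Theory.
Import numFieldNormedType.Exports.
From mathcomp Require Import ring lra.

Set Implicit Arguments.
Unset Strict Implicit.
Unset Printing Implicit Defensive.

Local Open Scope classical_set_scope.
Local Open Scope ring_scope.

(* Take on M the metrics g_e = g_H + e^2 g_V, where g_V restricts on each fibre to a positive
   multiple of the invariant metric ghat and g_H is the pullback of a metric of the base; both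
   are obtained by summing over finitely many local trivializations with bump functions on the
   base. In a local trivialization, after dividing by e^2 and rescaling the base coordinates by
   e, the 2-jet of g_e at a point extends continuously to e = 0, with value the 2-jet of the
   product of a flat metric and a multiple of ghat. The curvature operator of that product is
   the one of the fibre extended by 0, so Scal > 0 and Riem_s > 0 on the fibre give
   the same in the limit. Positivity is an open condition on 2-jets and M is
   compact, hence g_e has it for all small e > 0. *)

(** * Maps of class C^k *)

(** No connection on the bundle and no formula for Riemannian submersions enters. The mixed and base
    blocks of g_V involve derivatives of the transition functions and are never computed: in the
    rescaled frame they carry a positive power of e, so only the fibre block is seen at e = 0. The
    obstacle is that positivity is defined chart by chart on M, whereas the limit is visible only in
    coordinates adapted to a trivialization; hence the curvature, defined by coordinate formulas,
    has to be shown to be a tensor. It is treated as a function of an arbitrary 2-jet, because the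
    limit at e = 0 is taken on jets, point by point, and not on metrics. All limits are joint in the
    point and e, so that compactness of M can select a single e. *)

Section ClassC.
Variables (R : realType) (n : nat).
Local Notation V := ('rV[R]_n).
Implicit Types (W : normedModType R) (U : set V) (k : nat).

Lemma class_C_continuous W k U (f : V -> W) x :
  class_C k U f -> U x -> {for x, continuous f}.
Proof. by case: k => [|k] [cf _] Ux; apply: cf; rewrite inE. Qed.

Lemma class_C_derivable W k U (f : V -> W) x i :
  class_C k.+1 U f -> U x -> derivable f x (delta_mx 0 i).
Proof. by move=> [_ /(_ i) [df _]] Ux; apply: df; rewrite inE. Qed.

Lemma class_C_partial W k U (f : V -> W) i :
  class_C k.+1 U f -> class_C k U (partial i f).
Proof. by move=> [_ /(_ i) []]. Qed.

Lemma class_C_sub W k U U' (f : V -> W) :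
  U' `<=` U -> class_C k U f -> class_C k U' f.
Proof.
move=> sU; elim: k f => [|k IH] f [cf df]; split.
- by move=> x; rewrite inE => /sU Ux; apply: cf; rewrite inE.
- by [].
- by move=> x; rewrite inE => /sU Ux; apply: cf; rewrite inE.
- move=> i; have [dfi Ck] := df i; split; last exact: IH.
  by move=> x; rewrite inE => /sU Ux; apply: dfi; rewrite inE.
Qed.

Lemma class_CW W k U (f : V -> W) : class_C k.+1 U f -> class_C k U f.
Proof.
elim: k f => [|k IH] f [cf df]; split=> // i.
by have [dfi Ck] := df i; split=> //; apply: IH.
Qed.

(** Each condition in [class_C] concerns one point of [U] at a time, and [partial i f] is a globally
    defined function, so nothing has to be glued. *)
Lemma class_C_near W k U (f : V -> W) :
  (forall x, U x -> exists U', [/\ open U', U' x & class_C k U' f]) ->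
  class_C k U f.
Proof.
elim: k f => [|k IH] f locf; split=> //.
- move=> x; rewrite inE => /locf [U' [_ U'x Cf]].
  exact: class_C_continuous Cf U'x.
- move=> x; rewrite inE => /locf [U' [_ U'x Cf]].
  exact: class_C_continuous Cf U'x.
- move=> i; split.
    move=> x; rewrite inE => /locf [U' [_ U'x Cf]].
    exact: class_C_derivable Cf U'x.
  apply: IH => x /locf [U' [oU' U'x Cf]]; exists U'; split=> //.
  exact: class_C_partial Cf.
Qed.

Lemma eq_partial W (f g : V -> W) i x :
  (\near x, f x = g x) -> partial i f x = partial i g x.
Proof. exact: near_eq_derive. Qed.

Lemma eq_class_C W k U (f g : V -> W) : open U -> {in U, f =1 g} ->
  class_C k U f -> class_C k U g.
Proof.
move=> oU; elim: k f g => [|k IH] f g fg [cf df].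
  split=> // x; rewrite inE => Ux.
  have nfg : {near x, f =1 g}.
    by near=> y; apply: fg; rewrite inE; near: y; exact: open_nbhs_nbhs.
  rewrite /continuous_at -(nbhs_singleton nfg).
  by apply: cvg_trans (cf x _); [exact: (near_eq_cvg nfg)|rewrite inE].
have nfg x : U x -> {near x, f =1 g}.
  by move=> Ux; near=> y; apply: fg; rewrite inE; near: y; exact: open_nbhs_nbhs.
split=> [x|i].
  rewrite inE => Ux; rewrite /continuous_at -(nbhs_singleton (nfg _ Ux)).
  by apply: cvg_trans (cf x _); [exact: (near_eq_cvg (nfg _ Ux))|rewrite inE].
have [dfi Ck] := df i; split.
  move=> x; rewrite inE => Ux; apply: near_eq_derivable (nfg _ Ux) _.
  by apply: dfi; rewrite inE.
apply: (IH (partial i f)) => // x; rewrite inE => Ux.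
exact: near_eq_derive (nfg _ Ux).
Unshelve. all: by end_near. Qed.

Lemma class_C_cst W k U (a : W) : open U -> class_C k U (cst a).
Proof.
move=> oU; elim: k a => [|k IH] a; split=> //.
- by move=> x _; exact: cst_continuous.
- by move=> x _; exact: cst_continuous.
move=> i; split=> [x _|]; first exact: derivable_cst.
apply: (eq_class_C oU _ (IH 0)) => x _.
by rewrite /partial (derive_cst a).
Qed.

Lemma class_CD W k U (f g : V -> W) : open U ->
  class_C k U f -> class_C k U g -> class_C k U (f \+ g).
Proof.
move=> oU; elim: k f g => [|k IH] f g Cf Cg.
  split=> // x; rewrite inE => Ux.
  exact: continuousD (class_C_continuous Cf Ux) (class_C_continuous Cg Ux).
split=> [x|i].
  rewrite inE => Ux.
  exact: continuousD (class_C_continuous Cf Ux) (class_C_continuous Cg Ux).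
split=> [x|].
  rewrite inE => Ux.
  by apply: derivableD; [exact: class_C_derivable Cf Ux|exact: class_C_derivable Cg Ux].
apply: (eq_class_C oU _ (IH _ _ (class_C_partial i Cf) (class_C_partial i Cg))).
move=> x; rewrite inE => Ux; rewrite /partial deriveD //.
- exact: class_C_derivable Cf Ux.
- exact: class_C_derivable Cg Ux.
Qed.

Lemma class_CM k U (f g : V -> R) : open U ->
  class_C k U f -> class_C k U g -> class_C k U (f \* g).
Proof.
move=> oU; elim: k f g => [|k IH] f g Cf Cg.
  split=> // x; rewrite inE => Ux.
  exact: continuousM (class_C_continuous Cf Ux) (class_C_continuous Cg Ux).
split=> [x|i].
  rewrite inE => Ux.
  exact: continuousM (class_C_continuous Cf Ux) (class_C_continuous Cg Ux).
split=> [x|].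
  rewrite inE => Ux.
  by apply: derivableM; [exact: class_C_derivable Cf Ux|exact: class_C_derivable Cg Ux].
have C1 := IH _ _ (class_CW Cf) (class_C_partial i Cg).
have C2 := IH _ _ (class_CW Cg) (class_C_partial i Cf).
apply: (eq_class_C oU _ (class_CD oU C1 C2)).
move=> x; rewrite inE => Ux; rewrite /partial deriveM //.
- exact: class_C_derivable Cf Ux.
- exact: class_C_derivable Cg Ux.
Qed.

Lemma continuous_mxP (T : topologicalType) (m p : nat) (f : T -> 'M[R]_(m, p)) x :
  {for x, continuous f} <-> forall i j, {for x, continuous (fun y => f y i j)}.
Proof.
split=> [cf i j|cf].
  exact: (continuous_comp cf (@coord_continuous _ _ _ i j _)).
apply/cvgrPdist_le => /= e e0; near=> y.
rewrite [leLHS]/Num.Def.normr/= mx_normrE (bigmax_le _ (ltW e0))//= => i _.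
rewrite !mxE; move: i; near: y; apply: filter_forall => /= i.
exact: ((cvgrPdist_le _ _).1 (cf i.1 i.2)).
Unshelve. all: by end_near. Qed.

Lemma partial_mx (m p : nat) (f : V -> 'M[R]_(m, p)) i x a b :
  derivable f x (delta_mx 0 i) ->
  partial i f x a b = partial i (fun y => f y a b) x.
Proof. by move=> df; rewrite /partial derive_mx // mxE. Qed.

Lemma class_C_mxP (m p : nat) k U (f : V -> 'M[R]_(m, p)) : open U ->
  class_C k U f <-> forall a b, class_C k U (fun x => f x a b).
Proof.
move=> oU; elim: k f => [|k IH] f.
  split=> [[cf _] a b|cf]; split=> // x xU.
    exact: (continuous_mxP _ _).1 (cf _ xU) _ _.
  by apply/continuous_mxP => a b; have [c _] := cf a b; apply: c.
split=> [Cf a b|Cf].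
  split=> [x|i].
    rewrite inE => Ux.
    exact: (continuous_mxP _ _).1 (class_C_continuous Cf Ux) _ _.
  split=> [x|].
    rewrite inE => Ux.
    by have /derivable_mxP := class_C_derivable (i := i) Cf Ux; apply.
  apply: (eq_class_C oU _ ((IH _).1 (class_C_partial i Cf) a b)) => x.
  rewrite inE => Ux; rewrite partial_mx //; exact: class_C_derivable Cf Ux.
have df i x : U x -> derivable f x (delta_mx 0 i).
  by move=> Ux; apply/derivable_mxP => a b; exact: class_C_derivable (Cf a b) Ux.
split=> [x|i].
  rewrite inE => Ux; apply/continuous_mxP => a b.
  exact: class_C_continuous (Cf a b) Ux.
split=> [x|]; first by rewrite inE; apply: df.
apply/IH => a b; apply: (eq_class_C oU _ (class_C_partial i (Cf a b))) => x.
by rewrite inE => Ux; rewrite partial_mx //; apply: df.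
Qed.

End ClassC.

Lemma cvg_sumr (R : realType) (T I : Type) (F : set_system T) (r : seq I)
    (P : pred I) (f : I -> T -> R) (a : I -> R) : Filter F ->
  (forall i, f i t @[t --> F] --> a i) ->
  \sum_(i <- r | P i) f i t @[t --> F] --> \sum_(i <- r | P i) a i.
Proof.
move=> FF fa; apply: cvg_big => [|i _]; last exact: fa.
by move=> y; exact: add_continuous.
Qed.

(** * Differentiability from continuous partial derivatives *)

Section Directional.
Variables (R : realType) (V : normedModType R).

Lemma is_derive_line (f : V -> R) (z v : V) (s : R) :
  derivable f (s *: v + z) v ->
  is_derive s 1 (fun s => f (s *: v + z)) ('D_v f (s *: v + z)).
Proof.
(* The restriction to the line and [f] in direction [v] have the same difference quotients, so both
   derivatives are limits of one function. *)
have E : (fun h : R => h^-1 *: (f ((h *: (1 : R^o) + s) *: v + z) - f (s *: v + z)))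
     = (fun h : R => h^-1 *: (f (h *: v + (s *: v + z)) - f (s *: v + z))).
  by apply/funext => h; rewrite [h *: (1 : R^o)]mulr1 scalerDl addrA.
move=> df; apply: DeriveDef.
  by rewrite /derivable; rewrite -[X in cvg (X @ _)]/(fun h : R => h^-1 *: (f ((h *: (1 : R^o) +
    s) *: v + z) - f (s *: v + z))) E.
by rewrite /derive; rewrite -[X in lim (X @ _)]/(fun h : R => h^-1 *: (f ((h *: (1 : R^o) + s)
  *: v + z) - f (s *: v + z))) E.
Qed.

(** Both signs of [c] are allowed because the steps taken later are the coordinates of an arbitrary
    small vector. *)
Lemma MVT_line (f : V -> R) (z v : V) (c : R) :
  (forall s : R, `|s| <= `|c| -> derivable f (s *: v + z) v) ->
  exists2 s : R, `|s| <= `|c| & f (c *: v + z) - f z = c * 'D_v f (s *: v + z).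
Proof.
move=> df.
have dg (s : R) : `|s| <= `|c| ->
    is_derive s 1 (fun s => f (s *: v + z)) ('D_v f (s *: v + z)).
  by move=> sc; apply: is_derive_line; apply: df.
have ctn (a b : R) : (forall s : R, s \in `[a, b] -> `|s| <= `|c|) ->
   {within `[a, b], continuous (fun s => f (s *: v + z))}.
  move=> ab; apply: derivable_within_continuous => s /ab sc.
  exact: (@ex_derive _ _ _ _ _ _ _ (dg _ sc)).
have [c0|c0] := leP 0 c.
  have H (s : R) : s \in `[0, c] -> `|s| <= `|c|.
    by rewrite in_itv /= => /andP[s0 sc]; rewrite !ger0_norm.
  have [s|s sc] := @MVT_segment _ (fun s => f (s *: v + z)) (fun s => 'D_v f (s *: v + z)) 0 c
    c0 _ (ctn _ _ H).
    by move=> sc; apply: dg; apply: H; apply: subset_itv_oo_cc sc.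
  rewrite scale0r add0r subr0 => E; exists s; first exact: H.
  by rewrite E mulrC.
have H (s : R) : s \in `[c, 0] -> `|s| <= `|c|.
  by rewrite in_itv /= => /andP[s0 sc]; rewrite !ler0_norm ?lerN2 // ltW.
have [s|s sc] := @MVT_segment _ (fun s => f (s *: v + z)) (fun s => 'D_v f (s *: v + z)) c 0
  (ltW c0) _ (ctn _ _ H).
  by move=> sc; apply: dg; apply: H; apply: subset_itv_oo_cc sc.
rewrite scale0r add0r sub0r mulrN => E; exists s; first exact: H.
by rewrite -[LHS]opprB E opprK mulrC.
Qed.

End Directional.

Section C1.
Variables (R : realType) (n : nat).
Local Notation V := ('rV[R]_n).
Implicit Types (f : V -> R).

Lemma rV_norm_le (v : V) (e : R) : 0 <= e -> (forall i, `|v 0 i| <= e) -> `|v| <= e.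
Proof.
move=> e0 ve; rewrite [leLHS]/Num.Def.normr/= mx_normrE; apply: bigmax_le => // -[i j] _ /=.
by rewrite (ord1 i).
Qed.

Lemma rV_norm_ge (v : V) i : `|v 0 i| <= `|v|.
Proof.
rewrite [leRHS]/Num.Def.normr/= mx_normrE.
exact: (@le_bigmax _ _ _ 0 (fun ij : 'I_1 * 'I_n => `|v ij.1 ij.2|) (0, i)).
Qed.

(* [cut k h] changes one coordinate at a time, so that the mean value theorem
   applies along each segment from [cut k h] to [cut k.+1 h]. *)
Let cut (k : nat) (h : V) : V := \row_i (if (i < k)%N then h 0 i else 0).

Let cutS (k : 'I_n) h : cut k.+1 h = h 0 k *: delta_mx 0 k + cut k h.
Proof.
apply/rowP => i; rewrite !mxE eqxx /= ltnS leq_eqVlt.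
have [->|ik] := eqVneq i k; first by rewrite eqxx ltnn /= mulr1 addr0.
by rewrite -val_eqE in ik; rewrite (negbTE ik) /= mulr0 add0r.
Qed.

Let near_cut k (h : V) (s d : R) (i : 'I_n) : `|h| < d -> `|s| <= `|h 0 i| ->
  (k <= i)%N -> `|s *: delta_mx 0 i + cut k h| < d.
Proof.
move=> hd sh ki; apply: le_lt_trans hd; apply: rV_norm_le => // j.
rewrite !mxE eqxx /=; have [->|ij] := eqVneq j i.
  rewrite ltnNge ki /= mulr1 addr0; apply: le_trans sh _; exact: rV_norm_ge.
rewrite mulr0 add0r; case: ifP => _; last by rewrite normr0.
exact: rV_norm_ge.
Qed.

(** [class_C] records partial derivatives only, while the chain rule needs a differential. The
    increment of [f] telescopes along the coordinate steps, and on each step the mean value theorem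
    compares it with the partial derivative at [x]. *)
Lemma class_C1_differentiable U f x :
  open U -> class_C 1 U f -> U x -> differentiable f x.
Proof.
move=> oU Cf Ux.
pose L0 := fun h : V => \sum_i h 0 i * partial i f x.
have L_lin : linear L0.
  move=> a u v; rewrite /L0 scaler_sumr -big_split /=; apply: eq_bigr => i _.
  by rewrite !mxE mulrDl /GRing.scale /= mulrA.
pose L : {linear V -> R} := HB.pack L0 (GRing.isLinear.Build _ _ _ _ _ L_lin).
have cL : continuous L.
  change (continuous L0) => h; apply: (cvg_sumr (F := nbhs h)) => i.
  apply: (@continuousM _ _ (fun h : V => h 0 i) (cst (partial i f x)) h).
    exact: coord_continuous.
  exact: cst_continuous.
have fL : f \o shift x = cst (f x) + L +o_ (0 : V) id.
  apply/eqaddoP => e e0.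
  (* Each of the [n] steps may cost this much; the successor keeps the quotient meaningful for
     [n = 0]. *)
  have e1 : 0 < e / n.+1%:R by rewrite divr_gt0.
  have /nbhs_ballP[d /= d0 xd] : \forall y \near x, U y /\
      forall i, `|partial i f x - partial i f y| <= e / n.+1%:R.
    near=> y; split; first by near: y; exact: open_nbhs_nbhs.
    near: y; apply: filter_forall => i.
    have := class_C_continuous (class_C_partial i Cf) Ux.
    by move/cvgrPdist_le; apply.
  have near_x v : `|v| < d -> U (v + x) /\
      forall i, `|partial i f x - partial i f (v + x)| <= e / n.+1%:R.
    by move=> vd; apply: xd; rewrite -ball_normE /= opprD addrC subrK normrN.
  have near0 : \forall h \near (0 : V), `|h| < d by apply: nbhs0_lt.
  near=> h.
  have hd : `|h| < d by near: h.
  have cutn : cut n h = h by apply/rowP => i; rewrite mxE ltn_ord.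
  have cut0 : cut 0 h = 0 by apply/rowP => i; rewrite !mxE ltn0.
  have step (i : 'I_n) :
      `|f (cut i.+1 h + x) - f (cut i h + x) - h 0 i * partial i f x| <=
      e / n.+1%:R * `|h|.
    have dfi s : `|s| <= `|h 0 i| ->
        derivable f (s *: delta_mx 0 i + (cut i h + x)) (delta_mx 0 i).
      move=> sh; rewrite addrA.
      have [Uy _] := near_x _ (near_cut hd sh (leqnn i)).
      exact: class_C_derivable Cf Uy.
    have [s sh] := MVT_line dfi.
    rewrite addrA -cutS => ->; rewrite -mulrBr normrM mulrC.
    apply: ler_pM => //; last exact: rV_norm_ge.
    have [_ /(_ i)] := near_x _ (near_cut hd sh (leqnn i)).
    by rewrite distrC addrA.
  have -> : (f \o shift x - (cst (f x) + L)) h =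
      \sum_(i < n) (f (cut i.+1 h + x) - f (cut i h + x) - h 0 i * partial i f x).
    rewrite sumrB -(big_mkord xpredT (fun i => f (cut i.+1 h + x) - f (cut i h + x))).
    rewrite (@telescope_sumr _ _ _ (fun i => f (cut i h + x))) // cutn cut0 add0r.
    by rewrite opprD addrA.
  apply: le_trans (ler_norm_sum _ _ _) _.
  apply: le_trans (ler_sum _ (fun i _ => step i)) _.
  rewrite sumr_const card_ord -[X in X <= _]mulr_natl mulrA ler_wpM2r //.
  rewrite mulrCA ler_piMr ?(ltW e0) // ler_pdivrMr // mul1r.
  by rewrite ler_nat.
apply/diff_locallyP; have dfE := diff_unique cL fL.
by rewrite dfE.
Unshelve. all: by end_near. Qed.

Lemma mx_differentiable m (g : V -> 'rV[R]_m) x :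
  (forall j, differentiable (fun y => g y 0 j) x) -> differentiable g x.
Proof.
move=> dg.
have -> : g = \sum_(j < m) (fun y => g y 0 j *: delta_mx 0 j).
  by apply/funext => y; rewrite {1}[g y]row_sum_delta fct_sumE.
by apply: differentiable_sum => j; apply: differentiableZl.
Qed.

Lemma class_C1_differentiable_rV m U (g : V -> 'rV[R]_m) x :
  open U -> class_C 1 U g -> U x -> differentiable g x.
Proof.
move=> oU Cg Ux; apply: mx_differentiable => j.
by apply: (class_C1_differentiable oU) => //; exact: (class_C_mxP _ _ oU).1.
Qed.

End C1.

(** * Chain rule *)

Section Chain.
Variables (R : realType) (n m : nat).
Local Notation V := ('rV[R]_n).

Lemma jacobianE U (g : V -> 'rV[R]_m) x i j :
  open U -> class_C 1 U g -> U x ->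
  'J g x i j = partial i (fun y => g y 0 j) x.
Proof.
move=> oU Cg Ux; rewrite -partial_mx; last exact: class_C_derivable Cg Ux.
rewrite /partial deriveEjacobian; last exact: class_C1_differentiable_rV Cg Ux.
by rewrite -rowE !mxE.
Qed.

Lemma partial_comp U U' (f : 'rV[R]_m -> R) (g : V -> 'rV[R]_m) x i :
  open U -> open U' -> class_C 1 U g -> class_C 1 U' f -> U x -> U' (g x) ->
  derivable (f \o g) x (delta_mx 0 i) /\
  partial i (f \o g) x =
  \sum_j partial i (fun y => g y 0 j) x * partial j f (g x).
Proof.
move=> oU oU' Cg Cf Ux U'x.
have dg := class_C1_differentiable_rV oU Cg Ux.
have df := class_C1_differentiable oU' Cf U'x.
have dfg := differentiable_comp dg df.
split; first exact: diff_derivable.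
rewrite {1}/partial deriveE // diff_comp //= -[X in 'd f _ X]deriveE //.
rewrite -/(partial i g x) [partial i g x]row_sum_delta linear_sum.
apply: eq_bigr => j _; rewrite linearZ /= -[X in _ *: X]deriveE //.
by rewrite partial_mx //; exact: class_C_derivable Cg Ux.
Qed.

(** Induction on [k] with [f] generalized and [g] fixed: by the chain rule the derivatives of
    [f \o g] involve the composites [partial j f \o g] with the same [g]. *)
Lemma class_C_comp k U U' (f : 'rV[R]_m -> R) (g : V -> 'rV[R]_m) :
  open U -> open U' -> class_C k U g -> class_C k U' f ->
  (forall x, U x -> U' (g x)) -> class_C k U (f \o g).
Proof.
move=> oU oU' + + UU'; elim: k f => [|k IH] f Cg Cf.
  split=> // x; rewrite inE => Ux; apply: continuous_comp.
    exact: class_C_continuous Cg Ux.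
  exact: class_C_continuous Cf (UU' _ Ux).
have C1 (W : normedModType R) p (D : set 'rV[R]_p) (h : 'rV[R]_p -> W) :
    class_C k.+1 D h -> class_C 1 D h.
  by elim: k {IH Cg Cf} => // k IH /class_CW /IH.
have Cg1 := C1 _ _ _ _ Cg; have Cf1 := C1 _ _ _ _ Cf.
split=> [x|i].
  rewrite inE => Ux; apply: continuous_comp.
    exact: class_C_continuous Cg Ux.
  exact: class_C_continuous Cf (UU' _ Ux).
split=> [x|].
  by rewrite inE => Ux; have [] := partial_comp i oU oU' Cg1 Cf1 Ux (UU' _ Ux).
apply: (@eq_class_C _ _ _ _ _ (\sum_j (fun x =>
    partial i (fun y => g y 0 j) x * partial j f (g x)))) => //.
  move=> x; rewrite inE => Ux.
  have [_ ->] := partial_comp i oU oU' Cg1 Cf1 Ux (UU' _ Ux).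
  by rewrite fct_sumE.
elim/big_ind: _ => [|a b|j _].
- exact: (class_C_cst _ 0 oU).
- exact: class_CD.
- apply: class_CM => //.
    exact: class_C_partial ((class_C_mxP _ _ oU).1 Cg 0 j).
  by apply: IH; [exact: class_CW|exact: class_C_partial].
Qed.

End Chain.

(** * Symmetry of mixed partial derivatives *)

Section Schwarz.
Variables (R : realType) (n : nat).
Local Notation V := ('rV[R]_n).
Local Notation e_ := (delta_mx 0).

Lemma norm_delta_le (i : 'I_n) : `|e_ i : V| <= 1.
Proof.
apply: rV_norm_le => // j; rewrite !mxE eqxx /=.
by case: (j == i); rewrite ?normr1 ?normr0.
Qed.

(* Symmetric in [i] and [j] up to the order of its terms, and close to [t ^+ 2] times
   either mixed derivative. *)
Definition second_difference (f : V -> R) (x : V) (i j : 'I_n) (t : R) : R :=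
  f (t *: e_ i + (t *: e_ j + x)) - f (t *: e_ i + x) - f (t *: e_ j + x) + f x.

(** The mean value theorem is used twice: in direction [i] for the increment [u] of [f] along
    [e_ j], then in direction [j] for [partial i f]. As basis vectors have norm at most 1,
    [t + t < d] keeps every point in the ball. *)
Lemma second_differenceE (f : V -> R) (x : V) (i j : 'I_n) (t d : R) :
  0 < t -> t + t < d -> class_C 2 (ball x d) f ->
  exists2 y, ball x d y &
  second_difference f x i j t = t * (t * partial j (partial i f) y).
Proof.
move=> t0 td Cf.
have small (s s' : R) a b : `|s| <= t -> `|s'| <= t ->
    ball x d (s *: e_ a + (s' *: e_ b + x)).
  move=> st st'; rewrite -ball_normE /= addrA opprD addrCA subrr addr0 normrN.
  apply: le_lt_trans td; apply: le_trans (ler_normD _ _) _.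
  by apply: lerD; rewrite normrZ -[leRHS]mulr1; apply: ler_pM => //; exact: norm_delta_le.
have small1 (s : R) a : `|s| <= t -> ball x d (s *: e_ a + x).
  move=> st; have := small s 0 a a st; rewrite normr0 scale0r add0r.
  by apply; apply: ltW.
pose u := (fun y => f (t *: e_ j + y)) \- f.
have tt : `|t| <= t by rewrite ger0_norm // ltW.
have shiftE (y : V) : derivable f (t *: e_ j + y) (e_ i) ->
    derivable (fun y => f (t *: e_ j + y)) y (e_ i) /\
    'D_(e_ i) (fun y => f (t *: e_ j + y)) y = 'D_(e_ i) f (t *: e_ j + y).
  have E : (fun h : R => h^-1 *: (f (t *: e_ j + (h *: e_ i + y)) - f (t *: e_ j + y)))
     = (fun h : R => h^-1 *: (f (h *: e_ i + (t *: e_ j + y)) - f (t *: e_ j + y))).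
    by apply/funext => h; rewrite addrCA.
  move=> df; rewrite /derivable /derive.
  rewrite -[X in cvg (X @ _)]/(fun h : R => h^-1 *: (f (t *: e_ j + (h *: e_ i + y)) - f (t *:
    e_ j + y))).
  by rewrite -[X in lim (X @ _)]/(fun h : R => h^-1 *: (f (t *: e_ j + (h *: e_ i + y)) - f (t
    *: e_ j + y))) E.
have df (y : V) : ball x d y -> derivable f y (e_ i).
  exact: class_C_derivable Cf.
have [s|s st E] := @MVT_line _ _ u x (e_ i) t.
  rewrite (ger0_norm (ltW t0)) => st; apply: derivableB; last exact/df/small1.
  by have [] := shiftE (s *: e_ i + x); first by rewrite addrCA; apply/df/small.
rewrite (ger0_norm (ltW t0)) in st.
have dts : derivable f (t *: e_ j + (s *: e_ i + x)) (e_ i).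
  by rewrite addrCA; exact/df/small.
have [d1 d2] := shiftE _ dts.
rewrite deriveB // in E; last exact/df/small1.
rewrite d2 in E.
have [s'|s' st' E'] := @MVT_line _ _ (partial i f) (s *: e_ i + x) (e_ j) t.
  rewrite (ger0_norm (ltW t0)) => st'.
  by apply: class_C_derivable (class_C_partial i Cf) _; rewrite addrCA; apply: small.
exists (s' *: e_ j + (s *: e_ i + x)).
  by rewrite (ger0_norm (ltW t0)) in st'; apply/small.
rewrite -[partial j (partial i f) _]/('D_(e_ j) (partial i f) _) -E' -E /u /=.
rewrite /second_difference addrCA. ring.
Qed.

End Schwarz.

Section SchwarzMain.
Variables (R : realType) (n : nat).
Local Notation V := ('rV[R]_n).
Lemma near_dist_le (f : V -> R) (x : V) (e : R) : {for x, continuous f} -> 0 < e ->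
  \forall y \near x, `|f x - f y| <= e.
Proof. by move=> /cvgrPdist_le; apply. Qed.

Lemma partialC (f : V -> R) U x i j : open U -> class_C 2 U f -> U x ->
  partial i (partial j f) x = partial j (partial i f) x.
Proof.
move=> oU Cf Ux; apply/eqP; rewrite -subr_eq0 -normr_eq0; apply/eqP/le_anti.
rewrite normr_ge0 andbT; apply/ler_addgt0Pl => e e0; rewrite addr0.
have e2 : 0 < e / 2 by rewrite divr_gt0.
have cont a b : {for x, continuous (partial a (partial b f))}.
  exact: class_C_continuous (class_C_partial a (class_C_partial b Cf)) Ux.
have /nbhs_ballP[d /= d0 xd] : \forall y \near x, [/\ U y,
    `|partial i (partial j f) x - partial i (partial j f) y| <= e / 2 &
    `|partial j (partial i f) x - partial j (partial i f) y| <= e / 2].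
  have c1 := near_dist_le (cont i j) e2.
  have c2 := near_dist_le (cont j i) e2.
  have c3 : \forall y \near x, U y by exact: open_nbhs_nbhs.
  near=> y; split; [exact: (near c3 y)|exact: (near c1 y)|exact: (near c2 y)].
(* Two successive translations by [t] must stay in the ball of radius [d]; any positive [t < d / 2]
   would serve. *)
pose t := d / 4.
have t0 : 0 < t by rewrite divr_gt0.
have td : t + t < d by rewrite /t; lra.
have Cd : class_C 2 (ball x d) f by apply: class_C_sub Cf => y /xd[].
have [y xy E] := second_differenceE i j t0 td Cd.
have [z xz E'] := second_differenceE j i t0 td Cd.
have : second_difference f x i j t = second_difference f x j i t.
  by rewrite /second_difference addrCA; ring.
rewrite E E' => /(mulfI (lt0r_neq0 t0)) /(mulfI (lt0r_neq0 t0)) Eyz.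
have [_ _ h1] := xd _ xy; have [_ h2 _] := xd _ xz.
move: h1 h2; rewrite Eyz.
move: (partial i _ x) (partial j _ x) (partial i _ z) => a b c h1 h2.
rewrite -(subrKA c) [e]splitr.
by apply: le_trans (ler_normD _ _) _; rewrite lerD // distrC.
Unshelve. all: by end_near. Qed.
End SchwarzMain.

(** * Algebra of maps of class C^k *)

Section Inverse.
Variables (R : realType) (n : nat).
Local Notation V := ('rV[R]_n).
Implicit Types (U : set V) (k : nat).

Lemma class_C_eq (W : normedModType R) k U (f g : V -> W) : open U -> f =1 g ->
  class_C k U f -> class_C k U g.
Proof. by move=> oU fg; apply: eq_class_C oU _ => x _. Qed.

Lemma class_C_sum (I : Type) (r : seq I) (P : pred I) k U (f : I -> V -> R) :
  open U -> (forall i, P i -> class_C k U (f i)) ->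
  class_C k U (fun x => \sum_(i <- r | P i) f i x).
Proof.
move=> oU Cf; elim: r => [|i r IH].
  by apply: (class_C_eq oU _ (class_C_cst _ 0 oU)) => x; rewrite big_nil.
have E x : (if P i then f i x + \sum_(j <- r | P j) f j x
    else \sum_(j <- r | P j) f j x) = \sum_(j <- i :: r | P j) f j x.
  by rewrite big_cons.
apply: (class_C_eq oU E).
case Pi: (P i); last exact: IH.
by apply: class_CD => //; exact: Cf.
Qed.

Lemma class_C_prod (I : Type) (r : seq I) k U (f : I -> V -> R) :
  open U -> (forall i, class_C k U (f i)) ->
  class_C k U (fun x => \prod_(i <- r) f i x).
Proof.
move=> oU Cf; elim: r => [|i r IH].
  by apply: (class_C_eq oU _ (class_C_cst _ (1 : R) oU)) => x; rewrite big_nil.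
have E x : f i x * \prod_(j <- r) f j x = \prod_(j <- i :: r) f j x.
  by rewrite big_cons.
apply: (class_C_eq oU E).
exact: class_CM.
Qed.

Lemma class_CV k U (f : V -> R) : open U -> (forall x, U x -> f x != 0) ->
  class_C k U f -> class_C k U (fun x => (f x)^-1).
Proof.
move=> oU f0; elim: k => [|k IH] Cf.
  split=> // x; rewrite inE => Ux.
  by apply: continuousV; [exact: f0|exact: class_C_continuous Cf Ux].
have CV := IH (class_CW Cf).
split=> [x|i].
  rewrite inE => Ux.
  by apply: continuousV; [exact: f0|exact: class_C_continuous Cf Ux].
have df x : U x -> derivable f x (delta_mx 0 i).
  exact: class_C_derivable Cf.
split=> [x|].
  by rewrite inE => Ux; apply: derivableV; [exact: f0|exact: df].
have C1 := class_CM oU (class_CM oU CV CV) (class_C_partial i Cf).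
apply: (eq_class_C oU _ (class_CM oU (class_C_cst _ (-1 : R) oU) C1)) => x.
rewrite inE => Ux; rewrite /partial (deriveV (f0 _ Ux) (df _ Ux)) /=.
rewrite -[LHS]/(-1 * (((f x)^-1 * (f x)^-1) * 'D_(delta_mx 0 i) f x)).
by rewrite mulN1r -invfM -expr2 /GRing.scale /= mulNr.
Qed.

Lemma class_C_det k U m (h : V -> 'M[R]_m) : open U ->
  (forall a b, class_C k U (fun x => h x a b)) ->
  class_C k U (fun x => \det (h x)).
Proof.
move=> oU Ch; apply: class_C_sum => // s _.
apply: class_CM => //; first exact: class_C_cst.
exact: class_C_prod.
Qed.

(** By Cramer's rule the entries are cofactors divided by the determinant. *)
Lemma class_C_invmx k U m (h : V -> 'M[R]_m) : open U ->
  (forall x, U x -> h x \in unitmx) -> class_C k U h ->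
  forall a b, class_C k U (fun x => invmx (h x) a b).
Proof.
move=> oU uh /(class_C_mxP _ _ oU) Ch a b.
have C1 : class_C k U (fun x => (\det (h x))^-1 * ((-1) ^+ (b + a) * \det (row' b (col' a (h x))))).
  apply: class_CM => //.
    apply: class_CV => //; last exact: class_C_det.
    by move=> x /uh; rewrite unitmxE unitfE.
  apply: class_CM => //; first exact: class_C_cst.
  apply: class_C_det => // c d.
  by apply: (class_C_eq oU _ (Ch (lift b c) (lift a d))) => x; rewrite !mxE.
apply: (eq_class_C oU _ C1) => x; rewrite inE => Ux.
by rewrite /invmx uh // !mxE.
Qed.

End Inverse.

(** * Rules for partial derivatives *)

Section IsPartial.
Variables (R : realType) (n : nat).
Local Notation V := ('rV[R]_n).

Definition has_partial (i : 'I_n) (f : V -> R) (x : V) (d : R) :=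
  is_derive x (delta_mx 0 i : V) f d.

Lemma has_partialE i (f : V -> R) (x : V) d : has_partial i f x d -> partial i f x = d.
Proof. by move=> fd; exact: (@derive_val _ _ _ _ _ _ _ fd). Qed.

Lemma class_C_has_partial k U i (f : V -> R) (x : V) :
  class_C k.+1 U f -> U x -> has_partial i f x (partial i f x).
Proof. by move=> Cf Ux; apply/derivableP; exact: class_C_derivable Cf Ux. Qed.

Lemma eq_has_partial i (f g : V -> R) (x : V) d d' :
  (\near x, f x = g x) -> d = d' -> has_partial i f x d -> has_partial i g x d'.
Proof. by move=> fg <-; exact: near_eq_is_derive. Qed.

Lemma has_partialD i (f g : V -> R) (x : V) df dg :
  has_partial i f x df -> has_partial i g x dg ->
  has_partial i (fun y => f y + g y) x (df + dg).
Proof. by move=> hf hg; exact: is_deriveD. Qed.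

Lemma has_partialB i (f g : V -> R) (x : V) df dg :
  has_partial i f x df -> has_partial i g x dg ->
  has_partial i (fun y => f y - g y) x (df - dg).
Proof. by move=> hf hg; exact: is_deriveB. Qed.

Lemma has_partialM i (f g : V -> R) (x : V) df dg :
  has_partial i f x df -> has_partial i g x dg ->
  has_partial i (fun y => f y * g y) x (df * g x + f x * dg).
Proof.
move=> hf hg.
have H : has_partial i (f * g) x (f x *: dg + g x *: df) by exact: is_deriveM.
apply: eq_has_partial H; first by near=> y.
by rewrite addrC [g x *: _]mulrC.
Unshelve. all: by end_near. Qed.

Lemma has_partialZ i (c : R) (f : V -> R) (x : V) df :
  has_partial i f x df -> has_partial i (fun y => c * f y) x (c * df).
Proof. by move=> hf; exact: is_deriveZ. Qed.

Lemma has_partial_sum (I : Type) (r : seq I) i (f : I -> V -> R) (x : V) df :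
  (forall j, has_partial i (f j) x (df j)) ->
  has_partial i (fun y => \sum_(j <- r) f j y) x (\sum_(j <- r) df j).
Proof.
move=> hf; elim: r => [|j r IH].
  have H : has_partial i (cst 0) x 0 by exact: is_derive_cst.
  apply: eq_has_partial H; last by rewrite big_nil.
  by near=> y; rewrite big_nil.
have H := has_partialD (hf j) IH.
apply: eq_has_partial H; last by rewrite big_cons.
by near=> y; rewrite big_cons.
Unshelve. all: by end_near. Qed.

End IsPartial.

(** * Contraction of tensors with vectors *)

Section Contraction.
Variables (R : comPzRingType) (I : finType).
Implicit Types (u v : I -> R) (F G : I -> R).

(** Value of a covector on a vector. Nesting it evaluates a covariant tensor, and a change of
    coordinates amounts to evaluating the tensor on rows of the Jacobian. *)
Definition ctr F u : R := \sum_a u a * F a.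

Lemma eq_ctr F G u : F =1 G -> ctr F u = ctr G u.
Proof. by move=> FG; apply: eq_bigr => a _; rewrite FG. Qed.

Lemma ctrD F G u : ctr (fun a => F a + G a) u = ctr F u + ctr G u.
Proof. by rewrite -big_split; apply: eq_bigr => a _; rewrite mulrDr. Qed.

Lemma ctrZ c F u : ctr (fun a => c * F a) u = c * ctr F u.
Proof. by rewrite mulr_sumr; apply: eq_bigr => a _; rewrite mulrCA. Qed.

Lemma ctrZr c F u : ctr (fun a => F a * c) u = ctr F u * c.
Proof. by rewrite mulr_suml; apply: eq_bigr => a _; rewrite mulrA. Qed.

Lemma ctrC (K : I -> I -> R) u v :
  ctr (fun a => ctr (fun b => K a b) v) u = ctr (fun b => ctr (fun a => K a b) u) v.
Proof.
rewrite /ctr; under eq_bigr do rewrite mulr_sumr.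
rewrite exchange_big; apply: eq_bigr => b _.
by rewrite mulr_sumr; apply: eq_bigr => a _; rewrite mulrCA.
Qed.

Lemma ctr_sum (J : finType) (F : J -> I -> R) u :
  ctr (fun a => \sum_j F j a) u = \sum_j ctr (F j) u.
Proof. by rewrite /ctr; under eq_bigr do rewrite mulr_sumr; rewrite exchange_big. Qed.

End Contraction.

(** * The curvature tensor as a function of the 2-jet of the metric *)

Section Jets.
Variables (R : realType) (n : nat).
Local Notation V := ('rV[R]_n).
Implicit Types (i j k l m p : 'I_n).

(* Christoffel symbols of the first kind. Once the indices are lowered, the curvature
   contains no derivative of the inverse metric [g]. *)
Definition jchr (d1 : 'I_n -> 'I_n -> 'I_n -> R) k i j : R :=
  2^-1 * (d1 i j k + d1 j i k - d1 k i j).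

(** The classical formula for the covariant curvature tensor, [g] being the inverse metric. The jet
    is given by arbitrary arrays, so that the formula also applies to the limit jet at e = 0 and is
    visibly continuous. *)
Definition jcurv (g : 'M[R]_n) (d1 : 'I_n -> 'I_n -> 'I_n -> R)
    (d2 : 'I_n -> 'I_n -> 'I_n -> 'I_n -> R) i j k l : R :=
  2^-1 * (d2 i l j k + d2 j k i l - d2 i k j l - d2 j l i k)
  - \sum_m \sum_p g m p * (jchr d1 m i k * jchr d1 p j l
                           - jchr d1 m j k * jchr d1 p i l).

(** [G] and [dG] stand for the Christoffel symbols of the second kind and their derivatives. They
    are controlled through their lowered forms: the last hypothesis is the product rule applied to
    the one before it. *)
Lemma lowered_curvature (hx g : 'M[R]_n) (d1 : 'I_n -> 'I_n -> 'I_n -> R)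
    (d2 dG : 'I_n -> 'I_n -> 'I_n -> 'I_n -> R) (G : 'I_n -> 'I_n -> 'I_n -> R)
    i j k l :
  (forall c a b, d1 c a b = d1 c b a) ->
  (forall d c a b, d2 d c a b = d2 d c b a) ->
  (forall d c a b, d2 d c a b = d2 c d a b) ->
  (forall m a b, G m a b = \sum_p g m p * jchr d1 p a b) ->
  (forall a b c, \sum_m G m a b * hx m c = jchr d1 c a b) ->
  (forall d a b c, \sum_m dG d m a b * hx m c =
    2^-1 * (d2 d a b c + d2 d b a c - d2 d c a b) - \sum_m G m a b * d1 d m c) ->
  \sum_m (dG i m j l - dG j m i l
    + \sum_p (G m i p * G p j l - G m j p * G p i l)) * hx m k
  = jcurv g d1 d2 i j k l.
Proof.
move=> d1s d2s d2C GE GL dGL; pose L := jchr d1.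
transitivity ((\sum_m dG i m j l * hx m k) - (\sum_m dG j m i l * hx m k)
  + \sum_p (L k i p * G p j l - L k j p * G p i l)).
  rewrite -sumrB; under [X in _ = _ + X]eq_bigr => p _ do
    rewrite /L -!GL !mulr_suml -sumrB.
  rewrite [X in _ = _ + X]exchange_big -big_split /=; apply: eq_bigr => m _.
  rewrite mulrDl mulrBl mulr_suml; congr (_ + _); apply: eq_bigr => p _.
  by ring.
rewrite !dGL /jcurv.
have -> : \sum_m \sum_p g m p * (L m i k * L p j l - L m j k * L p i l)
  = \sum_m (L m i k * G m j l - L m j k * G m i l).
  apply: eq_bigr => m _; rewrite !GE !mulr_sumr -sumrB.
  by apply: eq_bigr => p _; rewrite /L; ring.
(* Compatibility of the connection with the metric: [d1 i m k] is the sum of [L k i m] and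
   [L m i k]. *)
have -> : \sum_p (L k i p * G p j l - L k j p * G p i l) =
  \sum_m G m j l * d1 i m k - \sum_m G m i l * d1 j m k
  - \sum_m (L m i k * G m j l - L m j k * G m i l).
  rewrite -!sumrB; apply: eq_bigr => m _; rewrite /L /jchr.
  by rewrite !(d1s _ k m); field.
rewrite !(d2s _ _ l) !(d2C _ k) (d2C j i).
by field.
Qed.

Definition jet1 (h : V -> 'M[R]_n) (x : V) c a b : R :=
  partial c (fun y => h y a b) x.

Definition jet2 (h : V -> 'M[R]_n) (x : V) d c a b : R :=
  partial d (partial c (fun y => h y a b)) x.

Variables (h : V -> 'M[R]_n) (U : set V).
Hypotheses (oU : open U) (Ch : class_C 2 U h).
Hypotheses (sym_h : forall x, U x -> (h x)^T = h x).

Let Che a b : class_C 2 U (fun y => h y a b).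
Proof. exact: (class_C_mxP _ _ oU).1. Qed.

Lemma near_in_open (P : V -> Prop) (x : V) :
  U x -> (forall y, U y -> P y) -> \near x, P x.
Proof. by move=> Ux UP; near=> y; apply: UP; near: y; exact: open_nbhs_nbhs.
Unshelve. all: by end_near. Qed.

Lemma jet1_sym x c a b : U x -> jet1 h x c a b = jet1 h x c b a.
Proof.
move=> Ux; apply: eq_partial; apply: near_in_open => // y Uy.
by rewrite -[in LHS](sym_h Uy) mxE.
Qed.

Lemma jet2_sym x d c a b : U x -> jet2 h x d c a b = jet2 h x d c b a.
Proof.
move=> Ux; apply: eq_partial; apply: near_in_open => // y Uy.
exact: jet1_sym.
Qed.

Lemma jet2C x d c a b : U x -> jet2 h x d c a b = jet2 h x c d a b.
Proof. by move=> Ux; apply: partialC oU _ Ux. Qed.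

Lemma has_jet2 x d c a b : U x ->
  has_partial d (fun y => jet1 h y c a b) x (jet2 h x d c a b).
Proof. by move=> Ux; exact: class_C_has_partial (class_C_partial _ (Che a b)) Ux. Qed.

Lemma christoffelE k i j x :
  christoffel h k i j x = \sum_l invmx (h x) k l * jchr (jet1 h x) l i j.
Proof.
rewrite /christoffel mulr_sumr; apply: eq_bigr => l _.
by rewrite mulrCA.
Qed.

Hypothesis uh : forall x, U x -> h x \in unitmx.

Lemma christoffel_lower k j l x : U x ->
  \sum_m christoffel h m j l x * h x m k = jchr (jet1 h x) k j l.
Proof.
move=> Ux.
have E q : \sum_m invmx (h x) m q * h x m k = (q == k)%:R.
  have := mulmxV (uh Ux) => /matrixP/(_ k q); rewrite !mxE eq_sym => <-.
  by apply: eq_bigr => m _; rewrite mulrC -{1}(sym_h Ux) mxE.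
under eq_bigr do rewrite christoffelE mulr_suml.
rewrite exchange_big /= (bigD1 k) //= [X in _ + X]big1 ?addr0 => [|q qk].
  under eq_bigr do rewrite mulrAC.
  by rewrite -mulr_suml E eqxx mul1r.
under eq_bigr do rewrite mulrAC.
by rewrite -mulr_suml E (negbTE qk) mul0r.
Qed.

Lemma christoffel_has_partial i m j l x : U x ->
  has_partial i (christoffel h m j l) x (partial i (christoffel h m j l) x).
Proof.
move=> Ux; have Cinv := class_C_invmx oU uh (class_CW Ch).
apply: (class_C_has_partial (k := 0) (U := U)) => //.
have E y : \sum_q invmx (h y) m q * jchr (jet1 h y) q j l = christoffel h m j l y.
  by rewrite christoffelE.
apply: (class_C_eq oU E); apply: class_C_sum => // q _.
apply: class_CM => //; apply: class_CM => //; first exact: class_C_cst.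
have C1 c a b : class_C 1 U (fun y => jet1 h y c a b).
  exact: class_C_partial (Che a b).
apply: class_CD => //; first exact: class_CD.
have E' y : -1 * jet1 h y q j l = - jet1 h y q j l by rewrite mulN1r.
apply: (class_C_eq oU E'); apply: class_CM => //.
exact: (class_C_cst _ (-1 : R)).
Qed.

(** Differentiating both sides of [christoffel_lower], instead of the definition, keeps derivatives
    of the inverse metric out of the formula. *)
Lemma christoffel_partial i m j l k x : U x ->
  \sum_m partial i (christoffel h m j l) x * h x m k =
  2^-1 * (jet2 h x i j l k + jet2 h x i l j k - jet2 h x i k j l)
  - \sum_m christoffel h m j l x * jet1 h x i m k.
Proof.
move=> Ux; apply/eqP; rewrite eq_sym subr_eq -big_split /= eq_sym; apply/eqP.
have H : has_partial i (fun y => \sum_m christoffel h m j l y * h y m k) x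
    (\sum_m (partial i (christoffel h m j l) x * h x m k
             + christoffel h m j l x * jet1 h x i m k)).
  apply: has_partial_sum => q; apply: has_partialM.
    exact: christoffel_has_partial.
  exact: class_C_has_partial (Che q k) Ux.
rewrite -(has_partialE H).
have H' : has_partial i (fun y => jchr (jet1 h y) k j l) x
  (2^-1 * (jet2 h x i j l k + jet2 h x i l j k - jet2 h x i k j l)).
  apply: has_partialZ; apply: has_partialB; last exact: has_jet2.
  by apply: has_partialD; exact: has_jet2.
rewrite -(has_partialE H'); apply: eq_partial.
by apply: near_in_open => // y; exact: christoffel_lower.
Qed.

Lemma curvE i j k l x : U x ->
  curv h i j k l x = jcurv (invmx (h x)) (jet1 h x) (jet2 h x) i j k l.
Proof.
move=> Ux; apply: (@lowered_curvature (h x) (invmx (h x)) (jet1 h x) (jet2 h x)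
  (fun i m j l => partial i (christoffel h m j l) x)
  (fun m j l => christoffel h m j l x)).
- by move=> *; exact: jet1_sym.
- by move=> *; exact: jet2_sym.
- by move=> *; exact: jet2C.
- by move=> *; exact: christoffelE.
- by move=> *; exact: christoffel_lower.
- by move=> *; exact: christoffel_partial.
Qed.

End Jets.

Section Contractions.
Variables (R : realType) (n : nat).
Local Notation I := 'I_n.
Local Notation vec := (I -> R).

Definition ctr2 (X : I -> I -> R) (u v : vec) := ctr (fun a => ctr (X a) v) u.
Definition ctr3 (X : I -> I -> I -> R) (u v w : vec) :=
  ctr (fun a => ctr2 (X a) v w) u.
Definition ctr4 (X : I -> I -> I -> I -> R) (u v w z : vec) :=
  ctr (fun a => ctr3 (X a) v w z) u.

Lemma eq_ctr2 X Y u v : (forall a b, X a b = Y a b) -> ctr2 X u v = ctr2 Y u v.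
Proof. by move=> XY; apply: eq_ctr => a; apply: eq_ctr => b. Qed.
Lemma eq_ctr3 X Y u v w : (forall a b c, X a b c = Y a b c) ->
  ctr3 X u v w = ctr3 Y u v w.
Proof. by move=> XY; apply: eq_ctr => a; apply: eq_ctr2 => b. Qed.
Lemma eq_ctr4 X Y u v w z : (forall a b c d, X a b c d = Y a b c d) ->
  ctr4 X u v w z = ctr4 Y u v w z.
Proof. by move=> XY; apply: eq_ctr => a; apply: eq_ctr3 => b. Qed.

Lemma ctr2C X u v : ctr2 X u v = ctr2 (fun b a => X a b) v u.
Proof. exact: ctrC. Qed.
Lemma ctr3C12 X u v w : ctr3 X u v w = ctr3 (fun b a => X a b) v u w.
Proof. exact: ctrC. Qed.
Lemma ctr3C23 X u v w : ctr3 X u v w = ctr3 (fun a c b => X a b c) u w v.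
Proof. by apply: eq_ctr => a; exact: ctr2C. Qed.
Lemma ctr4C12 X u v w z : ctr4 X u v w z = ctr4 (fun b a => X a b) v u w z.
Proof. exact: ctrC. Qed.
Lemma ctr4C23 X u v w z : ctr4 X u v w z = ctr4 (fun a c b => X a b c) u w v z.
Proof. by apply: eq_ctr => a; exact: ctr3C12. Qed.
Lemma ctr4C34 X u v w z :
  ctr4 X u v w z = ctr4 (fun a b d c => X a b c d) u v z w.
Proof. by apply: eq_ctr => a; exact: ctr3C23. Qed.

Lemma ctr2D X Y u v : ctr2 (fun a b => X a b + Y a b) u v = ctr2 X u v + ctr2 Y u v.
Proof. by rewrite -ctrD; apply: eq_ctr => a; rewrite -ctrD. Qed.
Lemma ctr2Z x X u v : ctr2 (fun a b => x * X a b) u v = x * ctr2 X u v.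
Proof. by rewrite -ctrZ; apply: eq_ctr => a; rewrite -ctrZ. Qed.
Lemma ctr3D X Y u v w :
  ctr3 (fun a b c => X a b c + Y a b c) u v w = ctr3 X u v w + ctr3 Y u v w.
Proof. by rewrite -ctrD; apply: eq_ctr => a; rewrite -ctr2D. Qed.
Lemma ctr3Z x X u v w : ctr3 (fun a b c => x * X a b c) u v w = x * ctr3 X u v w.
Proof. by rewrite -ctrZ; apply: eq_ctr => a; rewrite -ctr2Z. Qed.
Lemma ctr3B X Y u v w :
  ctr3 (fun a b c => X a b c - Y a b c) u v w = ctr3 X u v w - ctr3 Y u v w.
Proof.
rewrite -mulN1r -ctr3Z -ctr3D.
by apply: eq_ctr3 => a b c; rewrite mulN1r.
Qed.
Lemma ctr4D X Y u v w z :
  ctr4 (fun a b c d => X a b c d + Y a b c d) u v w z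
  = ctr4 X u v w z + ctr4 Y u v w z.
Proof. by rewrite -ctrD; apply: eq_ctr => a; rewrite -ctr3D. Qed.
Lemma ctr4Z x X u v w z :
  ctr4 (fun a b c d => x * X a b c d) u v w z = x * ctr4 X u v w z.
Proof. by rewrite -ctrZ; apply: eq_ctr => a; rewrite -ctr3Z. Qed.
Lemma ctr4B X Y u v w z :
  ctr4 (fun a b c d => X a b c d - Y a b c d) u v w z
  = ctr4 X u v w z - ctr4 Y u v w z.
Proof.
rewrite -mulN1r -ctr4Z -ctr4D.
by apply: eq_ctr4 => a b c d; rewrite mulN1r.
Qed.

Lemma ctr4M X Y u v w z :
  ctr4 (fun a b c d => X a c * Y b d) u v w z = ctr2 X u w * ctr2 Y v z.
Proof.
rewrite ctr4C23 /ctr4 -[RHS]ctrZr; apply: eq_ctr => a.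
rewrite -ctrZr; apply: eq_ctr => b.
exact: ctr2Z.
Qed.

Lemma ctr4_sum (J : finType) (X : J -> I -> I -> I -> I -> R) u v w z :
  ctr4 (fun a b c d => \sum_j X j a b c d) u v w z = \sum_j ctr4 (X j) u v w z.
Proof.
rewrite -ctr_sum; apply: eq_ctr => a; rewrite -ctr_sum; apply: eq_ctr => b.
rewrite -ctr_sum; apply: eq_ctr => c; exact: ctr_sum.
Qed.

(** Duality: the frame change [J] moves from the covariant tensor [K] to the contravariant tensor
    [X], on which it acts by congruence. *)
Lemma contract_mx (J X : 'M[R]_n) (K : I -> I -> R) :
  \sum_i \sum_k X i k * ctr2 K (J i) (J k) =
  \sum_a \sum_b (J^T *m X *m J) a b * K a b.
Proof.
transitivity (\sum_i \sum_k \sum_a \sum_b X i k * (J i a * (J k b * K a b))).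
  apply: eq_bigr => i _; apply: eq_bigr => k _; rewrite /ctr2 /ctr mulr_sumr.
  by apply: eq_bigr => a _; rewrite !mulr_sumr.
under eq_bigr do rewrite exchange_big.
rewrite exchange_big; apply: eq_bigr => a _ /=.
under eq_bigr do rewrite exchange_big.
rewrite exchange_big; apply: eq_bigr => b _ /=.
rewrite exchange_big /= mxE mulr_suml; apply: eq_bigr => k _.
rewrite mxE !mulr_suml; apply: eq_bigr => i _; rewrite mxE; ring.
Qed.

Lemma contract_quad (J X : 'M[R]_n) (u v : vec) :
  \sum_i \sum_k X i k * (ctr u (J i) * ctr v (J k)) =
  \sum_a \sum_b (J^T *m X *m J) a b * (u a * v b).
Proof.
rewrite -contract_mx; apply: eq_bigr => i _; apply: eq_bigr => k _.
by rewrite /ctr2 -ctrZr; congr (_ * _); apply: eq_ctr => a; rewrite ctrZ.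
Qed.

End Contractions.

Lemma conj_invmx (R : comUnitRingType) n (J h : 'M[R]_n) :
  J \in unitmx -> h \in unitmx ->
  J^T *m invmx (J *m h *m J^T) *m J = invmx h.
Proof.
move=> uJ uh.
have -> : invmx (J *m h *m J^T) = invmx J^T *m invmx h *m invmx J.
  have ujt : J^T \in unitmx by rewrite unitmx_tr.
  have u1 : J *m h *m J^T \in unitmx by rewrite !unitmx_mul uJ uh.
  have E : J *m h *m J^T *m (invmx J^T *m invmx h *m invmx J) = 1%:M.
    by rewrite !mulmxA mulmxK // mulmxK // mulmxV.
  by rewrite -(mulKmx u1 (invmx J^T *m _ *m _)) E mulmx1.
by rewrite !mulmxA mulmxV ?unitmx_tr // mul1mx mulmxKV.
Qed.

(** * Tensoriality of the curvature *)

Section JetTensor.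
Variables (R : realType) (n : nat) (h : 'M[R]_n).
Local Notation I := 'I_n.
Variables (d1 : I -> I -> I -> R) (d2 : I -> I -> I -> I -> R).
Variables (J : 'M[R]_n) (Q : I -> I -> I -> R) (T : I -> I -> I -> I -> R).
Hypotheses (sym_h : h^T = h) (uh : h \in unitmx) (uJ : J \in unitmx).
Hypotheses (sym_d1 : forall c a b, d1 c a b = d1 c b a).
Hypotheses (QC : forall a b, Q a b = Q b a).
Hypotheses (TC12 : forall a b c, T a b c = T b a c)
  (TC23 : forall a b c, T a b c = T a c b).

(* The jets of [x |-> 'J phi x *m h (phi x) *m ('J phi x)^T], where [Q] and [T] are the
   second and third partial derivatives of [phi]. *)
Definition pull_jet1 k i j : R :=
  ctr3 d1 (J k) (J i) (J j) + ctr2 h (J i) (Q k j) + ctr2 h (Q k i) (J j).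

Definition pull_jet2 l k i j : R :=
  ctr4 d2 (J l) (J k) (J i) (J j) + ctr3 d1 (J k) (J i) (Q l j)
  + ctr3 d1 (J k) (Q l i) (J j) + ctr3 d1 (Q l k) (J i) (J j)
  + (ctr3 d1 (J l) (J i) (Q k j) + ctr2 h (J i) (T l k j) + ctr2 h (Q l i) (Q k j))
  + (ctr3 d1 (J l) (Q k i) (J j) + ctr2 h (Q k i) (Q l j) + ctr2 h (T l k i) (J j)).

Let s2 u v : ctr2 h u v = ctr2 h v u.
Proof.
by rewrite ctr2C; apply: eq_ctr2 => a b; rewrite -[in LHS]sym_h mxE.
Qed.

Let s3 u v w : ctr3 d1 u v w = ctr3 d1 u w v.
Proof. by rewrite ctr3C23; apply: eq_ctr3 => a b c; rewrite sym_d1. Qed.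

Let Ch (u v : I -> R) (a : I) : R := ctr2 (jchr d1 a) u v.

Let ChE u v w : ctr (Ch u v) w =
  2^-1 * (ctr3 d1 u v w + ctr3 d1 v u w - ctr3 d1 w u v).
Proof.
rewrite -[LHS]/(ctr3 (jchr d1) w u v) /jchr ctr3Z ctr3B ctr3D; congr (_ * (_ + _ - _)).
  by rewrite ctr3C12 ctr3C23.
by rewrite ctr3C23 ctr3C12 ctr3C23.
Qed.

(** The inhomogeneous transformation law of Christoffel symbols: a tensorial part plus the second
    derivatives of the coordinate change, lowered by [h]. *)
Let jchr_pull m i k : jchr pull_jet1 m i k =
  ctr (fun a => Ch (J i) (J k) a + ctr (h a) (Q i k)) (J m).
Proof.
rewrite ctrD ChE /jchr /pull_jet1 -[ctr (fun a => ctr (h a) _) _]/(ctr2 h (J m) (Q i k)).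
rewrite (s2 (Q i k)) (s2 (Q k i)) (s2 (Q m i)) (QC k i) (QC m i) (QC m k).
by rewrite (s2 (J k) (Q i m)); field.
Qed.

(** The inverse metric cancels one factor [h], so the terms in [u] and [v], later second derivatives
    of the coordinate change, come out free of [invmx h]. *)
Let quad (X Y : I -> R) (u v : I -> R) :
  \sum_a \sum_b invmx h a b * ((X a + ctr (h a) u) * (Y b + ctr (h b) v)) =
  \sum_a \sum_b invmx h a b * (X a * Y b) + ctr X v + ctr Y u + ctr2 h u v.
Proof.
have E (w : I -> R) b : \sum_a invmx h b a * ctr (h a) w = w b.
  rewrite /ctr; under eq_bigr do rewrite mulr_sumr; rewrite exchange_big /=.
  rewrite (bigD1 b) //= [X in _ + X]big1 ?addr0 => [|c cb].
    under eq_bigr do rewrite mulrCA.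
    rewrite -mulr_sumr; have := mulVmx uh => /matrixP/(_ b b).
    by rewrite !mxE eqxx => ->; rewrite mulr1.
  under eq_bigr do rewrite mulrCA.
  rewrite -mulr_sumr; have := mulVmx uh => /matrixP/(_ b c).
  by rewrite !mxE eq_sym (negbTE cb) => ->; rewrite mulr0.
have si a b : invmx h a b = invmx h b a.
  by rewrite -[in LHS]sym_h -trmx_inv mxE.
have E1 Z : \sum_a \sum_b invmx h a b * (Z a * ctr (h b) v) = ctr Z v.
  apply: eq_bigr => a _; under eq_bigr do rewrite mulrCA.
  by rewrite -mulr_sumr E mulrC.
have E2 : \sum_a \sum_b invmx h a b * (ctr (h a) u * Y b) = ctr Y u.
  rewrite exchange_big; apply: eq_bigr => b _ /=.
  under eq_bigr do rewrite mulrA si.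
  by rewrite -mulr_suml E.
have E3 : \sum_a \sum_b invmx h a b * (ctr (h a) u * ctr (h b) v) = ctr2 h u v.
  by rewrite (E1 (fun a => ctr (h a) u)) s2.
rewrite -(E1 X) -E2 -E3 -!big_split /=; apply: eq_bigr => a _.
by rewrite -!big_split /=; apply: eq_bigr => b _; ring.
Qed.

(** The third derivatives [T] cancel among the four second-derivative terms by symmetry. The terms
    in [Q] left there cancel against those that [quad] extracts from the products of Christoffel
    symbols. *)
Lemma jcurv_pull i j k l :
  jcurv (invmx (J *m h *m J^T)) pull_jet1 pull_jet2 i j k l =
  ctr4 (jcurv (invmx h) d1 d2) (J i) (J j) (J k) (J l).
Proof.
have JhJ := conj_invmx uJ uh.
have quadE a' c' b' d' :
  \sum_m \sum_p invmx (J *m h *m J^T) m p * (jchr pull_jet1 m a' c' * jchr pull_jet1 p b' d')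
  = \sum_a \sum_b invmx h a b * (Ch (J a') (J c') a * Ch (J b') (J d') b)
    + ctr (Ch (J a') (J c')) (Q b' d') + ctr (Ch (J b') (J d')) (Q a' c') + ctr2 h (Q a' c') (Q
      b' d').
  under eq_bigr do under eq_bigr do rewrite !jchr_pull.
  by rewrite contract_quad JhJ quad.
have sumB a' c' b' d' :
  \sum_a \sum_b invmx h a b * (Ch (J a') (J c') a * Ch (J b') (J d') b)
  = ctr4 (fun a b c d => \sum_m \sum_p invmx h m p * (jchr d1 m a c * jchr d1 p b d))
    (J a') (J b') (J c') (J d').
  rewrite ctr4_sum; apply: eq_bigr => m _; rewrite ctr4_sum; apply: eq_bigr => p _.
  by rewrite ctr4Z ctr4M.
have split_quad (g : 'M[R]_n) (X Y Z W : I -> R) :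
  \sum_m \sum_p g m p * (X m * Y p - Z m * W p) =
  \sum_m \sum_p g m p * (X m * Y p) - \sum_m \sum_p g m p * (Z m * W p).
  by rewrite -sumrB; apply: eq_bigr => m _; rewrite -sumrB; apply: eq_bigr => p _; rewrite mulrBr.
pose F a b c d := \sum_m \sum_p invmx h m p * (jchr d1 m a c * jchr d1 p b d).
pose D a b c d := d2 a d b c + d2 b c a d - d2 a c b d - d2 b d a c.
have -> : ctr4 (jcurv (invmx h) d1 d2) (J i) (J j) (J k) (J l) =
    2^-1 * ctr4 D (J i) (J j) (J k) (J l)
    - (ctr4 F (J i) (J j) (J k) (J l) - ctr4 F (J j) (J i) (J k) (J l)).
  rewrite [ctr4 F (J j) _ _ _]ctr4C12 -!ctr4B -ctr4Z -ctr4B.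
  apply: eq_ctr4 => a b c d; congr (_ - _).
  exact: (split_quad _ (jchr d1 ^~ a ^~ c) (jchr d1 ^~ b ^~ d)).
have DE : ctr4 D (J i) (J j) (J k) (J l) =
    ctr4 d2 (J i) (J l) (J j) (J k) + ctr4 d2 (J j) (J k) (J i) (J l)
    - ctr4 d2 (J i) (J k) (J j) (J l) - ctr4 d2 (J j) (J l) (J i) (J k).
  have -> : ctr4 d2 (J i) (J l) (J j) (J k) =
      ctr4 (fun a b c d => d2 a d b c) (J i) (J j) (J k) (J l).
    by rewrite ctr4C23 ctr4C34.
  have -> : ctr4 d2 (J j) (J k) (J i) (J l) =
      ctr4 (fun a b c d => d2 b c a d) (J i) (J j) (J k) (J l).
    by rewrite ctr4C23 ctr4C12.
  have -> : ctr4 d2 (J i) (J k) (J j) (J l) =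
      ctr4 (fun a b c d => d2 a c b d) (J i) (J j) (J k) (J l).
    by rewrite ctr4C23.
  have -> : ctr4 d2 (J j) (J l) (J i) (J k) =
      ctr4 (fun a b c d => d2 b d a c) (J i) (J j) (J k) (J l).
    by rewrite ctr4C23 ctr4C12 ctr4C34.
  by rewrite -ctr4D -!ctr4B.
rewrite DE -!sumB {DE}.
rewrite /jcurv (split_quad _ (jchr pull_jet1 ^~ i ^~ k) (jchr pull_jet1 ^~ j ^~ l)).
rewrite !quadE !ChE /pull_jet2.
(* The symmetries are used to bring the indices of [Q] and [T], and the arguments of the
   contractions, to one fixed order, so that [field] identifies equal terms. *)
pose Q2 := (QC l k, QC l j, QC l i, QC k j, QC k i, QC j i).
pose T2 := (TC12 l k, TC12 l j, TC12 l i, TC12 k j, TC12 k i, TC12 j i,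
  TC23 _ l k, TC23 _ l j, TC23 _ l i, TC23 _ k j, TC23 _ k i, TC23 _ j i).
rewrite !Q2 !T2 !(s2 (T _ _ _)) !(s3 _ (J _) (Q _ _)).
rewrite ?(s3 _ (J l) (J k)) ?(s3 _ (J l) (J j)) ?(s3 _ (J l) (J i))
  ?(s3 _ (J k) (J j)) ?(s3 _ (J k) (J i)) ?(s3 _ (J j) (J i)).
rewrite ?(s2 (Q j k) (Q i l)) ?(s2 (Q j l) (Q i k)) ?(s2 (Q k l) (Q i j)).
rewrite !sumB /F.
by field.
Qed.
End JetTensor.

(** * Curvature of a pulled back metric *)

Section Pullback.
Variables (R : realType) (n : nat).
Local Notation V := ('rV[R]_n).
Local Notation I := 'I_n.

Lemma has_partial_ctr i (F : V -> I -> R) (u : V -> I -> R) (x : V) dF du :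
  (forall a, has_partial i (F ^~ a) x (dF a)) ->
  (forall a, has_partial i (u ^~ a) x (du a)) ->
  has_partial i (fun y => ctr (F y) (u y)) x (ctr dF (u x) + ctr (F x) du).
Proof.
move=> hF hu; rewrite /ctr addrC -big_split /=.
by apply: has_partial_sum => a; exact: has_partialM.
Qed.

Lemma has_partial_ctr2 i (F : V -> I -> I -> R) (u v : V -> I -> R) (x : V) dF du dv :
  (forall a b, has_partial i (fun y => F y a b) x (dF a b)) ->
  (forall a, has_partial i (u ^~ a) x (du a)) ->
  (forall a, has_partial i (v ^~ a) x (dv a)) ->
  has_partial i (fun y => ctr2 (F y) (u y) (v y)) x
    (ctr2 dF (u x) (v x) + ctr2 (F x) (u x) dv + ctr2 (F x) du (v x)).
Proof.
move=> hF hu hv; rewrite -[X in X + _]ctrD; apply: has_partial_ctr => // a.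
exact: has_partial_ctr.
Qed.

Lemma has_partial_ctr3 i (F : V -> I -> I -> I -> R) (u v w : V -> I -> R) (x : V)
    dF du dv dw :
  (forall a b c, has_partial i (fun y => F y a b c) x (dF a b c)) ->
  (forall a, has_partial i (u ^~ a) x (du a)) ->
  (forall a, has_partial i (v ^~ a) x (dv a)) ->
  (forall a, has_partial i (w ^~ a) x (dw a)) ->
  has_partial i (fun y => ctr3 (F y) (u y) (v y) (w y)) x
    (ctr3 dF (u x) (v x) (w x) + ctr3 (F x) (u x) (v x) dw
     + ctr3 (F x) (u x) dv (w x) + ctr3 (F x) du (v x) (w x)).
Proof.
move=> hF hu hv hw; rewrite -[X in X + _ + _]ctrD -[X in X + _]ctrD; apply: has_partial_ctr => // a.
exact: has_partial_ctr2.
Qed.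

Variables (phi : V -> V) (h h' : V -> 'M[R]_n) (U U' : set V).
Hypotheses (oU : open U) (oU' : open U').
Hypotheses (Cphi : class_C 3 U phi) (Ch : class_C 2 U' h).
Hypotheses (UU' : forall y, U y -> U' (phi y)).
Hypotheses (uJ : forall y, U y -> 'J phi y \in unitmx).
Hypotheses (sym_h : forall x, U' x -> (h x)^T = h x).
Hypotheses (uh : forall x, U' x -> h x \in unitmx).
Hypotheses (h'E : forall y, U y -> h' y = 'J phi y *m h (phi y) *m ('J phi y)^T).

Let P i y a : R := partial i (fun z => phi z 0 a) y.
Let Q k i y a : R := partial k (P i ^~ a) y.
Let T l k i y a : R := partial l (Q k i ^~ a) y.

Let Cphia a : class_C 3 U (fun z => phi z 0 a).
Proof. exact: (class_C_mxP _ _ oU).1. Qed.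

Let JE y i : U y -> 'J phi y i = P i y.
Proof.
move=> Uy; apply/funext => a.
by rewrite (jacobianE _ _ oU) //; do 2!apply: class_CW.
Qed.

Let h'P i j y : U y -> h' y i j = ctr2 (h (phi y)) (P i y) (P j y).
Proof.
move=> Uy; rewrite h'E // ctr2C /ctr2 /ctr -!JE // mxE; apply: eq_bigr => b _.
by rewrite !mxE mulrC.
Qed.

Let Cphi1 : class_C 1 U phi. Proof. by do 2!apply: class_CW. Qed.

Let hasPhi k y (f : V -> R) : U y -> class_C 1 U' f ->
  has_partial k (fun y => f (phi y)) y (ctr (fun c => partial c f (phi y)) (P k y)).
Proof.
move=> Uy Cf; have [d1 d2] := partial_comp k oU oU' Cphi1 Cf Uy (UU' Uy).
by split.
Qed.

Let Cha a b : class_C 2 U' (fun z => h z a b).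
Proof. exact: (class_C_mxP _ _ oU').1. Qed.

Let hasH k y a b : U y ->
  has_partial k (fun y => h (phi y) a b) y (ctr (fun c => jet1 h (phi y) c a b) (P k y)).
Proof. by move=> Uy; apply: hasPhi => //; exact: class_CW. Qed.

Let hasD1 l y c a b : U y ->
  has_partial l (fun y => jet1 h (phi y) c a b) y
    (ctr (fun d => jet2 h (phi y) d c a b) (P l y)).
Proof. by move=> Uy; apply: hasPhi => //; exact: class_C_partial. Qed.

Let hasP k y i a : U y -> has_partial k (P i ^~ a) y (Q k i y a).
Proof. by move=> Uy; exact: class_C_has_partial (class_C_partial i (Cphia a)) Uy. Qed.

Let hasQ l y k i a : U y -> has_partial l (Q k i ^~ a) y (T l k i y a).
Proof.
move=> Uy.
exact: class_C_has_partial (class_C_partial k (class_C_partial i (Cphia a))) Uy.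
Qed.

Let ctr_first (X : I -> I -> I -> R) u v w :
  ctr2 (fun a b => ctr (fun c => X c a b) w) u v = ctr3 X w u v.
Proof. by rewrite ctr3C12 ctr3C23. Qed.

Let ctr_first3 (X : I -> I -> I -> I -> R) u v w z :
  ctr3 (fun a b c => ctr (fun d => X d a b c) z) u v w = ctr4 X z u v w.
Proof. by rewrite ctr4C12 ctr4C23 ctr4C34. Qed.

Let pull_jets1 y k i j : U y -> has_partial k (fun z => h' z i j) y
  (pull_jet1 (h (phi y)) (jet1 h (phi y)) ('J phi y) (fun k i => Q k i y) k i j).
Proof.
move=> Uy; apply: (@eq_has_partial _ _ _ (fun y => ctr2 (h (phi y)) (P i y) (P j y))).
- by apply: (near_in_open oU Uy) => z Uz; rewrite h'P.
- reflexivity.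
rewrite /pull_jet1 !(JE _ Uy) -ctr_first.
by apply: has_partial_ctr2 => *; [exact: hasH|exact: hasP|exact: hasP].
Qed.

Let pull_jets2 y l k i j : U y -> jet2 h' y l k i j =
  pull_jet2 (h (phi y)) (jet1 h (phi y)) (jet2 h (phi y)) ('J phi y)
    (fun k i => Q k i y) (fun l k i => T l k i y) l k i j.
Proof.
move=> Uy; apply: has_partialE.
apply: (@eq_has_partial _ _ _ (fun y =>
   ctr3 (jet1 h (phi y)) (P k y) (P i y) (P j y)
   + ctr2 (h (phi y)) (P i y) (Q k j y) + ctr2 (h (phi y)) (Q k i y) (P j y))).
- apply: (near_in_open oU Uy) => z Uz; rewrite /jet1 (has_partialE (pull_jets1 k i j Uz)).
  by rewrite /pull_jet1 !JE.
- reflexivity.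
rewrite /pull_jet2 !(JE _ Uy) -ctr_first3 -!(ctr_first _ _ _ (P l y)).
apply: has_partialD; first apply: has_partialD.
- by apply: has_partial_ctr3 => *; [exact: hasD1|exact: hasP|exact: hasP|exact: hasP].
- by apply: has_partial_ctr2 => *; [exact: hasH|exact: hasP|exact: hasQ].
- by apply: has_partial_ctr2 => *; [exact: hasH|exact: hasQ|exact: hasP].
Qed.

(** Class 3 for [phi] against class 2 for [h]: the metric is multiplied by first derivatives of
    [phi], so its 2-jet contains third derivatives. *)
Lemma curv_pullback i j k l y : U y ->
  curv h' i j k l y = ctr4 (fun a b c d => curv h a b c d (phi y))
    ('J phi y i) ('J phi y j) ('J phi y k) ('J phi y l).
Proof.
move=> Uy.
have Ch' : class_C 2 U h'.
  apply/(class_C_mxP _ _ oU) => a b.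
  have CP i' c : class_C 2 U (P i' ^~ c) by exact: class_C_partial.
  apply: (eq_class_C (f := fun y => ctr2 (h (phi y)) (P a y) (P b y)) oU).
    by move=> z; rewrite inE => Uz; rewrite h'P.
  apply: class_C_sum => // c _; apply: class_CM => //.
  apply: class_C_sum => // d _; apply: class_CM => //.
  exact: (class_C_comp oU oU' (class_CW Cphi) (Cha c d) UU').
have uh' z : U z -> h' z \in unitmx.
  by move=> Uz; rewrite h'E // !unitmx_mul unitmx_tr uJ // uh //; exact: UU'.
have sym_h' z : U z -> (h' z)^T = h' z.
  by move=> Uz; rewrite h'E // !trmx_mul trmxK (sym_h (UU' Uz)) mulmxA.
rewrite (curvE oU Ch' sym_h' uh' _ _ _ _ Uy) h'E //.
have sym_d1 c a b : jet1 h (phi y) c a b = jet1 h (phi y) c b a.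
  by apply: (jet1_sym oU') => //; exact: UU'.
have QC a b : Q a b y = Q b a y.
  apply/funext => c; apply: (partialC _ _ oU _ Uy).
  exact: class_CW.
have TC12 a b c : T a b c y = T b a c y.
  apply/funext => d; apply: (partialC _ _ oU _ Uy).
  exact: class_C_partial.
have TC23 a b c : T a b c y = T a c b y.
  apply/funext => d; apply: eq_partial; apply: (near_in_open oU Uy) => z Uz.
  by apply: (partialC _ _ oU _ Uz); exact: class_CW.
transitivity (ctr4 (jcurv (invmx (h (phi y))) (jet1 h (phi y)) (jet2 h (phi y)))
    ('J phi y i) ('J phi y j) ('J phi y k) ('J phi y l)); last first.
  by apply: eq_ctr4 => a b c d; rewrite (curvE oU' Ch sym_h uh) //; exact: UU'.
rewrite -(jcurv_pull _ (sym_h (UU' Uy)) (uh (UU' Uy)) (uJ Uy) sym_d1 QC TC12 TC23).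
congr (jcurv _ _ _ _ _ _ _).
  apply/funext => a; apply/funext => b; apply/funext => c.
  exact: has_partialE (pull_jets1 _ _ _ Uy).
apply/funext => a; apply/funext => b; apply/funext => c; apply/funext => d.
exact: pull_jets2.
Qed.

End Pullback.

(** * Curvature as a form on bivectors *)

Section CurvatureForms.
Variables (R : realType) (n : nat).
Local Notation V := ('rV[R]_n).
Local Notation I := 'I_n.
Implicit Types (K : I -> I -> I -> I -> R) (J X Y g w : 'M[R]_n).

Definition jscal g K : R :=
  \sum_i \sum_j \sum_k \sum_l g i k * g j l * K i j k l.

Definition jform (t : R) (hx : 'M[R]_n) K (i j k l : I) : R :=
  jscal (invmx hx) K * (kulkarni_nomizu hx hx i j k l / 2) - 2 * t * K i j k l.

(** Summing over all index pairs makes the form compatible with frame changes. On antisymmetric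
    arrays it is 4 times the sum over increasing pairs in [posdef_bivectors]. *)
Definition biv_form K w : R :=
  \sum_i \sum_j \sum_k \sum_l K i j k l * w i j * w k l.

Lemma ctr2_sum (T : finType) (F : T -> I -> I -> R) u v :
  ctr2 (fun a b => \sum_t F t a b) u v = \sum_t ctr2 (F t) u v.
Proof. by rewrite -ctr_sum; apply: eq_ctr => a; rewrite -ctr_sum. Qed.

Lemma contract_mx4 J X Y K :
  \sum_i \sum_j \sum_k \sum_l X i j * Y k l * ctr4 K (J i) (J j) (J k) (J l) =
  \sum_a \sum_b \sum_c \sum_d
    (J^T *m X *m J) a b * (J^T *m Y *m J) c d * K a b c d.
Proof.
transitivity (\sum_i \sum_j X i j * ctr2 (fun a b => \sum_k \sum_l Y k l *
    ctr2 (K a b) (J k) (J l)) (J i) (J j)).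
  apply: eq_bigr => i _; apply: eq_bigr => j _.
  transitivity (X i j * \sum_k \sum_l Y k l * ctr4 K (J i) (J j) (J k) (J l)).
    rewrite mulr_sumr; apply: eq_bigr => k _; rewrite mulr_sumr.
    by apply: eq_bigr => l _; rewrite mulrA.
  congr (_ * _).
  rewrite ctr2_sum; apply: eq_bigr => k _; rewrite ctr2_sum; apply: eq_bigr => l _.
  by rewrite ctr2Z.
rewrite contract_mx; apply: eq_bigr => a _; apply: eq_bigr => b _.
rewrite contract_mx mulr_sumr; apply: eq_bigr => c _; rewrite mulr_sumr.
by apply: eq_bigr => d _; rewrite mulrA.
Qed.

Lemma jscal_pull J g K :
  jscal g (fun i j k l => ctr4 K (J i) (J j) (J k) (J l)) =
  jscal (J^T *m g *m J) K.
Proof.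
rewrite /jscal.
(* The metric pairs [i] with [k] and [j] with [l], so the two middle indices are exchanged before
   [contract_mx4] applies. *)
transitivity (\sum_i \sum_k \sum_j \sum_l g i k * g j l *
    ctr4 (fun a c b d => K a b c d) (J i) (J k) (J j) (J l)).
  apply: eq_bigr => i _; rewrite exchange_big; apply: eq_bigr => k _ /=.
  apply: eq_bigr => j _; apply: eq_bigr => l _.
  by rewrite -ctr4C23.
rewrite contract_mx4; apply: eq_bigr => a _.
by rewrite exchange_big.
Qed.

Lemma biv_form_pull J K w :
  biv_form (fun i j k l => ctr4 K (J i) (J j) (J k) (J l)) w =
  biv_form K (J^T *m w *m J).
Proof.
rewrite /biv_form.
under eq_bigr do under eq_bigr do under eq_bigr do under eq_bigr do
  rewrite -mulrA mulrC.
rewrite contract_mx4.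
apply: eq_bigr => a _; apply: eq_bigr => b _; apply: eq_bigr => c _.
by apply: eq_bigr => d _; rewrite mulrC mulrA.
Qed.

Definition biv_antisym K : Prop :=
  (forall i j k l, K j i k l = - K i j k l) /\
  (forall i j k l, K i j l k = - K i j k l).

Lemma sum_antisym (f : I -> I -> R) : (forall i j, f i j = f j i) ->
  (forall i, f i i = 0) ->
  \sum_i \sum_j f i j = 2 * \sum_(i < n) \sum_(j < n | (i < j)%N) f i j.
Proof.
move=> fs f0.
have E : \sum_i \sum_j f i j = \sum_(i < n) \sum_(j < n | (i < j)%N) f i j
  + \sum_(i < n) \sum_(j < n | (j < i)%N) f i j.
  rewrite -big_split /=; apply: eq_bigr => i _.
  rewrite (bigID (fun j : I => (i < j)%N)) /=; congr (_ + _).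
  rewrite (bigD1 i) ?ltnn //= f0 add0r; apply: eq_bigl => j.
  by rewrite -leqNgt ltn_neqAle andbC.
rewrite E mulr_natl mulr2n; congr (_ + _).
rewrite (exchange_big_dep predT) //=; apply: eq_bigr => i _.
by apply: eq_bigr => j _.
Qed.

Lemma posdef_bivectorsP K : biv_antisym K ->
  posdef_bivectors K <-> (forall w, w^T = - w -> w != 0 -> 0 < biv_form K w).
Proof.
move=> [K12 K34].
suff E w : w^T = - w -> biv_form K w = 4 *
   \sum_(i < n) \sum_(j < n | (i < j)%N) \sum_(k < n) \sum_(l < n | (k < l)%N)
          K i j k l * w i j * w k l.
  by split=> H w wa w0; have := H w wa w0; rewrite E // pmulr_rgt0.
move=> wa.
have ws i j : w j i = - w i j by have /matrixP/(_ i j) := wa; rewrite !mxE.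
have w0 i : w i i = 0.
  by apply/eqP; have := ws i i; lra.
rewrite /biv_form (sum_antisym (f := fun i j => \sum_k \sum_l K i j k l * w i j * w k l)).
- have -> : (4 : R) = 2 * 2 by ring.
  rewrite -mulrA; congr (_ * _); rewrite mulr_sumr; apply: eq_bigr => i _.
  rewrite mulr_sumr; apply: eq_bigr => j _.
  apply: (sum_antisym (f := fun k l => K i j k l * w i j * w k l)) => [k l|k].
    by rewrite K34 (ws k l); ring.
  by rewrite w0 mulr0.
- move=> i j; apply: eq_bigr => k _; apply: eq_bigr => l _.
  by rewrite K12 (ws i j); ring.
- move=> i; apply: big1 => k _; apply: big1 => l _; by rewrite w0 mulr0 mul0r.
Qed.

Lemma kn_pull J (hx : 'M[R]_n) i j k l :
  kulkarni_nomizu (J *m hx *m J^T) (J *m hx *m J^T) i j k l =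
  ctr4 (kulkarni_nomizu hx hx) (J i) (J j) (J k) (J l).
Proof.
have E a b : (J *m hx *m J^T) a b = ctr2 hx (J a) (J b).
  rewrite ctr2C /ctr2 /ctr mxE; apply: eq_bigr => c _.
  by rewrite !mxE mulrC.
rewrite /kulkarni_nomizu !E !ctr4B ctr4D.
have H1 i' j' k' l' : ctr4 (fun a b c d => hx a c * hx b d) (J i') (J j') (J k') (J l')
  = ctr2 hx (J i') (J k') * ctr2 hx (J j') (J l').
  exact: (ctr4M (fun a c => hx a c) (fun b d => hx b d)).
have H2 i' j' k' l' : ctr4 (fun a b c d => hx a d * hx b c) (J i') (J j') (J k') (J l')
  = ctr2 hx (J i') (J l') * ctr2 hx (J j') (J k').
  rewrite ctr4C34; exact: (ctr4M (fun a c => hx a c) (fun b d => hx b d)).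
congr (_ + _ - _ - _); first by rewrite H1.
- rewrite mulrC -H1; apply: eq_ctr4 => *; exact: mulrC.
- by rewrite H2.
- by rewrite mulrC -H2; apply: eq_ctr4 => *; exact: mulrC.
Qed.

Lemma jform_pull t J (hx : 'M[R]_n) K i j k l :
  J \in unitmx -> hx \in unitmx ->
  jform t (J *m hx *m J^T) (fun i j k l => ctr4 K (J i) (J j) (J k) (J l)) i j k l
  = ctr4 (jform t hx K) (J i) (J j) (J k) (J l).
Proof.
move=> uJ uh; rewrite /jform jscal_pull conj_invmx // kn_pull.
set s := jscal _ _.
transitivity (ctr4 (fun a b c d => s / 2 * kulkarni_nomizu hx hx a b c d
    - 2 * t * K a b c d) (J i) (J j) (J k) (J l)).
  rewrite [RHS]ctr4B (ctr4Z (s / 2) (kulkarni_nomizu hx hx)) (ctr4Z (2 * t) K).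
  by ring.
by apply: eq_ctr4 => a b c d; rewrite -/s; ring.
Qed.

Lemma curv_antisym K g d1 d2 : g^T = g ->
  (forall i j k l, K i j k l = jcurv g d1 d2 i j k l) -> biv_antisym K.
Proof.
move=> gs KE; have gsE a b : g b a = g a b by rewrite -{1}gs mxE.
split=> i j k l; rewrite !KE /jcurv opprB.
  rewrite [X in _ - X](_ : _ = - \sum_m \sum_p g m p *
    (jchr d1 m i k * jchr d1 p j l - jchr d1 m j k * jchr d1 p i l)).
    by ring.
  rewrite -sumrN; apply: eq_bigr => m _; rewrite -sumrN; apply: eq_bigr => p _.
  by ring.
rewrite [X in _ - X](_ : _ = - \sum_m \sum_p g m p *
  (jchr d1 m i k * jchr d1 p j l - jchr d1 m j k * jchr d1 p i l)).
  by ring.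
rewrite exchange_big -sumrN; apply: eq_bigr => m _; rewrite -sumrN.
by apply: eq_bigr => p _; rewrite gsE; ring.
Qed.

Lemma jform_antisym t (hx : 'M[R]_n) K :
  biv_antisym K -> biv_antisym (jform t hx K).
Proof.
move=> [K12 K34].
split=> i j k l; rewrite /jform ?(K12 i j k l) ?(K34 i j k l) /kulkarni_nomizu;
  move: (jscal _ _) (K i j k l) => s c; ring.
Qed.

Lemma scalE (h : V -> 'M[R]_n) x :
  scal h x = jscal (invmx (h x)) (fun i j k l => curv h i j k l x).
Proof. by []. Qed.

End CurvatureForms.

(** * The product of a flat metric and a fibre metric *)

Section PositiveDefinite.
Variable R : realType.

Definition pdmx n (A : 'M[R]_n) : Prop :=
  forall v : 'rV[R]_n, v != 0 -> 0 < (v *m A *m v^T) 0 0.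

Lemma pdmx_conj n (A L : 'M[R]_n) : L \in unitmx -> pdmx A ->
  pdmx (L *m A *m L^T).
Proof.
move=> uL pA v v0; have : v *m L != 0.
  by apply: contra v0 => /eqP vL; rewrite -(mulmxK uL v) vL mul0mx.
by move=> /pA; rewrite trmx_mul !mulmxA.
Qed.

(** Symmetric elimination of the first coordinate. The factor provides an orthonormal frame, in
    which norms of bivectors become sums of squares. *)
Lemma cholesky n (A : 'M[R]_n) : A^T = A -> pdmx A ->
  exists2 P : 'M[R]_n, P \in unitmx & A = P *m P^T.
Proof.
elim: n A => [|n IH] A sA pA.
  exists 1%:M; first exact: unitmx1.
  by rewrite !flatmx0; apply/matrixP => -[].
pose a := (A : 'M[R]_(1 + n)) 0 0; pose b := ursubmx (A : 'M[R]_(1 + n)).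
pose d := drsubmx (A : 'M[R]_(1 + n)).
have ulE : ulsubmx (A : 'M[R]_(1 + n)) = a%:M.
  apply/matrixP => i j; rewrite !mxE !ord1 eqxx mulr1n /a.
  by congr (A _ _); apply: val_inj.
have dlE : dlsubmx (A : 'M[R]_(1 + n)) = b^T.
  by rewrite /b trmx_ursub; congr dlsubmx; exact: esym.
have AE : A = block_mx a%:M b b^T d.
  by rewrite -[LHS](@submxK _ 1 n 1 n) ulE dlE.
have a0 : 0 < a.
  have e0 : (delta_mx 0 0 : 'rV[R]_(1 + n)) != 0.
    by apply/eqP => /matrixP/(_ 0 0)/eqP; rewrite !mxE !eqxx oner_eq0.
  by have := pA _ e0; rewrite -rowE trmx_delta -colE !mxE.
pose r := Num.sqrt a.
have r0 : r != 0 by rewrite gt_eqF // sqrtr_gt0.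
have rr : r * r = a by rewrite -expr2 sqr_sqrtr // ltW.
pose L : 'M[R]_(1 + n) := block_mx r%:M 0 (r^-1 *: b^T) 1%:M.
(* The Schur complement of the entry [a], since [r^-1 * r^-1] is [a^-1]; the induction continues
   with it. *)
pose S := d - (r^-1 * r^-1) *: (b^T *m b).
have uL : L \in unitmx.
  by rewrite unitmxE det_lblock det1 mulr1 det_scalar1 unitfE.
have AL : A = L *m block_mx 1%:M 0 0 S *m L^T.
  rewrite AE /L !tr_block_mx !mulmx_block !tr_scalar_mx !trmx0.
  rewrite !(mulmx0, mul0mx, addr0, add0r, mulmx1, mul1mx) linearZ /= trmxK.
  rewrite -scalar_mxM rr mul_scalar_mx scalerA mulfV // scale1r.
  rewrite mul_mx_scalar scalerA mulfV // scale1r.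
  by rewrite -scalemxAl -scalemxAr scalerA /S addrC subrK.
have pB : pdmx (block_mx 1%:M 0 0 S : 'M[R]_(1 + n)).
  have -> : block_mx 1%:M 0 0 S = invmx L *m A *m (invmx L)^T.
    by rewrite AL trmx_inv !mulmxA mulVmx // mul1mx mulmxK // unitmx_tr.
  by apply: pdmx_conj => //; rewrite unitmx_inv.
have pS : pdmx S.
  move=> v v0; have : row_mx (0 : 'rV[R]_1) v != 0.
    by apply: contra v0 => /eqP/eqP; rewrite row_mx_eq0 => /andP[].
  move=> /pB; rewrite mul_row_block tr_row_mx mul_row_col.
  by rewrite !(mulmx0, mul0mx, addr0, add0r, trmx0).
have sS : S^T = S.
  rewrite /S linearB linearZ /= trmx_mul trmxK; congr (_ - _).
  by rewrite /d trmx_drsub; congr drsubmx.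
have [P1 uP1 SP] := IH S sS pS.
pose B1 : 'M[R]_(1 + n) := block_mx 1%:M 0 0 P1.
have EB : block_mx 1%:M 0 0 S = B1 *m B1^T.
  rewrite /B1 tr_block_mx !trmx0 trmx1 mulmx_block.
  by rewrite !(mulmx0, mul0mx, addr0, add0r, mulmx1) -SP.
exists (L *m B1).
  by rewrite unitmx_mul uL (block_diag_mx_unit (1%:M : 'M[R]_1)) unitmx1.
by rewrite {1}AL EB trmx_mul !mulmxA.
Qed.

End PositiveDefinite.

Section Product.
Variables (R : realType).

(** On a bivector [w], twice the squared norm induced by [h], since every pair of indices is counted
    in both orders. *)
Definition bnorm n (h w : 'M[R]_n) : R :=
  \sum_i \sum_j \sum_k \sum_l h i k * h j l * w i j * w k l.

Lemma bnorm_conj n (P w : 'M[R]_n) :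
  bnorm (P *m P^T) w = \sum_a \sum_b (P^T *m w *m P) a b ^+ 2.
Proof.
have E (u : 'M[R]_n) : biv_form (fun i j k l => (i == k)%:R * (j == l)%:R) u =
    \sum_a \sum_b u a b ^+ 2.
  apply: eq_bigr => i _; apply: eq_bigr => j _.
  rewrite (bigD1 i) //= (bigD1 j) //= !eqxx !mul1r -expr2 big1 => [|l lj].
    rewrite addr0 big1 ?addr0 // => k ki; apply: big1 => l _.
    by rewrite eq_sym (negbTE ki) !mul0r.
  by rewrite eq_sym (negbTE lj) mulr0 !mul0r.
rewrite -E -biv_form_pull; apply: eq_bigr => i _; apply: eq_bigr => j _.
apply: eq_bigr => k _; apply: eq_bigr => l _; congr (_ * _ * _).
rewrite (ctr4M (fun a c => (a == c)%:R) (fun b d => (b == d)%:R)).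
have H a b : (P *m P^T) a b = ctr2 (fun a b => (a == b)%:R) (P a) (P b).
  rewrite mxE; apply: eq_bigr => c _; rewrite mxE; congr (_ * _).
  rewrite /ctr (bigD1 c) //= eqxx mulr1 big1 ?addr0 // => d dc.
  by rewrite eq_sym (negbTE dc) mulr0.
by rewrite !H.
Qed.

Lemma biv_form_kn n (h w : 'M[R]_n) : w^T = - w ->
  biv_form (kulkarni_nomizu h h) w = 4 * bnorm h w.
Proof.
move=> wa; have ws i j : w j i = - w i j by have /matrixP/(_ i j) := wa; rewrite !mxE.
have E : \sum_i \sum_j \sum_k \sum_l h i l * h j k * w i j * w k l = - bnorm h w.
  rewrite -sumrN; apply: eq_bigr => i _; rewrite -sumrN; apply: eq_bigr => j _.
  rewrite exchange_big -sumrN; apply: eq_bigr => k _; rewrite -sumrN.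
  by apply: eq_bigr => l _; rewrite (ws k l); ring.
rewrite (_ : 4 * _ = bnorm h w + bnorm h w - (- bnorm h w) - (- bnorm h w)); last by ring.
rewrite -!E -!(big_split, sumrB) /=; apply: eq_bigr => i _.
rewrite -!(big_split, sumrB) /=; apply: eq_bigr => j _.
rewrite -!(big_split, sumrB) /=; apply: eq_bigr => k _.
rewrite -!(big_split, sumrB) /=; apply: eq_bigr => l _.
by rewrite /kulkarni_nomizu; ring.
Qed.

Lemma biv_form_jform n t (hx : 'M[R]_n) K w : w^T = - w ->
  biv_form (jform t hx K) w =
  2 * jscal (invmx hx) K * bnorm hx w - 2 * t * biv_form K w.
Proof.
move=> wa; set s := jscal _ _.
have -> : 2 * s * bnorm hx w = s / 2 * biv_form (kulkarni_nomizu hx hx) w.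
  by rewrite biv_form_kn //; field.
rewrite /biv_form !mulr_sumr -sumrB; apply: eq_bigr => i _.
rewrite !mulr_sumr -sumrB; apply: eq_bigr => j _.
rewrite !mulr_sumr -sumrB; apply: eq_bigr => k _.
rewrite !mulr_sumr -sumrB; apply: eq_bigr => l _.
by rewrite /jform -/s; ring.
Qed.

Variables (q p : nat).
Implicit Types (H : 'M[R]_q) (D : 'M[R]_p) (K : 'I_p -> 'I_p -> 'I_p -> 'I_p -> R)
  (Q : 'I_(q + p) -> 'I_(q + p) -> 'I_(q + p) -> 'I_(q + p) -> R).

Definition vertical (Q : 'I_(q + p) -> 'I_(q + p) -> 'I_(q + p) -> 'I_(q + p) -> R) K :=
  (forall i j k l, Q (rshift q i) (rshift q j) (rshift q k) (rshift q l) = K i j k l) /\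
  (forall (i j k l a : 'I_(q + p)), a \in [:: i; j; k; l] -> (a < q)%N -> Q i j k l = 0).

Lemma vertical_sum Q K (f : 'I_(q + p) -> 'I_(q + p) -> 'I_(q + p) -> 'I_(q + p) -> R) :
  vertical Q K ->
  \sum_i \sum_j \sum_k \sum_l f i j k l * Q i j k l =
  \sum_i \sum_j \sum_k \sum_l
     f (rshift q i) (rshift q j) (rshift q k) (rshift q l) * K i j k l.
Proof.
move=> [KE K0].
rewrite big_split_ord /= [X in X + _]big1 ?add0r => [|i _]; last first.
  do 3!(apply: big1 => ? _); rewrite (K0 _ _ _ _ (lshift p i) _ (ltn_ord i)) ?mulr0 //.
  by rewrite !inE eqxx.
apply: eq_bigr => i _; rewrite big_split_ord /= [X in X + _]big1 ?add0r => [|j _]; last first.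
  do 2!(apply: big1 => ? _); rewrite (K0 _ _ _ _ (lshift p j) _ (ltn_ord j)) ?mulr0 //.
  by rewrite !inE eqxx ?orbT.
apply: eq_bigr => j _; rewrite big_split_ord /= [X in X + _]big1 ?add0r => [|k _]; last first.
  do 1!(apply: big1 => ? _); rewrite (K0 _ _ _ _ (lshift p k) _ (ltn_ord k)) ?mulr0 //.
  by rewrite !inE eqxx ?orbT.
apply: eq_bigr => k _; rewrite big_split_ord /= [X in X + _]big1 ?add0r => [|l _]; last first.
  rewrite (K0 _ _ _ _ (lshift p l) _ (ltn_ord l)) ?mulr0 //.
  by rewrite !inE eqxx ?orbT.
by apply: eq_bigr => l _; rewrite KE.
Qed.

(* The curvature sees only the fibre block of a bivector, whereas the scalar curvature
   weighs all blocks: the other blocks can only help. *)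
Lemma posdef_product t H D Q K :
  H^T = H -> D^T = D -> pdmx H -> pdmx D -> vertical Q K ->
  0 < jscal (invmx D) K ->
  (forall w, w^T = - w -> w != 0 -> 0 < biv_form (jform t D K) w) ->
  let h0 : 'M[R]_(q + p) := block_mx H 0 0 D in
  0 < jscal (invmx h0) Q /\
  (forall w, w^T = - w -> w != 0 -> 0 < biv_form (jform t h0 Q) w).
Proof.
move=> sH sD pH pD vK s0 pos h0.
have [P uP HP] := cholesky sH pH; have [P' uP' DP] := cholesky sD pD.
have uPP (m : nat) (A : 'M[R]_m) : A \in unitmx -> A *m A^T \in unitmx.
  by move=> uA; rewrite unitmx_mul unitmx_tr uA.
have uH : H \in unitmx by rewrite HP uPP.
have uD : D \in unitmx by rewrite DP uPP.
have sE : jscal (invmx h0) Q = jscal (invmx D) K.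
  rewrite /jscal (vertical_sum _ vK).
  apply: eq_bigr => i _; apply: eq_bigr => j _; apply: eq_bigr => k _.
  apply: eq_bigr => l _.
  by rewrite /h0 invmx_block_diag ?block_diag_mx_unit ?uH ?uD // !block_mxEdr.
split=> [|w wa w0]; first by rewrite sE.
(* A frame orthonormal for [h0] and adapted to its blocks: it turns [bnorm h0 w] into a sum of
   squares, of which [bnorm D w22] keeps those of the fibre block. *)
pose J : 'M[R]_(q + p) := block_mx P 0 0 P'.
have uJ : J \in unitmx by rewrite block_diag_mx_unit uP uP'.
have hJ : h0 = J *m J^T.
  rewrite /J tr_block_mx !trmx0 mulmx_block.
  by rewrite !(mulmx0, mul0mx, addr0, add0r) -HP -DP.
pose w22 : 'M[R]_p := drsubmx w.
have wa22 : w22^T = - w22 by rewrite /w22 trmx_drsub wa; apply/matrixP => i j; rewrite !mxE.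
have KE : biv_form Q w = biv_form K w22.
  have := vertical_sum (fun i j k l => w i j * w k l) vK.
  rewrite /biv_form => E.
  transitivity (\sum_i \sum_j \sum_k \sum_l w i j * w k l * Q i j k l).
    by do 4!(apply: eq_bigr => ? _); ring.
  by rewrite E; do 4!(apply: eq_bigr => ? _); rewrite !mxE; ring.
pose W := J^T *m w *m J.
have WE : drsubmx W = P'^T *m w22 *m P'.
  rewrite /W -[w]submxK /J tr_block_mx !trmx0 !mulmx_block.
  by rewrite !(mulmx0, mul0mx, addr0, add0r) block_mxKdr.
have W0 : W != 0.
  apply: contra w0 => /eqP W0.
  have -> : w = invmx J^T *m W *m invmx J.
    by rewrite /W !mulmxA mulVmx ?unitmx_tr // mul1mx mulmxK.
  by rewrite W0 mulmx0 mul0mx.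
have nE : bnorm h0 w = \sum_a \sum_b W a b ^+ 2 by rewrite hJ bnorm_conj.
have nE22 : bnorm D w22 = \sum_a \sum_b W (rshift q a) (rshift q b) ^+ 2.
  rewrite DP bnorm_conj -WE; apply: eq_bigr => a _; apply: eq_bigr => b _.
  by rewrite !mxE.
have sq0 m1 m2 (g : 'I_m1 -> 'I_m2 -> R) : 0 <= \sum_a \sum_b g a b ^+ 2.
  by apply: sumr_ge0 => a _; apply: sumr_ge0 => b _; exact: sqr_ge0.
have le22 : bnorm D w22 <= bnorm h0 w.
  rewrite nE nE22 [leRHS]big_split_ord /= ler_wpDl ?sq0 //.
  apply: ler_sum => a _; rewrite [leRHS]big_split_ord /= ler_wpDl //.
  by apply: sumr_ge0 => b _; exact: sqr_ge0.
rewrite biv_form_jform // sE KE.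
(* A bivector without fibre component is invisible to the curvature; the scalar curvature alone
   makes the form positive on it. *)
have [w22_0|w22_n0] := eqVneq w22 0.
  have -> : biv_form K w22 = 0.
    by rewrite /biv_form; do 4!(apply: big1 => ? _); rewrite w22_0 !mxE mulr0.
  rewrite mulr0 subr0 !mulr_gt0 //.
  rewrite nE lt_def sq0 andbT; apply: contra W0 => /eqP E.
  apply/eqP/matrixP => a b; rewrite [RHS]mxE.
  have Ea : \sum_b W a b ^+ 2 = 0.
    apply: (psumr_eq0P _ E) => // c _; apply: sumr_ge0 => d _; exact: sqr_ge0.
  apply/eqP; rewrite -sqrf_eq0; apply/eqP.
  by apply: (psumr_eq0P _ Ea) => // d _; exact: sqr_ge0.
have := pos _ wa22 w22_n0; rewrite biv_form_jform // => /lt_le_trans; apply.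
by rewrite lerD2r ler_wpM2l // mulr_ge0 // ltW.
Qed.

End Product.

(** * Rescaling and limits *)

Section JetScaling.
Variables (R : realType) (n : nat).
Local Notation I := 'I_n.

(* The metric [e *: h] in the frame [s a *: d_a]; positivity is insensitive to both. *)
Definition scale_mx (e : R) (s : I -> R) (h : 'M[R]_n) : 'M[R]_n :=
  \matrix_(a, b) (e * s a * s b * h a b).

Lemma scale_mxE e s h :
  scale_mx e s h = e *: (diag_mx (\row_a s a) *m h *m (diag_mx (\row_a s a))^T).
Proof.
apply/matrixP => a b; rewrite tr_diag_mx mul_mx_diag mul_diag_mx !mxE; ring.
Qed.

Variables (e : R) (s : I -> R).
Hypotheses (e0 : e != 0) (s0 : forall a, s a != 0).

Lemma scale_mx_inv h : h \in unitmx ->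
  invmx (scale_mx e s h) = scale_mx e^-1 (fun a => (s a)^-1) (invmx h).
Proof.
move=> uh.
have E : scale_mx e s h *m scale_mx e^-1 (fun a => (s a)^-1) (invmx h) = 1%:M.
  apply/matrixP => a b; rewrite mxE.
  transitivity (\sum_j s a / s b * (h a j * invmx h j b)).
    by apply: eq_bigr => j _; rewrite !mxE; field; rewrite e0 !s0.
  rewrite -mulr_sumr; have := mulmxV uh => /matrixP/(_ a b); rewrite !mxE => ->.
  by have [->|] := eqVneq a b; rewrite ?divff ?mulr1 // mulr0.
have [u _] := mulmx1_unit E.
by rewrite -[RHS](mulKmx u) E mulmx1.
Qed.

Lemma scale_mx_unit h : scale_mx e s h \in unitmx -> h \in unitmx.
Proof.
rewrite scale_mxE unitmxE detZ !det_mulmx det_tr unitrM => /andP[_].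
by rewrite unitrM => /andP[]; rewrite unitrM => /andP[].
Qed.

Definition scale_tensor (K : I -> I -> I -> I -> R) i j k l :=
  e * (s i * s j * s k * s l) * K i j k l.

Lemma jcurv_scale h d1 d2 i j k l : h \in unitmx ->
  jcurv (invmx (scale_mx e s h)) (fun c a b => e * (s c * s a * s b) * d1 c a b)
    (scale_tensor d2) i j k l = scale_tensor (jcurv (invmx h) d1 d2) i j k l.
Proof.
move=> uh; rewrite scale_mx_inv // /scale_tensor /jcurv [RHS]mulrBr; congr (_ - _).
  by ring.
rewrite mulr_sumr; apply: eq_bigr => m _; rewrite mulr_sumr; apply: eq_bigr => p _.
by rewrite !mxE /jchr; field; rewrite e0 !s0.
Qed.

Lemma jscal_scale h K : h \in unitmx ->
  jscal (invmx (scale_mx e s h)) (scale_tensor K) = e^-1 * jscal (invmx h) K.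
Proof.
move=> uh; rewrite scale_mx_inv // /jscal mulr_sumr.
apply: eq_bigr => i _; rewrite mulr_sumr; apply: eq_bigr => j _.
rewrite mulr_sumr; apply: eq_bigr => k _; rewrite mulr_sumr; apply: eq_bigr => l _.
by rewrite /scale_tensor !mxE; field; rewrite e0 !s0.
Qed.

Lemma biv_form_scale t h K w : h \in unitmx ->
  biv_form (jform t (scale_mx e s h) (scale_tensor K)) w =
  e * biv_form (jform t h K) (\matrix_(i, j) (s i * s j * w i j)).
Proof.
move=> uh; rewrite /biv_form mulr_sumr; apply: eq_bigr => i _.
rewrite mulr_sumr; apply: eq_bigr => j _.
rewrite mulr_sumr; apply: eq_bigr => k _; rewrite mulr_sumr; apply: eq_bigr => l _.
rewrite /jform jscal_scale // /kulkarni_nomizu /scale_tensor !mxE.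
by move: (jscal _ _) (K i j k l) => c d; field.
Qed.

Hypothesis e_gt0 : 0 < e.

(** A frame change by [s] acts on bivectors through the nonzero factors [s i * s j]. The equivalence
    is used in both directions: to multiply the fibre metric by its weight, and to return from the
    rescaled jet to the metric. *)
Lemma posdef_scale t h K : h \in unitmx ->
  (0 < jscal (invmx (scale_mx e s h)) (scale_tensor K) /\
   (forall w, w^T = - w -> w != 0 ->
     0 < biv_form (jform t (scale_mx e s h) (scale_tensor K)) w)) <->
  (0 < jscal (invmx h) K /\
   (forall w, w^T = - w -> w != 0 -> 0 < biv_form (jform t h K) w)).
Proof.
move=> uh; rewrite jscal_scale // pmulr_rgt0 ?invr_gt0 //.
have aux (r : I -> R) w : (forall a, r a != 0) -> w^T = - w -> w != 0 ->
  let w' := \matrix_(i, j) (r i * r j * w i j) in w'^T = - w' /\ w' != 0.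
  move=> r0 wa w0; split.
    apply/matrixP => i j; rewrite !mxE; have /matrixP/(_ i j) := wa.
    by rewrite !mxE => ->; ring.
  apply: contra w0 => /eqP w'0; apply/eqP/matrixP => i j.
  have /matrixP/(_ i j)/eqP := w'0; rewrite !mxE !mulf_eq0 !(negbTE (r0 _)) /=.
  by move/eqP.
split=> -[sc pos]; split=> // w wa w0.
  have sV a : (s a)^-1 != 0 by rewrite invr_eq0.
  have [wa' w0'] := aux _ _ sV wa w0.
  have := pos _ wa' w0'; rewrite biv_form_scale // pmulr_rgt0 //.
  congr (_ < biv_form _ _); apply/matrixP => i j; rewrite !mxE.
  by field; rewrite !s0.
have [wa' w0'] := aux _ _ s0 wa w0.
by rewrite biv_form_scale // pmulr_rgt0 //; exact: pos.
Qed.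

End JetScaling.

Section Limits.
Variables (R : realType) (T : Type) (F : set_system T).
Context {FF : Filter F}.

Lemma cvg_prodr (J : Type) (r : seq J) (f : J -> T -> R) (a : J -> R) :
  (forall i, f i t @[t --> F] --> a i) ->
  \prod_(i <- r) f i t @[t --> F] --> \prod_(i <- r) a i.
Proof.
by move=> fa; apply: cvg_big => [|i _]; [exact: mul_continuous|exact: fa].
Qed.

Lemma cvg_det n (A : T -> 'M[R]_n) (L : 'M[R]_n) :
  (forall i j, A t i j @[t --> F] --> L i j) ->
  \det (A t) @[t --> F] --> \det L.
Proof.
move=> AL; apply: cvg_sumr => s; apply: cvgM; first exact: cvg_cst.
by apply: cvg_prodr.
Qed.

Lemma near_unitmx n (A : T -> 'M[R]_n) (L : 'M[R]_n) :
  (forall i j, A t i j @[t --> F] --> L i j) -> L \in unitmx ->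
  \forall t \near F, A t \in unitmx.
Proof.
move=> AL uL; have dL : \det L != 0 by move: uL; rewrite unitmxE unitfE.
have := cvg_det AL => /cvgr_neq0 /(_ dL).
by apply: filterS => t; rewrite unitmxE unitfE.
Qed.

Lemma cvg_invmx n (A : T -> 'M[R]_n) (L : 'M[R]_n) :
  (forall i j, A t i j @[t --> F] --> L i j) -> L \in unitmx ->
  forall i j, invmx (A t) i j @[t --> F] --> invmx L i j.
Proof.
move=> AL uL i j; have dL : \det L != 0 by move: uL; rewrite unitmxE unitfE.
rewrite [invmx L]/invmx uL !mxE.
have H : (\det (A t))^-1 * ((-1) ^+ (j + i) * \det (row' j (col' i (A t)))) @[t --> F]
    --> (\det L)^-1 * ((-1) ^+ (j + i) * \det (row' j (col' i L))).
  apply: cvgM; first by apply: cvgV => //; exact: cvg_det.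
  apply: cvgM; first exact: cvg_cst.
  apply: cvg_det => a b; under eq_cvg do rewrite !mxE.
  by rewrite !mxE; exact: AL.
(* [invmx] is given by cofactors at invertible matrices only, hence the restriction to [t] near the
   limit. *)
apply: cvg_trans H; apply: near_eq_cvg.
apply: filterS (near_unitmx AL uL) => t ut.
by rewrite /invmx ut !mxE.
Qed.

Variable n : nat.
Variables (h : T -> 'M[R]_n) (L : 'M[R]_n).
Hypotheses (hL : forall i j, h t i j @[t --> F] --> L i j) (uL : L \in unitmx).

Lemma cvg_jcurv d1 d2 D1 D2 i j k l :
  (forall c a b, d1 t c a b @[t --> F] --> D1 c a b) ->
  (forall d c a b, d2 t d c a b @[t --> F] --> D2 d c a b) ->
  jcurv (invmx (h t)) (d1 t) (d2 t) i j k l @[t --> F] -->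
  (jcurv (invmx L) D1 D2 i j k l : R).
Proof.
move=> c1 c2.
have cj a b c : jchr (d1 t) a b c @[t --> F] --> (jchr D1 a b c : R).
  apply: cvgM; first exact: cvg_cst.
  by apply: cvgB => //; apply: cvgD.
apply: cvgB.
  apply: cvgM; first exact: cvg_cst.
  by apply: cvgB => //; apply: cvgB => //; apply: cvgD.
apply: cvg_sumr => m; apply: cvg_sumr => p; apply: cvgM; first exact: cvg_invmx.
by apply: cvgB; apply: cvgM.
Qed.

Variables (Q : T -> 'I_n -> 'I_n -> 'I_n -> 'I_n -> R).
Variables (K : 'I_n -> 'I_n -> 'I_n -> 'I_n -> R).
Hypotheses (QK : forall i j k l, Q t i j k l @[t --> F] --> K i j k l).

Lemma cvg_jscal : jscal (invmx (h t)) (Q t) @[t --> F] --> jscal (invmx L) K.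
Proof.
do 4!(apply: cvg_sumr => ?); apply: cvgM => //.
by apply: cvgM; exact: cvg_invmx.
Qed.

Lemma cvg_jform s i j k l :
  jform s (h t) (Q t) i j k l @[t --> F] --> jform s L K i j k l.
Proof.
apply: cvgB; last by apply: cvgM => //; exact: cvg_cst.
apply: cvgM; first exact: cvg_jscal.
apply: cvgM; last exact: cvg_cst.
by do 2!(apply: cvgB; last exact: cvgM); apply: cvgD; exact: cvgM.
Qed.

(* By homogeneity it is enough to be uniform over the compact set of unit bivectors. *)
Lemma near_biv_form_gt0 :
  (forall w, w^T = - w -> w != 0 -> 0 < biv_form K w) ->
  \forall t \near F, forall w, w^T = - w -> w != 0 -> 0 < biv_form (Q t) w.
Proof.
move=> pos.
(* Bivectors are flattened to row vectors, where closed and bounded sets are compact. *)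
pose S := [set v : 'rV[R]_(n * n) | `|v| = 1 /\ (vec_mx v)^T = - vec_mx v].
have cS : compact S.
  apply: bounded_closed_compact.
    by exists 1; split=> // x x1 v [v1 _] /=; rewrite v1 ltW.
  have -> : S = (fun v => `|v|) @^-1` [set 1] `&`
     \bigcap_(ij in [set: 'I_n * 'I_n])
       ((fun v : 'rV[R]_(n * n) => v 0 (mxvec_index ij.1 ij.2)
             + v 0 (mxvec_index ij.2 ij.1)) @^-1` [set 0]).
    apply/seteqP; split=> v.
      move=> [v1 va]; split=> // -[i j] _ /=.
      by have /matrixP/(_ i j) := va; rewrite !mxE => ->; rewrite subrr.
    move=> [v1 va]; split=> //; apply/matrixP => i j; rewrite !mxE.
    by have /eqP := va (i, j) I; rewrite /= addrC addr_eq0 => /eqP.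
  apply: closedI.
    apply: closed_comp => [v _|]; first exact: norm_continuous.
    exact: closed_eq.
  apply: closed_bigI => ij _; apply: closed_comp => [v _|]; last exact: closed_eq.
  by apply: continuousD; exact: coord_continuous.
have : \forall t \near F, S `<=` [set v | 0 < biv_form (Q t) (vec_mx v)].
  (* In this form of compactness it suffices to find, for each unit [v], positivity for all pairs
     close to [v] and to the limit along [F]. *)
  apply: (compact_near_coveringP S).1 => // v [v1 va].
  have w0 : vec_mx v != 0.
    apply/eqP => v0; have := vec_mxK v; rewrite v0 linear0 => vE.
    by move: v1; rewrite -vE normr0 => /eqP; rewrite eq_sym oner_eq0.
  have := pos _ va w0.
  have cw i j : (vec_mx u.1) i j @[u --> (nbhs v, F)] --> (vec_mx v) i j.
    under eq_cvg do rewrite mxE; rewrite mxE.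
    exact: (cvg_comp _ _ (@cvg_fst _ _ (nbhs v) F _) (@coord_continuous R 1 (n * n) 0
      (mxvec_index i j) v)).
  have cQ i j k l : Q u.2 i j k l @[u --> (nbhs v, F)] --> K i j k l.
    exact: (cvg_comp _ _ cvg_snd (@QK i j k l)).
  have cB : biv_form (Q u.2) (vec_mx u.1) @[u --> (nbhs v, F)]
      --> biv_form K (vec_mx v).
    by do 4!(apply: cvg_sumr => ?); apply: cvgM => //; apply: cvgM.
  move=> /(cvgr_gt _ cB); exact.
apply: filterS => t St w wa w0.
have v0 : mxvec w != 0 by apply: contra w0 => /eqP v0; rewrite -(mxvecK w) v0 linear0.
have nv0 : 0 < `|mxvec w| by rewrite normr_gt0.
pose v := `|mxvec w|^-1 *: mxvec w.
have vE : vec_mx v = `|mxvec w|^-1 *: w by rewrite linearZ /= mxvecK.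
have /St /= : S v.
  split; first by rewrite normrZ normfV normr_id mulVf ?gt_eqF.
  by rewrite vE linearZ /= wa scalerN.
rewrite vE; have -> : biv_form (Q t) (`|mxvec w|^-1 *: w) =
    (`|mxvec w|^-1 * `|mxvec w|^-1) * biv_form (Q t) w.
  rewrite /biv_form mulr_sumr; apply: eq_bigr => i _.
  rewrite mulr_sumr; apply: eq_bigr => j _.
  rewrite mulr_sumr; apply: eq_bigr => k _.
  by rewrite mulr_sumr; apply: eq_bigr => l _; rewrite !mxE; ring.
by rewrite pmulr_rgt0 // mulr_gt0 // invr_gt0.
Qed.

End Limits.

(** * The adiabatic limit *)

Section Adiabatic.
Variables (R : realType) (q p : nat).
Local Notation n := (q + p)%N.
Local Notation V := ('rV[R]_(q + p)).
Local Notation I := ('I_(q + p)).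

Lemma pdmx_unit m (A : 'M[R]_m) : A^T = A -> pdmx A -> A \in unitmx.
Proof.
by move=> sA /(cholesky sA)[P uP ->]; rewrite unitmx_mul unitmx_tr uP.
Qed.

Lemma pdmxZ m (c : R) (A : 'M[R]_m) : 0 < c -> pdmx A -> pdmx (c *: A).
Proof.
move=> c0 pA v v0; rewrite -scalemxAr -scalemxAl mxE.
by rewrite mulr_gt0 //; exact: pA.
Qed.

Lemma partial_rshift (W : normedModType R) (f : 'rV[R]_q -> 'rV[R]_p -> W) (c : 'I_p) (z : V) :
  partial (rshift q c) (fun y => f (lsubmx y) (rsubmx y)) z =
  partial c (f (lsubmx z)) (rsubmx z).
Proof.
have E : (fun h : R => h^-1 *: (f (lsubmx (h *: delta_mx 0 (rshift q c) + z))
    (rsubmx (h *: delta_mx 0 (rshift q c) + z)) - f (lsubmx z) (rsubmx z))) =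
  (fun h : R => h^-1 *: (f (lsubmx z) (h *: delta_mx 0 c + rsubmx z)
    - f (lsubmx z) (rsubmx z))).
  apply/funext => h; congr (_ *: (f _ _ - _)); apply/rowP => i; rewrite !mxE.
    by rewrite (_ : (lshift p i == rshift q c) = false) ?mulr0 ?add0r // eq_lrshift.
  by rewrite (_ : (rshift q i == rshift q c) = (i == c)) // eq_rshift.
rewrite /partial /derive.
by rewrite -[X in lim (X @ _) = _]/(fun h : R => h^-1 *: (f (lsubmx (h *: delta_mx 0 (rshift q
  c) + z))
    (rsubmx (h *: delta_mx 0 (rshift q c) + z)) - f (lsubmx z) (rsubmx z))) E.
Qed.

(** [h0] and [k0] are g_H and g_V in the coordinates of a local trivialization, the [q] base
    coordinates coming first. [h0E] says that [h0] comes from the base; [k0E] prescribes the fibre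
    block of [k0], a multiple of the fibre metric [gh] with a factor constant along each fibre. *)
Variables (h0 k0 : V -> 'M[R]_n) (Hf : 'rV[R]_q -> 'M[R]_q) (s : 'rV[R]_q -> R).
Variables (gh : 'rV[R]_p -> 'M[R]_p) (W : set V) (U : set 'rV[R]_p).
Hypotheses (oW : open W) (oU : open U).
Hypotheses (Ch0 : class_C 2 W h0) (Ck0 : class_C 2 W k0) (Cgh : class_C 2 U gh).
Hypotheses (sym_h0 : forall z, W z -> (h0 z)^T = h0 z)
  (sym_k0 : forall z, W z -> (k0 z)^T = k0 z)
  (sym_gh : forall x, U x -> (gh x)^T = gh x) (pd_gh : forall x, U x -> pdmx (gh x)).
Hypotheses (h0E : forall z, W z -> h0 z = block_mx (Hf (lsubmx z)) 0 0 0)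
  (k0E : forall z, W z -> drsubmx (k0 z) = s (lsubmx z) *: gh (rsubmx z)).
Hypothesis WU : forall z, W z -> U (rsubmx z).

Definition fibre_scale (e : R) (a : I) : R := if (a < q)%N then e else 1.
Local Notation sg := fibre_scale.

Let all3 (c a b : I) := [&& (c < q)%N, (a < q)%N & (b < q)%N].

Let Ch0e a b : class_C 2 W (fun z => h0 z a b).
Proof. exact: (class_C_mxP _ _ oW).1. Qed.
Let Ck0e a b : class_C 2 W (fun z => k0 z a b).
Proof. exact: (class_C_mxP _ _ oW).1. Qed.

Let h0_zero z (a b : I) : W z -> ~~ ((a < q)%N && (b < q)%N) -> h0 z a b = 0.
Proof.
move=> Wz; rewrite h0E //.
case: (split_ordP a) => a' ->; case: (split_ordP b) => b' -> /=; rewrite ?ltn_ord //= => _.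
- by rewrite block_mxEur mxE.
- by rewrite block_mxEdl mxE.
- by rewrite block_mxEdr mxE.
Qed.

Let partial_zero (d : I) (f : V -> R) z : W z -> (forall y, W y -> f y = 0) -> partial d f z = 0.
Proof.
move=> Wz f0; have -> : partial d f z = partial d (cst 0) z.
  by apply: eq_partial; exact: near_in_open Wz _.
by rewrite /partial derive_cst.
Qed.

Let jet1_h0 z (c a b : I) : W z -> ~~ all3 c a b -> jet1 h0 z c a b = 0.
Proof.
move=> Wz; rewrite /all3 negb_and => /orP[cq|]; last first.
  by move=> ab; apply: partial_zero => // y Wy; exact: h0_zero.
have [ab|ab] := boolP ((a < q)%N && (b < q)%N); last first.
  by apply: partial_zero => // y Wy; exact: h0_zero.
case: (split_ordP c) cq => c' -> // _; move: ab.
case: (split_ordP a) => a' -> //; case: (split_ordP b) => b' -> // _.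
transitivity (partial (rshift q c') (fun y : V => Hf (lsubmx y) a' b') z).
  by apply: eq_partial; apply: (near_in_open oW Wz) => y Wy; rewrite h0E // block_mxEul.
rewrite (partial_rshift (fun x _ => Hf x a' b')) /partial.
exact: derive_cst.
Qed.

Let jet2_h0 z (d c a b : I) : W z -> ~~ ((d < q)%N && all3 c a b) -> jet2 h0 z d c a b = 0.
Proof.
move=> Wz; rewrite negb_and => /orP[dq|cab]; last first.
  by apply: partial_zero => // y Wy; exact: jet1_h0.
(* Symmetry of second derivatives puts the fibre direction innermost, where the first derivative
   already vanishes on all of [W]. *)
rewrite (jet2C oW Ch0) //; apply: partial_zero => // y Wy; apply: jet1_h0 => //.
by rewrite /all3 (negbTE dq).
Qed.

Let jet1_k0 z c a b : W z ->
  jet1 k0 z (rshift q c) (rshift q a) (rshift q b) =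
  s (lsubmx z) * jet1 gh (rsubmx z) c a b.
Proof.
move=> Wz.
transitivity (partial (rshift q c) (fun y : V => s (lsubmx y) * gh (rsubmx y) a b) z).
  apply: eq_partial; apply: (near_in_open oW Wz) => y Wy.
  by have /matrixP/(_ a b) := k0E Wy; rewrite !mxE.
rewrite (partial_rshift (fun x y => s x * gh y a b)).
apply: has_partialE; apply: has_partialZ.
exact: class_C_has_partial ((class_C_mxP _ _ oU).1 Cgh a b) (WU Wz).
Qed.

Let jet2_k0 z d c a b : W z ->
  jet2 k0 z (rshift q d) (rshift q c) (rshift q a) (rshift q b) =
  s (lsubmx z) * jet2 gh (rsubmx z) d c a b.
Proof.
move=> Wz.
transitivity (partial (rshift q d)
    (fun y : V => s (lsubmx y) * jet1 gh (rsubmx y) c a b) z).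
  by apply: eq_partial; apply: (near_in_open oW Wz) => y Wy; exact: jet1_k0.
rewrite (partial_rshift (fun x y => s x * jet1 gh y c a b)).
apply: has_partialE; apply: has_partialZ.
exact: (has_jet2 oU Cgh d c a b (WU Wz)).
Qed.

Let he (e : R) (z : V) : 'M[R]_n := h0 z + e ^+ 2 *: k0 z.

Let Che e : class_C 2 W (he e).
Proof.
apply/(class_C_mxP _ _ oW) => a b.
have E y : h0 y a b + e ^+ 2 * k0 y a b = he e y a b by rewrite !mxE.
apply: (class_C_eq oW E); apply: class_CD => //; apply: class_CM => //.
exact: class_C_cst.
Qed.

Let jet1_he e z (c a b : I) : W z ->
  jet1 (he e) z c a b = jet1 h0 z c a b + e ^+ 2 * jet1 k0 z c a b.
Proof.
move=> Wz; apply: has_partialE.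
apply: (@eq_has_partial _ _ _ (fun y => h0 y a b + e ^+ 2 * k0 y a b)).
- by near=> y; rewrite !mxE.
- reflexivity.
apply: has_partialD; last apply: has_partialZ.
- exact: class_C_has_partial (Ch0e a b) Wz.
- exact: class_C_has_partial (Ck0e a b) Wz.
Unshelve. all: by end_near. Qed.

Let jet2_he e z (d c a b : I) : W z ->
  jet2 (he e) z d c a b = jet2 h0 z d c a b + e ^+ 2 * jet2 k0 z d c a b.
Proof.
move=> Wz; apply: has_partialE.
apply: (@eq_has_partial _ _ _ (fun y => jet1 h0 y c a b + e ^+ 2 * jet1 k0 y c a b)).
- by apply: (near_in_open oW Wz) => y Wy; rewrite [RHS]jet1_he.
- reflexivity.
apply: has_partialD; last apply: has_partialZ.
  exact: (has_jet2 oW Ch0 d c a b Wz).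
exact: (has_jet2 oW Ck0 d c a b Wz).
Qed.

(* The 2-jet of [e ^- 2 *: (h0 + e ^+ 2 *: k0)] in the coordinates where base vectors are
   multiplied by [e]. As [h0] has base components only, and they depend on the base
   coordinates only, no negative power of [e] is left, and the jet is continuous up to
   [e = 0], where it is that of the product of a flat metric and [s *: gh]. *)
Let ht (u : V * R) : 'M[R]_n :=
  \matrix_(a, b) (h0 u.1 a b + sg u.2 a * sg u.2 b * k0 u.1 a b).
Let d1t (u : V * R) (c a b : I) : R :=
  sg u.2 c * (jet1 h0 u.1 c a b + sg u.2 a * sg u.2 b * jet1 k0 u.1 c a b).
Let d2t (u : V * R) (d c a b : I) : R :=
  sg u.2 d * sg u.2 c *
  (jet2 h0 u.1 d c a b + sg u.2 a * sg u.2 b * jet2 k0 u.1 d c a b).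

Let sg_neq0 e (a : I) : 0 < e -> sg e a != 0.
Proof. by move=> e0; rewrite /sg; case: ifP => _; rewrite ?gt_eqF ?oner_eq0. Qed.

Let htE z e : W z -> 0 < e -> ht (z, e) = scale_mx (e ^- 2) (sg e) (he e z).
Proof.
move=> Wz e0; apply/matrixP => a b; rewrite !mxE /=.
have en0 : e != 0 by rewrite gt_eqF.
have [ab|ab] := boolP ((a < q)%N && (b < q)%N).
  by rewrite /sg; move/andP: ab => [-> ->]; field.
by rewrite h0_zero // !add0r; field.
Qed.

Let d1tE z e : W z -> 0 < e -> d1t (z, e) =
  (fun c a b => e ^- 2 * (sg e c * sg e a * sg e b) * jet1 (he e) z c a b).
Proof.
move=> Wz e0; apply/funext => c; apply/funext => a; apply/funext => b.
rewrite jet1_he // /d1t /=.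
have en0 : e != 0 by rewrite gt_eqF.
have [cab|cab] := boolP (all3 c a b).
  rewrite /sg; move/and3P: cab => [-> -> ->].
  by move: (jet1 h0 _ _ _ _) (jet1 k0 _ _ _ _) => x y; field.
rewrite jet1_h0 // !add0r; move: (jet1 k0 _ _ _ _) => x; by field.
Qed.

Let d2tE z e : W z -> 0 < e ->
  d2t (z, e) = scale_tensor (e ^- 2) (sg e) (jet2 (he e) z).
Proof.
move=> Wz e0; apply/funext => d; apply/funext => c.
apply/funext => a; apply/funext => b.
rewrite /scale_tensor jet2_he // /d2t /=.
have en0 : e != 0 by rewrite gt_eqF.
have [dcab|dcab] := boolP ((d < q)%N && all3 c a b).
  rewrite /sg; move: dcab => /and4P[-> -> -> ->].
  by move: (jet2 h0 _ _ _ _ _) (jet2 k0 _ _ _ _ _) => x y; field.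
rewrite jet2_h0 // !add0r; move: (jet2 k0 _ _ _ _ _) => x; by field.
Qed.

Variable (z0 : V) (t : R).
Hypotheses (Wz0 : W z0) (pdH : pdmx (Hf (lsubmx z0))) (s_gt0 : 0 < s (lsubmx z0)).
Hypotheses (scal_gh : 0 < scal gh (rsubmx z0))
  (riem_gh : posdef_bivectors (riem_form t gh (rsubmx z0))).

Let y0 := rsubmx z0.
Let s0 := s (lsubmx z0).
Let L : 'M[R]_n := block_mx (Hf (lsubmx z0)) 0 0 (s0 *: gh y0).

Let htL : ht (z0, 0) = L.
Proof.
apply/matrixP => a b; rewrite [LHS]mxE /= h0E // /sg /L.
case: (split_ordP a) => a' ->; case: (split_ordP b) => b' ->;
  rewrite ?block_mxEul ?block_mxEur ?block_mxEdl ?block_mxEdr ?mul0r ?mulr0 ?mul0r ?addr0 //.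
rewrite [X in X + _]mxE add0r !mul1r.
by have /matrixP/(_ a' b') := k0E Wz0; rewrite !mxE.
Qed.

Let sg0r e (a : 'I_p) : sg e (rshift q a) = 1.
Proof. by rewrite /sg /= ltnNge leq_addr. Qed.
Let sg0lt (a : I) : (a < q)%N -> sg 0 a = 0.
Proof. by rewrite /sg => ->. Qed.

(** A base direction of differentiation is killed by its factor [sg 0]. In a fibre direction the
    contribution of [h0] vanishes, and that of [k0] carries a factor [sg 0] for the remaining base
    index. *)
Let vertical3 (c a b x : I) : x \in [:: c; a; b] -> (x < q)%N -> d1t (z0, 0) c a b = 0.
Proof.
rewrite /d1t /= !inE => xcab xq.
have [cq|cq] := boolP (c < q)%N; first by rewrite sg0lt // mul0r.
rewrite jet1_h0 ?/all3 ?(negbTE cq) // add0r.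
case/or3P: xcab => /eqP xE; first by rewrite xE (negbTE cq) in xq.
- by rewrite -xE (sg0lt xq) !mul0r mulr0.
- by rewrite -xE (sg0lt xq) mulr0 mul0r mulr0.
Qed.

Let vertical4 (d c a b x : I) : x \in [:: d; c; a; b] -> (x < q)%N -> d2t (z0, 0) d c a b = 0.
Proof.
rewrite /d2t /= !inE => xcab xq.
have [dq|dq] := boolP (d < q)%N; first by rewrite sg0lt // !mul0r.
rewrite jet2_h0 ?(negbTE dq) // add0r.
case/or4P: xcab => /eqP xE; first by rewrite xE (negbTE dq) in xq.
- by rewrite -xE (sg0lt xq) mulr0 mul0r.
- by rewrite -xE (sg0lt xq) !mul0r mulr0.
- by rewrite -xE (sg0lt xq) mulr0 mul0r mulr0.
Qed.

Let uD : gh y0 \in unitmx.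
Proof. by apply: pdmx_unit; [apply: sym_gh|apply: pd_gh]; exact: WU. Qed.

Let curv_gh i j k l : curv gh i j k l y0 =
  jcurv (invmx (gh y0)) (jet1 gh y0) (jet2 gh y0) i j k l.
Proof.
apply: (curvE oU Cgh sym_gh _ _ _ _ _ (WU Wz0)) => x Ux.
by apply: pdmx_unit; [apply: sym_gh|apply: pd_gh].
Qed.

Let one_neq0 (a : 'I_p) : (fun=> 1 : R) a != 0 := oner_neq0 R.

Let symH : (Hf (lsubmx z0))^T = Hf (lsubmx z0).
Proof.
have := sym_h0 Wz0; rewrite h0E // tr_block_mx => /eq_block_mx [].
by [].
Qed.

Let LE : scale_mx s0 (fun=> 1) (gh y0) = s0 *: gh y0.
Proof. by apply/matrixP => a b; rewrite !mxE; ring. Qed.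

(** Every term with a base index contains a vanishing jet entry. On fibre indices the inner sum
    shrinks to the fibre block of [invmx L], which is the inverse of the fibre block because [L] is
    block diagonal. *)
Let vertical_curv :
  vertical (jcurv (invmx L) (d1t (z0, 0)) (d2t (z0, 0)))
    (scale_tensor s0 (fun=> 1) (fun i j k l => curv gh i j k l y0)).
Proof.
have s00 : s0 != 0 by rewrite gt_eqF.
have invL : invmx L = block_mx (invmx (Hf (lsubmx z0))) 0 0 (invmx (s0 *: gh y0)).
  rewrite invmx_block_diag // block_diag_mx_unit pdmx_unit //=.
  by rewrite unitmxZ // unitfE.
have ch0 (c a b x : I) : x \in [:: c; a; b] -> (x < q)%N -> jchr (d1t (z0, 0)) c a b = 0.
  move=> xcab xq; rewrite /jchr !(@vertical3 _ _ _ x) //; first by rewrite subr0 addr0 mulr0.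
  - by move: xcab; rewrite !inE => /or3P[] ->; rewrite ?orbT.
  - by move: xcab; rewrite !inE => /or3P[] ->; rewrite ?orbT.
have d1r c a b : d1t (z0, 0) (rshift q c) (rshift q a) (rshift q b) =
    s0 * (1 * 1 * 1) * jet1 gh y0 c a b.
  rewrite /d1t /= !sg0r jet1_k0 // jet1_h0 //; first by rewrite add0r !mul1r mulr1.
  by rewrite /all3 /= ltnNge leq_addr.
split=> [i j k l|i j k l x xI xq]; last first.
  rewrite /jcurv.
  have xi : x \in [:: i; l; j; k] by move: xI; rewrite !inE => /or4P[] ->; rewrite ?orbT.
  have xj : x \in [:: j; k; i; l] by move: xI; rewrite !inE => /or4P[] ->; rewrite ?orbT.
  have xk : x \in [:: i; k; j; l] by move: xI; rewrite !inE => /or4P[] ->; rewrite ?orbT.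
  have xl : x \in [:: j; l; i; k] by move: xI; rewrite !inE => /or4P[] ->; rewrite ?orbT.
  rewrite (vertical4 xi xq) (vertical4 xj xq) (vertical4 xk xq) (vertical4 xl xq).
  rewrite !subr0 addr0 mulr0 sub0r big1 ?oppr0 // => m _; apply: big1 => b _.
  have c1 : jchr (d1t (z0, 0)) m i k * jchr (d1t (z0, 0)) b j l = 0.
    move: xI; rewrite !inE => /or4P[] /eqP xE.
    - by rewrite (@ch0 m i k x) ?mul0r // xE !inE eqxx orbT.
    - by rewrite (@ch0 b j l x) ?mulr0 // xE !inE eqxx orbT.
    - by rewrite (@ch0 m i k x) ?mul0r // xE !inE eqxx !orbT.
    - by rewrite (@ch0 b j l x) ?mulr0 // xE !inE eqxx !orbT.
  have c2 : jchr (d1t (z0, 0)) m j k * jchr (d1t (z0, 0)) b i l = 0.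
    move: xI; rewrite !inE => /or4P[] /eqP xE.
    - by rewrite (@ch0 b i l x) ?mulr0 // xE !inE eqxx orbT.
    - by rewrite (@ch0 m j k x) ?mul0r // xE !inE eqxx orbT.
    - by rewrite (@ch0 m j k x) ?mul0r // xE !inE eqxx !orbT.
    - by rewrite (@ch0 b i l x) ?mulr0 // xE !inE eqxx !orbT.
  by rewrite c1 c2 subrr mulr0.
rewrite /scale_tensor curv_gh -[LHS]/(jcurv _ _ _ _ _ _ _).
rewrite -[RHS]/(scale_tensor s0 (fun=> 1) (jcurv (invmx (gh y0)) (jet1 gh y0) (jet2 gh y0)) i j
  k l).
rewrite -(jcurv_scale s00 one_neq0) // LE /jcurv.
have d2r a b c d : d2t (z0, 0) (rshift q a) (rshift q b) (rshift q c) (rshift q d) =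
    scale_tensor s0 (fun=> 1) (jet2 gh y0) a b c d.
  rewrite /d2t /= !sg0r jet2_k0 // jet2_h0 //; first by rewrite /scale_tensor !mul1r add0r mulr1.
  by rewrite /= ltnNge leq_addr.
rewrite !d2r; congr (_ - _).
rewrite big_split_ord /= [X in X + _]big1 ?add0r => [|m _]; last first.
  apply: big1 => b _.
  rewrite !(@ch0 (lshift p m) _ _ (lshift p m) (mem_head _ _) (ltn_ord m)).
  by rewrite !mul0r subrr mulr0.
apply: eq_bigr => m _.
rewrite big_split_ord /= [X in X + _]big1 ?add0r => [|b _]; last first.
  rewrite !(@ch0 (lshift p b) _ _ (lshift p b) (mem_head _ _) (ltn_ord b)).
  by rewrite !mulr0 subrr mulr0.
apply: eq_bigr => b _; rewrite invL block_mxEdr /jchr !d1r.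
by [].
Qed.

Let limit_positive :
  0 < jscal (invmx L) (jcurv (invmx L) (d1t (z0, 0)) (d2t (z0, 0))) /\
  (forall w, w^T = - w -> w != 0 ->
    0 < biv_form (jform t L (jcurv (invmx L) (d1t (z0, 0)) (d2t (z0, 0)))) w).
Proof.
have s00 : s0 != 0 by rewrite gt_eqF.
have symD : (s0 *: gh y0)^T = s0 *: gh y0 by rewrite linearZ /= sym_gh //; exact: WU.
have pos := (posdef_scale s00 one_neq0 s_gt0 t (fun i j k l => curv gh i j k l y0) uD).2.
have [pos1 pos2] : 0 < jscal (invmx (gh y0)) (fun i j k l => curv gh i j k l y0) /\
   (forall w, w^T = - w -> w != 0 ->
    0 < biv_form (jform t (gh y0) (fun i j k l => curv gh i j k l y0)) w).
  split; first exact: scal_gh.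
  apply/posdef_bivectorsP; last exact: riem_gh.
  apply: jform_antisym.
  apply: (curv_antisym (g := invmx (gh y0))) => [|i j k l]; last exact: curv_gh.
  by rewrite trmx_inv sym_gh //; exact: WU.
have [] := pos (conj pos1 pos2); rewrite LE => pos3 pos4.
have pdD : pdmx (s0 *: gh y0) by apply: pdmxZ => //; apply: pd_gh; exact: WU.
exact: posdef_product symH symD pdH pdD vertical_curv pos3 pos4.
Qed.

Let unscale z e : W z -> 0 < e -> ht (z, e) \in unitmx ->
  0 < jscal (invmx (ht (z, e))) (jcurv (invmx (ht (z, e))) (d1t (z, e)) (d2t (z, e))) ->
  (forall w, w^T = - w -> w != 0 -> 0 < biv_form (jform t (ht (z, e))
     (jcurv (invmx (ht (z, e))) (d1t (z, e)) (d2t (z, e)))) w) ->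
  0 < scal (he e) z /\ posdef_bivectors (riem_form t (he e) z).
Proof.
move=> Wz e0; rewrite htE // d1tE // d2tE // => ut.
have uh : he e z \in unitmx by apply: scale_mx_unit ut.
have ee0 : 0 < e ^- 2 by rewrite invr_gt0 exprn_gt0.
have een0 : e ^- 2 != 0 by rewrite gt_eqF.
have sgn0 a := sg_neq0 a e0.
have sym_he y : W y -> (he e y)^T = he e y.
  by move=> Wy; rewrite linearD linearZ /= sym_h0 // sym_k0.
have curv_he i j k l : curv (he e) i j k l z =
    jcurv (invmx (he e z)) (jet1 (he e) z) (jet2 (he e) z) i j k l.
  (* At this stage invertibility of [he e] is known at [z] only; [curvE] asks for it on an open set,
     and the locus of invertibility is open. *)
  pose W' := W `&` [set y | he e y \in unitmx].
  have oW' : open W'.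
    rewrite openE => y [Wy uy]; rewrite /interior; apply: filterI.
      exact: open_nbhs_nbhs.
    apply: (near_unitmx (F := nbhs y) (A := he e) _ uy) => a b.
    exact: class_C_continuous ((class_C_mxP _ _ oW).1 (Che e) a b) Wy.
  have CW' : class_C 2 W' (he e) by apply: class_C_sub (Che e) => y [].
  have sW' y : W' y -> (he e y)^T = he e y by move=> [Wy _]; exact: sym_he.
  have uW' y : W' y -> he e y \in unitmx by move=> [_].
  exact: (curvE oW' CW' sW' uW' i j k l (conj Wz uh)).
pose K i j k l := curv (he e) i j k l z.
have -> : jcurv (invmx (scale_mx (e ^- 2) (sg e) (he e z)))
    (fun c a b => e ^- 2 * (sg e c * sg e a * sg e b) * jet1 (he e) z c a b)
    (scale_tensor (e ^- 2) (sg e) (jet2 (he e) z)) = scale_tensor (e ^- 2) (sg e) K.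
  apply/funext => i; apply/funext => j; apply/funext => k; apply/funext => l.
  by rewrite jcurv_scale // /scale_tensor /K curv_he.
move=> p1 p2.
have [p1' p2'] := (posdef_scale een0 sgn0 ee0 t K uh).1 (conj p1 p2).
split; first exact: p1'.
apply/posdef_bivectorsP; last exact: p2'.
apply: jform_antisym; apply: (curv_antisym (g := invmx (he e z))); last exact: curv_he.
by rewrite trmx_inv sym_he.
Qed.

(** The neighbourhood is one of the pair formed by the point and [e], with [e] tending to 0 from the
    right. This uniformity in the point is what a later compactness argument consumes. *)
Lemma adiabatic : \forall z \near z0 & e \near 0^'+,
  0 < scal (he e) z /\ posdef_bivectors (riem_form t (he e) z).
Proof.
pose G := filter_prod (nbhs z0) (0^'+ : set_system R).
have FG : Filter G by exact: filter_prod_filter.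
have ce : u.2 @[u --> G] --> (0 : R).
  apply: cvg_trans (@cvg_snd _ _ (nbhs z0) (0^'+ : set_system R) _) _.
  exact: cvg_within.
have csg a : sg u.2 a @[u --> G] --> sg 0 a.
  by rewrite /sg; case: ifP => _; [exact: ce|exact: cvg_cst].
have cf (f : V -> R) : {for z0, continuous f} -> f u.1 @[u --> G] --> f z0.
  by move=> cf; exact: (cvg_comp _ _ (@cvg_fst _ _ (nbhs z0) (0^'+ : set_system R) _) cf).
have cont1 (g : V -> 'M[R]_n) c a b : class_C 2 W g ->
    jet1 g u.1 c a b @[u --> G] --> jet1 g z0 c a b.
  move=> Cg; apply: (cf (fun z => jet1 g z c a b)).
  exact: class_C_continuous (class_C_partial c ((class_C_mxP _ _ oW).1 Cg a b)) Wz0.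
have cont2 (g : V -> 'M[R]_n) d c a b : class_C 2 W g ->
    jet2 g u.1 d c a b @[u --> G] --> jet2 g z0 d c a b.
  move=> Cg; apply: (cf (fun z => jet2 g z d c a b)).
  exact: class_C_continuous
    (class_C_partial d (class_C_partial c ((class_C_mxP _ _ oW).1 Cg a b))) Wz0.
have cht a b : ht u a b @[u --> G] --> L a b.
  rewrite -htL mxE; under eq_cvg do rewrite mxE.
  apply: cvgD; first exact: cf (class_C_continuous (Ch0e a b) Wz0).
  apply: cvgM; first by apply: cvgM; exact: csg.
  exact: cf (class_C_continuous (Ck0e a b) Wz0).
have cd1 c a b : d1t u c a b @[u --> G] --> d1t (z0, 0) c a b.
  apply: cvgM; first exact: csg.
  apply: cvgD; first exact: cont1.
  by apply: cvgM; [apply: cvgM; exact: csg|exact: cont1].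
have cd2 d c a b : d2t u d c a b @[u --> G] --> d2t (z0, 0) d c a b.
  apply: cvgM; first by apply: cvgM; exact: csg.
  apply: cvgD; first exact: cont2.
  by apply: cvgM; [apply: cvgM; exact: csg|exact: cont2].
have uL : L \in unitmx.
  rewrite block_diag_mx_unit pdmx_unit //= unitmxZ //.
  by rewrite unitfE gt_eqF.
pose K u := jcurv (invmx (ht u)) (d1t u) (d2t u).
have cK i j k l : K u i j k l @[u --> G] -->
    jcurv (invmx L) (d1t (z0, 0)) (d2t (z0, 0)) i j k l.
  exact: cvg_jcurv.
have [lim1 lim2] := limit_positive.
have n1 : \forall u \near G, 0 < jscal (invmx (ht u)) (K u).
  by have cJ := cvg_jscal (FF := FG) cht uL cK; move: lim1 => /(cvgr_gt _ cJ); exact.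
have n2 : \forall u \near G, forall w, w^T = - w -> w != 0 ->
    0 < biv_form (jform t (ht u) (K u)) w.
  by apply: near_biv_form_gt0 lim2 => i j k l; exact: cvg_jform.
have n3 := near_unitmx (FF := FG) cht uL.
have n4 : \forall u \near G, W u.1.
  have nW : nbhs z0 W by exact: open_nbhs_nbhs.
  exact: (@cvg_fst _ _ (nbhs z0) (0^'+ : set_system R) _ W nW).
have n5 : \forall u \near G, 0 < u.2.
  have n0 : (0^'+ : set_system R) [set e | 0 < e] by exact: nbhs_right_gt.
  exact: (@cvg_snd _ _ (nbhs z0) (0^'+ : set_system R) _ _ n0).
have unscaleP u : W u.1 -> 0 < u.2 -> ht u \in unitmx ->
    0 < jscal (invmx (ht u)) (K u) ->
    (forall w, w^T = - w -> w != 0 -> 0 < biv_form (jform t (ht u) (K u)) w) ->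
    0 < scal (he u.2) u.1 /\ posdef_bivectors (riem_form t (he u.2) u.1).
  by case: u => z e; exact: unscale.
have : \forall u \near G, 0 < scal (he u.2) u.1 /\
    posdef_bivectors (riem_form t (he u.2) u.1).
  near=> u.
  have Wu : W u.1 by exact: (near n4 u).
  have e0 : 0 < u.2 by exact: (near n5 u).
  have uu : ht u \in unitmx by exact: (near n3 u).
  have p1 : 0 < jscal (invmx (ht u)) (K u) by exact: (near n1 u).
  have p2 : forall w, w^T = - w -> w != 0 -> 0 < biv_form (jform t (ht u) (K u)) w.
    by exact: (near n2 u).
  exact: unscaleP.
by apply: filterS => -[].
Unshelve. all: by end_near. Qed.

End Adiabatic.

(** * Bump functions *)

Section Bump.
Variable R : realType.

(* The factor [x^-1 ^+ m] makes this family stable under differentiation. *)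
Definition flat (m : nat) (x : R) : R :=
  if 0 < x then x^-1 ^+ m * expR (- x^-1) else 0.

Lemma flat_ge0 m x : 0 <= flat m x.
Proof.
rewrite /flat; case: ifP => // x0.
by rewrite mulr_ge0 ?expR_ge0 // exprn_ge0 // invr_ge0 ltW.
Qed.

Lemma flat_gt0 x : (0 < flat 0 x) = (0 < x).
Proof. by rewrite /flat; case: ifP; rewrite ?ltxx // mul1r expR_gt0. Qed.

(** A single term of the exponential series, of degree [m.+2], dominates the power of [x^-1]. The
    factor [x ^+ 2] yields differentiability at 0 with derivative 0. *)
Lemma flat_le m x : flat m x <= (m.+2)`!%:R * x ^+ 2.
Proof.
rewrite /flat; case: ifP => [x0|_]; last by rewrite mulr_ge0 // sqr_ge0.
set N : R := (m.+2)`!%:R; have N0 : 0 < N by rewrite ltr0n fact_gt0.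
have H : x^-1 ^+ m.+2 <= N * expR x^-1.
  have /(expR_ge1Dxn m.+1) : 0 <= x^-1 by rewrite invr_ge0 ltW.
  rewrite -/N => H; rewrite mulrC -ler_pdivrMr //.
  by apply: le_trans H; rewrite lerDr.
rewrite expRN ler_pdivrMr ?expR_gt0 // mulrAC.
apply: le_trans (ler_wpM2r (sqr_ge0 x) H).
have -> : x^-1 ^+ m.+2 = x^-1 ^+ m * x^-1 ^+ 2 by rewrite -exprD addn2.
by rewrite -mulrA -exprMn mulVf ?gt_eqF // expr1n mulr1.
Qed.

Lemma is_derive_flat m (x : R) :
  is_derive x 1 (flat m) (flat m.+2 x - m%:R * flat m.+1 x).
Proof.
have [x0|x0|x0] := ltgtP 0 x.
- have xn0 : x != 0 by rewrite gt_eqF.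
  have nE : \near x, x^-1 ^+ m * expR (- x^-1) = flat m x.
    near=> y; rewrite /flat ifT //; near: y; exact: lt_nbhsr.
  apply: near_eq_is_derive nE _.
  rewrite /flat x0.
  pose y := x^-1; have yE : x ^- 2 = y * y by rewrite /y -invfM -expr2.
  have dV : is_derive x 1 (fun y : R => y^-1) (- (y * y)).
    have d := @is_deriveV _ id x 1 1 xn0 (is_derive_id _ _).
    by apply: is_derive_eq d _; rewrite /= yE /GRing.scale /= mulr1.
  have dX := @is_deriveX _ _ (fun y : R => y^-1) m x 1 _ dV.
  have E : ((fun y : R => y^-1) ^+ m : R -> R) = (fun y => y^-1 ^+ m).
    apply/funext => z; elim: m {dX} => [|k IH]; first by rewrite !expr0.
    by rewrite !exprS -IH.
  rewrite E in dX.
  have dN := @is_deriveN _ _ _ (fun y : R => y^-1) x 1 _ dV.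
  have dE := @is_derive1_comp _ expR (fun y : R => - y^-1) x _ _ (is_derive_expR _) dN.
  have dM := is_deriveM dX dE.
  apply: is_derive_eq dM _.
  rewrite /GRing.scale /= opprK -/y.
  by case: m {dX E} => [|m]; rewrite ?exprS /=; ring.
- have nE : \near x, (cst 0 : R -> R) x = flat m x.
    near=> y; rewrite /flat ifF //; apply/negbTE; rewrite -leNgt ltW //.
    near: y; exact: lt_nbhsl.
  apply: near_eq_is_derive nE _.
  by rewrite /flat !ifF ?subrr ?mulr0 ?subr0 ?ltNge ?(ltW x0) //; exact: is_derive_cst.
have f0 k : flat k 0 = 0 by rewrite /flat ltxx.
rewrite -x0 {x x0}.
rewrite !f0 mulr0 subr0.
(* At 0 the difference quotient is [flat m h] divided by [h], hence at most a constant times the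
   absolute value of [h] by [flat_le]. *)
have H : (fun h : R => h^-1 *: (flat m (h *: (1 : R^o) + 0) - flat m 0)) @ (0 : R)^' --> (0 : R).
  apply/cvgrPdist_le => e e0.
  pose N : R := (m.+2)`!%:R; have N0 : 0 < N by rewrite ltr0n fact_gt0.
  have eN : 0 < e / N by exact: divr_gt0.
  near=> h.
  rewrite f0 subr0 addr0 sub0r normrN normrM [h *: _]mulr1.
  rewrite (ger0_norm (flat_ge0 _ _)).
  apply: le_trans (ler_wpM2l (normr_ge0 _) (flat_le m h)) _.
  have hn0 : h != 0 by near: h; exact: nbhs_dnbhs_neq.
  rewrite -/N -(real_normK (num_real h)) normfV mulrCA expr2 mulKf ?normr_eq0 //.
  rewrite mulrC -ler_pdivlMr //.
  near: h; exact: dnbhs0_le.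
apply: DeriveDef; first by apply/cvg_ex; exists 0.
exact: cvg_lim H.
Unshelve. all: by end_near. Qed.

Lemma class_C_flat k m U : open U ->
  class_C k U (fun v : 'rV[R]_1 => flat m (v 0 0)).
Proof.
move=> oU; elim: k m => [|k IH] m.
  split=> // v _; apply: (continuous_comp (@coord_continuous _ _ _ 0 0 v)).
  apply: differentiable_continuous; apply/derivable1_diffP.
  exact: (@ex_derive _ _ _ _ _ _ _ (is_derive_flat m (v 0 0))).
have dF i (v : 'rV[R]_1) : is_derive v (delta_mx 0 i) (fun v : 'rV[R]_1 => flat m (v 0 0))
    (flat m.+2 (v 0 0) - m%:R * flat m.+1 (v 0 0)).
  have E : (fun h : R => h^-1 *: (flat m ((h *: delta_mx 0 i + v) 0 0) - flat m (v 0 0)))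
    = (fun h : R => h^-1 *: (flat m (h *: (1 : R^o) + v 0 0) - flat m (v 0 0))).
    by apply/funext => h; rewrite !mxE (ord1 i) !eqxx.
  have [d1 d2] := is_derive_flat m (v 0 0).
  apply: DeriveDef.
    rewrite /derivable -[X in cvg (X @ _)]/(fun h : R => h^-1 *: (flat m ((h *: delta_mx 0 i +
      v) 0 0) - flat m (v 0 0))).
    by rewrite E.
  rewrite /derive -[X in lim (X @ _)]/(fun h : R => h^-1 *: (flat m ((h *: delta_mx 0 i + v) 0
    0) - flat m (v 0 0))).
  by rewrite E.
split=> [v _|i].
  apply: (continuous_comp (@coord_continuous _ _ _ 0 0 v)).
  apply: differentiable_continuous; apply/derivable1_diffP.
  exact: (@ex_derive _ _ _ _ _ _ _ (is_derive_flat m (v 0 0))).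
split=> [v _|]; first exact: (@ex_derive _ _ _ _ _ _ _ (dF i v)).
have E (v : 'rV[R]_1) : flat m.+2 (v 0 0) + (- m%:R) * flat m.+1 (v 0 0) =
    partial i (fun v : 'rV[R]_1 => flat m (v 0 0)) v.
  by rewrite (@has_partialE _ _ i _ v _ (dF i v)) mulNr.
apply: (class_C_eq oU E); apply: class_CD => //; apply: class_CM => //.
exact: class_C_cst.
Qed.

Variable n : nat.
Local Notation V := ('rV[R]_n).

Lemma class_C_coord k (U : set V) i : open U -> class_C k U (fun v : V => v 0 i).
Proof.
move=> oU; case: k => [|k]; split=> //.
- by move=> v _; exact: coord_continuous.
- by move=> v _; exact: coord_continuous.
have dF j (v : V) : is_derive v (delta_mx 0 j) (fun v : V => v 0 i) ((j == i)%:R).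
  have := is_derive_id v (delta_mx 0 j : V) => -[d1 d2].
  have d1' : derivable (fun v : V => v 0 i) v (delta_mx 0 j).
    by have /derivable_mxP := d1; apply.
  apply: DeriveDef => //.
  by have := partial_mx 0 i d1; rewrite /partial => <-; rewrite d2 mxE eqxx eq_sym.
move=> j; split=> [v _|]; first exact: (@ex_derive _ _ _ _ _ _ _ (dF j v)).
have E (v : V) : (j == i)%:R = partial j (fun v : V => v 0 i) v.
  by rewrite (@has_partialE _ _ j _ v _ (dF j v)).
exact: (class_C_eq oU E (class_C_cst _ ((j == i)%:R : R) oU)).
Qed.

(** The norm on row vectors is the sup norm, so a product over the coordinates is positive exactly
    on a ball when [d] is positive. *)
Definition bump (c : V) (d : R) (y : V) : R :=
  \prod_(i < n) flat 0 (d ^+ 2 - (y 0 i - c 0 i) ^+ 2).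

Lemma bump_smooth c d k U : open U -> class_C k U (bump c d).
Proof.
move=> oU; apply: class_C_prod => // i.
pose g (y : V) : 'rV[R]_1 := \row_(_ < 1) (d ^+ 2 - (y 0 i - c 0 i) ^+ 2).
have E y : ((fun v : 'rV[R]_1 => flat 0 (v 0 0)) \o g) y =
    flat 0 (d ^+ 2 - (y 0 i - c 0 i) ^+ 2) by rewrite /= mxE.
apply: (class_C_eq oU E).
apply: (class_C_comp (U' := setT)) => //; first exact: openT; last first.
  exact: class_C_flat openT.
apply/(class_C_mxP _ _ oU) => a b.
have E' (y : V) : d ^+ 2 + (-1) * ((y 0 i + - c 0 i) * (y 0 i + - c 0 i)) = g y a b.
  by rewrite mxE mulN1r expr2.
have Cc (e : R) : class_C k U (fun _ : V => e) by exact: class_C_cst.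
have Cl : class_C k U (fun y : V => y 0 i + - c 0 i).
  by apply: class_CD => //; exact: class_C_coord.
by apply: (class_C_eq oU E'); apply: class_CD => //; do 2!apply: class_CM => //.
Qed.

Lemma bump_ge0 c d y : 0 <= bump c d y.
Proof. by apply: prodr_ge0 => i _; exact: flat_ge0. Qed.

Lemma bump_gt0 c d : 0 < d -> 0 < bump c d c.
Proof.
move=> d0; apply: prodr_gt0 => i _.
by rewrite flat_gt0 subrr expr0n subr0 exprn_gt0.
Qed.

Lemma bump_supp c d y : 0 <= d -> bump c d y != 0 -> `|y - c| <= d.
Proof.
move=> d0 /prodf_neq0 dy; apply: rV_norm_le => // i.
have := dy i isT.
rewrite mxE [(- c) _ _]mxE.
have -> : (flat 0 (d ^+ 2 - (y 0 i - c 0 i) ^+ 2) != 0) =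
  (0 < flat 0 (d ^+ 2 - (y 0 i - c 0 i) ^+ 2)) by rewrite lt_def flat_ge0 andbT.
rewrite flat_gt0 subr_gt0 -real_normK ?num_real // => H.
by apply: ltW; move: H; rewrite ltr_pXn2r // nnegrE.
Qed.

End Bump.

(** * Plots *)

Section SmoothMaps.
Variables (R : realType).

Lemma smooth_in_comp n m (l k : nat) (U : set 'rV[R]_n) (U' : set 'rV[R]_m)
    (f : 'rV[R]_m -> 'M[R]_(l, k)) (g : 'rV[R]_n -> 'rV[R]_m) :
  open U -> open U' -> smooth_in U g -> smooth_in U' f ->
  (forall x, U x -> U' (g x)) -> smooth_in U (f \o g).
Proof.
move=> oU oU' sg sf UU' j; apply/(class_C_mxP _ _ oU) => a b.
apply: (class_C_comp (f := fun y => f y a b) oU oU') => //.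
exact: (class_C_mxP _ _ oU').1.
Qed.

Lemma smooth_in_sub n (W : normedModType R) (U U' : set 'rV[R]_n) (f : 'rV[R]_n -> W) :
  U' `<=` U -> smooth_in U f -> smooth_in U' f.
Proof. by move=> sU sf k; exact: class_C_sub sU (sf k). Qed.

Lemma smooth_in_near n (W : normedModType R) (U : set 'rV[R]_n) (f : 'rV[R]_n -> W) :
  (forall x, U x -> exists U', [/\ open U', U' x & smooth_in U' f]) -> smooth_in U f.
Proof.
move=> loc k; apply: class_C_near => x /loc [U' [oU' U'x sf]].
by exists U'; split=> //; exact: sf.
Qed.

Lemma eq_smooth_in n (W : normedModType R) (U : set 'rV[R]_n) (f g : 'rV[R]_n -> W) :
  open U -> (forall x, U x -> f x = g x) -> smooth_in U f -> smooth_in U g.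
Proof.
move=> oU fg sf k; apply: eq_class_C oU _ (sf k) => x; rewrite inE; exact: fg.
Qed.

Lemma smooth_in_mxP n m p (U : set 'rV[R]_n) (f : 'rV[R]_n -> 'M[R]_(m, p)) : open U ->
  smooth_in U f <-> forall a b, smooth_in U (fun x => f x a b).
Proof.
move=> oU; split=> [sf a b k|sf k]; first exact: (class_C_mxP _ _ oU).1.
by apply/(class_C_mxP _ _ oU) => a b; exact: sf.
Qed.

Lemma jacobian_comp n m l (U : set 'rV[R]_n) (U' : set 'rV[R]_m)
    (f : 'rV[R]_m -> 'rV[R]_l) (g : 'rV[R]_n -> 'rV[R]_m) x :
  open U -> open U' -> smooth_in U g -> smooth_in U' f -> U x -> U' (g x) ->
  'J (f \o g) x = 'J g x *m 'J f (g x).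
Proof.
move=> oU oU' sg sf Ux U'x.
have dg := class_C1_differentiable_rV oU (sg 1) Ux.
have df := class_C1_differentiable_rV oU' (sf 1) U'x.
apply/row_matrixP => i; rewrite !rowE mulmxA /jacobian !mul_rV_lin1.
by rewrite diff_comp.
Qed.

Lemma eq_jacobian n m (U : set 'rV[R]_n) (f g : 'rV[R]_n -> 'rV[R]_m) x :
  open U -> smooth_in U f -> U x -> (forall y, U y -> f y = g y) ->
  'J f x = 'J g x.
Proof.
move=> oU sf Ux fg; have sg := eq_smooth_in oU fg sf.
apply/matrixP => i j.
have E1 := jacobianE i j oU (sf 1) Ux; have E2 := jacobianE i j oU (sg 1) Ux.
apply: (etrans E1); apply: (etrans _ (esym E2)).
by apply: eq_partial; apply: (near_in_open oU Ux) => y /fg ->.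
Qed.

Lemma jacobian_id n (x : 'rV[R]_n) : 'J idfun x = 1%:M.
Proof.
apply/row_matrixP => i; rewrite !rowE -deriveEjacobian; last exact: ex_diff.
by rewrite derive_id mulmx1.
Qed.

Lemma open_preimage (S T : topologicalType) (W : set S) (k : S -> T) (D : set T) :
  open W -> {in W, continuous k} -> open D -> open (W `&` k @^-1` D).
Proof.
move=> oW ck oD; rewrite openE => x [Wx Dx]; apply: filterI.
  exact: open_nbhs_nbhs.
have := ck x (mem_set Wx) D; apply.
exact: open_nbhs_nbhs.
Qed.

End SmoothMaps.

Section Plots.
Variables (R : realType).

(* What is kept of [is_manifold] for [prod_atlas]: second countability and the
   compatibility of product charts are not needed. *)
Record charted m (T : topologicalType) (A : atlas R m T) : Prop := Charted {
  ch_cover : forall x, exists a, chart_dom A a x;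
  ch_dom_open : forall a, open (chart_dom A a);
  ch_img_open : forall a : chart_ix A, open (chart_img a);
  ch_mapK : forall a, {in chart_dom A a, cancel (chart_map A a) (chart_inv A a)};
  ch_inv_cont : forall a : chart_ix A, {in chart_img a, continuous (chart_inv A a)} }.

Lemma charted_manifold m (T : topologicalType) (A : atlas R m T) :
  is_manifold A -> charted A.
Proof. by case=> *; exact: Charted. Qed.

Lemma chart_imgP m (T : topologicalType) (A : atlas R m T) (a : chart_ix A) y :
  charted A -> chart_img a y ->
  chart_dom A a (chart_inv A a y) /\ chart_map A a (chart_inv A a y) = y.
Proof.
move=> cA [x Dx <-]; have E := ch_mapK cA (mem_set Dx).
by rewrite E.
Qed.

Lemma charted_prod m n (S T : topologicalType) (A : atlas R m S) (B : atlas R n T) :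
  charted A -> charted B -> charted (prod_atlas A B).
Proof.
move=> cA cB.
have imgE (c : chart_ix (prod_atlas A B)) :
    chart_img c = [set y | chart_img c.1 (lsubmx y) /\ chart_img c.2 (rsubmx y)].
  apply/seteqP; split=> [_ [[x x'] [Dx Dx'] <-]|y [[x Dx xE] [x' Dx' xE']]].
    by rewrite /= row_mxKl row_mxKr; split; [exists x|exists x'].
  by exists (x, x') => //=; rewrite xE xE' hsubmxK.
split.
- move=> [x y]; have [a ax] := ch_cover cA x; have [b by_] := ch_cover cB y.
  by exists (a, b).
- move=> [a b]; rewrite openE => -[x y] [/= ax by_].
  exists (chart_dom A a, chart_dom B b) => //=; split; apply: open_nbhs_nbhs; split=> //.
    exact: ch_dom_open.
  exact: ch_dom_open.
- move=> [a b]; rewrite imgE; apply: openI.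
    apply: open_comp => [y _|]; last exact: ch_img_open.
    exact/differentiable_continuous/differentiable_lsubmx.
  apply: open_comp => [y _|]; last exact: ch_img_open.
  exact/differentiable_continuous/differentiable_rsubmx.
- move=> [a b] [x y]; rewrite inE => -[/= ax by_].
  by rewrite row_mxKl row_mxKr !ch_mapK // inE.
- move=> [a b] y; rewrite imgE inE => -[/= ya yb].
  have c1 : {for y, continuous (@lsubmx R 1 m n)}.
    exact/differentiable_continuous/differentiable_lsubmx.
  have c2 : {for y, continuous (@rsubmx R 1 m n)}.
    exact/differentiable_continuous/differentiable_rsubmx.
  have H1 : chart_inv A a (lsubmx y') @[y' --> y] --> chart_inv A a (lsubmx y).
    apply: (continuous_comp (f := lsubmx) (g := chart_inv A a)); first exact: c1.
    by apply: (ch_inv_cont cA); rewrite inE.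
  have H2 : chart_inv B b (rsubmx y') @[y' --> y] --> chart_inv B b (rsubmx y).
    apply: (continuous_comp (f := rsubmx) (g := chart_inv B b)); first exact: c2.
    by apply: (ch_inv_cont cB); rewrite inE.
  exact: (cvg_pair H1 H2).
Qed.

(* The metric on the total space is defined along arbitrary plots: charts of the total
   space and products of charts in a local trivialization are then on the same footing. *)
Record is_plot m n (T : topologicalType) (A : atlas R m T) (W : set 'rV[R]_n)
    (k : 'rV[R]_n -> T) : Prop := Plot {
  plot_open : open W;
  plot_cont : {in W, continuous k};
  plot_smooth : forall b : chart_ix A,
    smooth_in (W `&` k @^-1` chart_dom A b) (chart_map A b \o k) }.

Lemma plot_chart_open m n (T : topologicalType) (A : atlas R m T) (W : set 'rV[R]_n) k b :
  charted A -> is_plot A W k -> open (W `&` k @^-1` chart_dom A b).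
Proof. by move=> cA [oW ck _]; apply: open_preimage => //; exact: ch_dom_open. Qed.

Lemma coord_dom_open m n (S T : topologicalType) (A : atlas R m S) (B : atlas R n T)
    (U : set S) (f : S -> T) (a : chart_ix A) (b : chart_ix B) :
  charted A -> charted B -> open U -> {in U, continuous f} ->
  open (coord_dom U f a b : set 'rV[R]_m).
Proof.
move=> cA cB oU cf.
have -> : coord_dom U f a b =
   chart_img a `&` chart_inv A a @^-1` (U `&` f @^-1` chart_dom B b).
  by apply/seteqP; split=> y; [move=> []|move=> [ya [Uy fy]]; split].
apply: open_preimage; [exact: ch_img_open|exact: ch_inv_cont|].
by apply: open_preimage => //; exact: ch_dom_open.
Qed.

(** Near each point the composite factors through a chart [a] of the middle space: it is
    [coord_map f a b] after [chart_map A a \o k]. *)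
Lemma plot_comp m n l (S T : topologicalType) (A : atlas R m S) (B : atlas R n T)
    (U : set S) (f : S -> T) (W : set 'rV[R]_l) (k : 'rV[R]_l -> S) :
  charted A -> charted B -> open U -> smooth_on A B U f -> is_plot A W k ->
  is_plot B (W `&` k @^-1` U) (f \o k).
Proof.
move=> cA cB oU [cf sf] pk; have [oW ck sk] := pk; split.
- exact: open_preimage.
- move=> z; rewrite inE => -[Wz Uz]; apply: continuous_comp.
    by apply: ck; rewrite inE.
  by apply: cf; rewrite inE.
move=> b; apply: smooth_in_near => z [[Wz Uz] bz].
have [a az] := ch_cover cA (k z).
pose N := (W `&` k @^-1` chart_dom A a) `&` k @^-1` (U `&` f @^-1` chart_dom B b).
have oN : open N.
  apply: open_preimage; first exact: plot_chart_open.
    by move=> y; rewrite inE => -[Wy _]; apply: ck; rewrite inE.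
  by apply: open_preimage => //; exact: ch_dom_open.
exists N; split=> //.
have kE y : N y -> chart_inv A a (chart_map A a (k y)) = k y.
  by move=> [[_ ay] _]; rewrite (ch_mapK cA) // inE.
apply: (@eq_smooth_in _ _ _ _ (coord_map f a b \o (chart_map A a \o k))) => //.
  by move=> y Ny; rewrite /coord_map /= kE.
apply: (smooth_in_comp (U' := coord_dom U f a b)) => //.
- by apply: coord_dom_open.
- by apply: smooth_in_sub (sk a) => y [].
- move=> y Ny; have [[_ ay] [Uy fy]] := Ny.
  by split; rewrite /= ?kE //; exists (k y).
Qed.

Lemma plot_chart m (T : topologicalType) (A : atlas R m T) (a : chart_ix A) :
  is_manifold A -> is_plot A (chart_img a) (chart_inv A a).
Proof.
move=> mA; have cA := charted_manifold mA; split.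
- exact: ch_img_open.
- exact: ch_inv_cont.
move=> b; have [_ /(_ a b)] := mfd_compat mA.
by apply: smooth_in_sub => y [ya yb].
Qed.

Lemma plot_sub m n (T : topologicalType) (A : atlas R m T) (W W' : set 'rV[R]_n) k :
  open W' -> W' `<=` W -> is_plot A W k -> is_plot A W' k.
Proof.
move=> oW' sW [oW ck sk]; split=> //.
  by move=> y; rewrite inE => /sW Wy; apply: ck; rewrite inE.
by move=> b; apply: smooth_in_sub (sk b) => y [/sW].
Qed.

Lemma plot_reparam m n l (T : topologicalType) (A : atlas R m T) (W : set 'rV[R]_n) k
    (W' : set 'rV[R]_l) (phi : 'rV[R]_l -> 'rV[R]_n) :
  charted A -> is_plot A W k -> open W' -> smooth_in W' phi ->
  (forall y, W' y -> W (phi y)) -> is_plot A W' (k \o phi).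
Proof.
move=> cA pk oW' sphi WW'; have [oW ck sk] := pk.
have cphi : {in W', continuous phi} by have [] := sphi 0.
have ckphi : {in W', continuous (k \o phi)}.
  move=> y yW; apply: continuous_comp; first exact: cphi.
  by apply: ck; rewrite inE; apply: WW'; rewrite inE in yW.
split=> // b.
have oN : open (W' `&` (k \o phi) @^-1` chart_dom A b).
  by apply: open_preimage => //; exact: ch_dom_open.
apply: (smooth_in_comp (f := chart_map A b \o k) (U' := W `&` k @^-1` chart_dom A b)) => //.
- exact: plot_chart_open.
- by apply: smooth_in_sub sphi => y [].
- by move=> y [/WW' Wy by_]; split.
Qed.

Lemma plot_snd m n l (S T : topologicalType) (A : atlas R m S) (B : atlas R n T)
    (W : set 'rV[R]_l) k : charted A -> charted B ->
  is_plot (prod_atlas A B) W k -> is_plot B W (snd \o k).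
Proof.
move=> cA cB pk; have [oW ck sk] := pk.
have c1 : {in W, continuous (snd \o k)}.
  by move=> y yW; apply: continuous_comp; [exact: ck|exact: cvg_snd].
split=> // b; apply: smooth_in_near => z [Wz bz].
have [a az] := ch_cover cA (k z).1.
pose N := W `&` k @^-1` chart_dom (prod_atlas A B) (a, b).
have oN : open N by apply: plot_chart_open => //; exact: charted_prod.
exists N; split=> //.
apply/smooth_in_mxP => // i j; rewrite (ord1 i).
apply: eq_smooth_in oN _ ((smooth_in_mxP _ oN).1 (sk (a, b)) 0 (rshift m j)) => y _ /=.
by rewrite row_mxEr.
Qed.

Lemma smooth_in_row_mx n m l (U : set 'rV[R]_n) (f : 'rV[R]_n -> 'rV[R]_m)
    (g : 'rV[R]_n -> 'rV[R]_l) : open U -> smooth_in U f -> smooth_in U g ->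
  smooth_in U (fun x => row_mx (f x) (g x)).
Proof.
move=> oU sf sg; apply/smooth_in_mxP => // i j.
case: (split_ordP j) => j' ->.
  apply: eq_smooth_in oU _ ((smooth_in_mxP _ oU).1 sf i j') => y _.
  by rewrite row_mxEl.
apply: eq_smooth_in oU _ ((smooth_in_mxP _ oU).1 sg i j') => y _.
by rewrite row_mxEr.
Qed.

Lemma plot_pair m n l (S T : topologicalType) (A : atlas R m S) (B : atlas R n T)
    (W : set 'rV[R]_l) k k' : charted A -> charted B ->
  is_plot A W k -> is_plot B W k' -> is_plot (prod_atlas A B) W (fun z => (k z, k' z)).
Proof.
move=> cA cB pk pk'; have [oW ck sk] := pk; have [_ ck' sk'] := pk'.
split=> //; first by move=> y yW; exact: (cvg_pair (ck _ yW) (ck' _ yW)).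
move=> [a b] /=.
have -> : W `&` (fun z => (k z, k' z)) @^-1` (chart_dom A a `*` chart_dom B b) =
   (W `&` k @^-1` chart_dom A a) `&` (W `&` k' @^-1` chart_dom B b).
  by apply/seteqP; split=> [y [Wy [ay by_]]|y [[Wy ay] [_ by_]]].
have oN : open ((W `&` k @^-1` chart_dom A a) `&` (W `&` k' @^-1` chart_dom B b)).
  by apply: openI; exact: plot_chart_open.
apply: (smooth_in_row_mx (f := chart_map A a \o k) (g := chart_map B b \o k')) => //.
  by apply: smooth_in_sub (sk a) => y [].
by apply: smooth_in_sub (sk' b) => y [].
Qed.

End Plots.

(** * Bump functions on the base *)

Section BumpCover.
Variables (R : realType) (q : nat) (B : topologicalType) (AB : atlas R q B).
Hypothesis hB : is_closed_manifold AB.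

(** The closed set [K] inside the open set allows extension by 0: an object defined only over [O]
    and the chart [c] becomes smooth everywhere once multiplied by [rho]. Smoothness is tested on
    plots, so it needs no choice of charts. *)
Record good_bump (O : set B) (c : chart_ix AB) (rho : B -> R) : Prop := GoodBump {
  gb_ge0 : forall b, 0 <= rho b;
  gb_supp : exists K, [/\ closed K, K `<=` O `&` chart_dom AB c &
                          forall b, rho b != 0 -> K b];
  gb_smooth : forall n (W : set 'rV[R]_n) k, is_plot AB W k -> smooth_in W (rho \o k) }.

Let mB := cmfd_manifold hB.
Let cB := charted_manifold mB.

Lemma exists_bump (O : set B) b : open O -> O b ->
  exists c rho, good_bump O c rho /\ \forall x \near b, 0 < rho x.
Proof.
move=> oO Ob; have [c cb] := ch_cover cB b.
pose y := chart_map AB c b.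
have yE : chart_inv AB c y = b by rewrite /y (ch_mapK cB) // inE.
have iy : chart_img c y by exists b.
have oN : open (chart_img c `&` chart_inv AB c @^-1` O).
  by apply: open_preimage => //; [exact: ch_img_open|exact: ch_inv_cont].
have /nbhs_ballP[e /= e0 ye] : nbhs y (chart_img c `&` chart_inv AB c @^-1` O).
  by apply: open_nbhs_nbhs; split=> //; split=> //=; rewrite yE.
pose d := e / 2; have d0 : 0 < d by rewrite divr_gt0.
pose S := [set v : 'rV[R]_q | `|v - y| <= d].
have SN : S `<=` chart_img c `&` chart_inv AB c @^-1` O.
  move=> v Sv; apply: ye; rewrite -ball_normE /= distrC.
  by apply: le_lt_trans Sv _; rewrite /d ltr_pdivrMr // ltr_pMr // ltr1n.
have cS : compact S.
  apply: bounded_closed_compact.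
    exists (d + `|y|); split; [exact: num_real|move=> x xd v Sv /=].
    apply: le_trans (ltW xd); rewrite -(subrK y v).
    by apply: le_trans (ler_normD _ _) _; rewrite lerD2r.
  have -> : S = (fun v => `|v - y|) @^-1` [set x | x <= d] by [].
  apply: closed_comp => [v _|]; last exact: closed_le.
  apply: continuous_comp; last exact: norm_continuous.
  by apply: continuousB; [exact: cvg_id|exact: cst_continuous].
pose K := chart_inv AB c @` S.
(* The Hausdorff property enters here: the image of a compact cube is closed in the whole base, not
   merely in the chart. *)
have clK : closed K.
  apply: compact_closed; first exact: mfd_hausdorff mB.
  apply: continuous_compact => //.
  apply: continuous_in_subspaceT => v; rewrite inE => Sv.
  by apply: (ch_inv_cont cB); rewrite inE; have [] := SN _ Sv.
pose rho x := if `[< chart_dom AB c x >] then bump y d (chart_map AB c x) else 0.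
have rhoK x : rho x != 0 -> K x.
  rewrite /rho; case: asboolP => [cx|_]; last by rewrite eqxx.
  move=> /(bump_supp (ltW d0)) Sx; exists (chart_map AB c x) => //.
  by rewrite (ch_mapK cB) // inE.
exists c, rho; split; last first.
  have nc : \forall x \near b, chart_dom AB c x.
    by apply: open_nbhs_nbhs; split=> //; exact: ch_dom_open.
  have cm : {for b, continuous (chart_map AB c)} by apply: (mfd_map_cont mB); rewrite inE.
  have cb' : {for y, continuous (bump y d)}.
    exact: class_C_continuous (@bump_smooth R q y d 0 setT openT) I.
  have nb : \forall x \near b, 0 < bump y d (chart_map AB c x).
    have cc := continuous_comp cm cb'.
    have := bump_gt0 y d0; rewrite -[y in bump _ _ y]/(chart_map AB c b).
    by move=> /(cvgr_gt _ cc).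
  near=> x; rewrite /rho asboolT //; first by near: x.
  by near: x.
split.
- by move=> x; rewrite /rho; case: ifP => // _; exact: bump_ge0.
- exists K; split=> // x [v Sv <-]; have [iv Ov] := SN _ Sv; split=> //.
  by have [] := chart_imgP cB iv.
move=> n W k pk; have [oW ck sk] := pk.
(* The preimages of the chart domain and of the complement of [K] are open and cover [W], because
   [K] lies in the chart domain. *)
apply: smooth_in_near => z Wz; have [cz|cz] := pselect (chart_dom AB c (k z)).
  exists (W `&` k @^-1` chart_dom AB c); have oN' := plot_chart_open (b := c) cB pk.
  split=> // j.
  apply: (@eq_class_C _ _ _ _ _ (bump y d \o (chart_map AB c \o k))) => //.
    by move=> x; rewrite inE => -[_ cx]; rewrite /rho /= asboolT.
  apply: (class_C_comp (U' := setT)) => //; [exact: openT|exact: sk|].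
  exact: bump_smooth openT.
exists (W `&` k @^-1` (~` K)); split.
- by apply: open_preimage => //; exact: closed_openC.
- by split=> // -[v Sv E]; apply: cz; rewrite -E; have [/(chart_imgP cB)[]] := SN _ Sv.
move=> j; have oN' : open (W `&` k @^-1` (~` K)).
  by apply: open_preimage => //; exact: closed_openC.
apply: (@eq_class_C _ _ _ _ _ (cst 0)) => //; last exact: class_C_cst.
move=> x; rewrite inE => -[_ nK] /=; apply/esym/eqP.
by have [//|/rhoK] := eqVneq (rho (k x)) 0.
Unshelve. all: by end_near. Qed.

(** [T] indexes a finite subcover by positivity sets. The functions are not normalized: the sums
    built from them only ask for some positive weight at every point. *)
Lemma bump_cover (J : Type) (D : J -> set B) :
  (forall j, open (D j)) -> (forall b, exists j, D j b) ->
  exists (T : finType) (tau : T -> J) (c : T -> chart_ix AB) (rho : T -> B -> R),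
    (forall i, good_bump (D (tau i)) (c i) (rho i)) /\
    (forall b, exists i, 0 < rho i b).
Proof.
move=> oD cD.
have ex (b : B) : exists u : J * chart_ix AB * (B -> R),
    good_bump (D u.1.1) u.1.2 u.2 /\ \forall x \near b, 0 < u.2 x.
  have [j Djb] := cD b; have [c [rho H]] := exists_bump (oD j) Djb.
  by exists (j, c, rho).
have [u uP] := choice ex.
pose f b := interior [set x | 0 < (u b).2 x].
(* Finite lists, directed by inclusion, form the parameter filter: near-covering compactness then
   produces a finite subcover. *)
pose F : set_system (seq B) := fun S => exists s0 : seq B, forall s, {subset s0 <= s} -> S s.
have FF : Filter F.
  split.
  - by exists [::].
  - move=> S S' [s sS] [s' sS']; exists (s ++ s') => r sr; split.
      by apply: sS => x xs; apply: sr; rewrite mem_cat xs.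
    by apply: sS' => x xs; apply: sr; rewrite mem_cat xs orbT.
  - by move=> S S' SS' [s sS]; exists s => r /sS /SS'.
have := (compact_near_coveringP [set: B]).1 (cmfd_compact hB) _ F
  (fun s x => exists2 b, b \in s & f b x) FF.
case=> [x _|s0 /(_ s0 (fun _ => id)) cov].
  exists (f x, [set s : seq B | x \in s]) => /=.
    split; first by apply: open_nbhs_nbhs; split; [exact: open_interior|exact: (uP x).2].
    by exists [:: x] => s; apply; rewrite mem_head.
  by move=> [x' s] /= [fx xs]; exists x.
exists (seq_sub s0), (fun i => (u (ssval i)).1.1), (fun i => (u (ssval i)).1.2),
  (fun i => (u (ssval i)).2).
split=> [i|b]; first exact: (uP (ssval i)).1.
have [b' b'X /interior_subset fb] := cov b I.
by exists (SeqSub b'X).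
Qed.

End BumpCover.

(** * The bundle metric *)

Section SmoothMatrices.
Variables (R : realType) (n : nat) (U : set 'rV[R]_n).
Hypothesis oU : open U.

Lemma smooth_in_sum (I : finType) (f : I -> 'rV[R]_n -> R) :
  (forall i, smooth_in U (f i)) -> smooth_in U (fun x => \sum_i f i x).
Proof. by move=> sf k; apply: class_C_sum => // i _; exact: sf. Qed.

Lemma smooth_inM (f g : 'rV[R]_n -> R) :
  smooth_in U f -> smooth_in U g -> smooth_in U (fun x => f x * g x).
Proof. by move=> sf sg k; exact: class_CM oU (sf k) (sg k). Qed.

Lemma smooth_in_mulmx m l k (f : 'rV[R]_n -> 'M[R]_(m, l)) (g : 'rV[R]_n -> 'M[R]_(l, k)) :
  smooth_in U f -> smooth_in U g -> smooth_in U (fun x => f x *m g x).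
Proof.
move=> sf sg; apply/smooth_in_mxP => // a b.
apply: (@eq_smooth_in _ _ _ _ (fun x => \sum_j f x a j * g x j b)) => //.
  by move=> x _; rewrite mxE.
apply: smooth_in_sum => j; apply: smooth_inM.
  exact: (smooth_in_mxP _ oU).1.
exact: (smooth_in_mxP _ oU).1.
Qed.

Lemma smooth_in_trmx m l (f : 'rV[R]_n -> 'M[R]_(m, l)) :
  smooth_in U f -> smooth_in U (fun x => (f x)^T).
Proof.
move=> sf; apply/smooth_in_mxP => // a b.
apply: eq_smooth_in oU _ ((smooth_in_mxP _ oU).1 sf b a) => x _.
by rewrite mxE.
Qed.

Lemma smooth_in_jacobian m (f : 'rV[R]_n -> 'rV[R]_m) :
  smooth_in U f -> smooth_in U (fun x => 'J f x).
Proof.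
move=> sf; apply/smooth_in_mxP => // a b k.
apply: (eq_class_C (f := partial a (fun y => f y 0 b)) oU).
  by move=> x; rewrite inE => Ux; exact: (esym (jacobianE a b oU (sf 1) Ux)).
exact: class_C_partial ((class_C_mxP _ _ oU).1 (sf k.+1) 0 b).
Qed.

End SmoothMatrices.

Section BundleMetric.
Variables (R : realType) (n q p r : nat) (M B F : topologicalType)
  (G : topologicalGroupType) (AM : atlas R n M) (AB : atlas R q B)
  (AF : atlas R p F) (AG : atlas R r G) (act : G -> F -> F)
  (pi : M -> B) (E : bundle_atlas M B F G) (ghat : metric_field AF).
Hypotheses (mM : is_manifold AM) (mB : is_manifold AB) (mF : is_manifold AF)
  (hE : is_fibre_bundle AM AB AF AG act pi E) (hg : is_riemannian ghat).

Let cM := charted_manifold mM.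
Let cB := charted_manifold mB.
Let cF := charted_manifold mF.

Implicit Types (j : triv_ix E) (b : chart_ix AB) (d : chart_ix AF).

Definition base_coord m b (k : 'rV[R]_m -> M) : 'rV[R]_m -> 'rV[R]_q :=
  chart_map AB b \o (pi \o k).

Definition fib j (x : M) : F := (triv E j x).2.

Definition fibre_coord m j d (k : 'rV[R]_m -> M) : 'rV[R]_m -> 'rV[R]_p :=
  chart_map AF d \o (fib j \o k).

Lemma pi_cont : continuous pi.
Proof. by have [c _] := proj_smooth hE; move=> x; apply: c; rewrite inE. Qed.

Lemma open_over (O : set B) : open O -> open (pi @^-1` O).
Proof. by move=> oO; apply: open_comp => // x _; exact: pi_cont. Qed.

Definition fibre_dom m j d (k : 'rV[R]_m -> M) (W : set 'rV[R]_m) :=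
  (W `&` k @^-1` (pi @^-1` triv_dom E j)) `&` (fib j \o k) @^-1` chart_dom AF d.

Section OnePlot.
Variables (m : nat) (W : set 'rV[R]_m) (k : 'rV[R]_m -> M).
Hypothesis pk : is_plot AM W k.

Lemma plot_base : is_plot AB W (pi \o k).
Proof.
rewrite -[W]setIT -[setT](preimage_setT k).
exact: (plot_comp cM cB openT (proj_smooth hE) pk).
Qed.

Lemma plot_fib j :
  is_plot AF (W `&` k @^-1` (pi @^-1` triv_dom E j)) (fib j \o k).
Proof.
apply: (plot_snd (k := triv E j \o k) cB cF).
apply: (plot_comp cM (charted_prod cB cF) _ (triv_smooth hE j) pk).
exact/open_over/(triv_open hE).
Qed.

Lemma base_coord_smooth b :
  smooth_in (W `&` (pi \o k) @^-1` chart_dom AB b) (base_coord b k).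
Proof. exact: plot_smooth plot_base b. Qed.

Lemma base_dom_open b : open (W `&` (pi \o k) @^-1` chart_dom AB b).
Proof. exact: plot_chart_open cB plot_base. Qed.

Lemma fibre_coord_smooth j d : smooth_in (fibre_dom j d k W) (fibre_coord j d k).
Proof. exact: plot_smooth (plot_fib j) d. Qed.

Lemma fibre_dom_open j d : open (fibre_dom j d k W).
Proof. exact: plot_chart_open cF (plot_fib j). Qed.

Definition vertical_term j d z :=
  'J (fibre_coord j d k) z *m ghat d (fibre_coord j d k z)
  *m ('J (fibre_coord j d k) z)^T.

Definition horizontal_term b z :=
  'J (base_coord b k) z *m ('J (base_coord b k) z)^T.

Lemma vertical_term_indep j d d' z :
  fibre_dom j d k W z -> fibre_dom j d' k W z ->
  vertical_term j d z = vertical_term j d' z.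
Proof.
move=> dz d'z; pose N := fibre_dom j d k W `&` fibre_dom j d' k W.
have oN : open N by apply: openI; exact: fibre_dom_open.
have Nz : N z by [].
have sN e : (e = d \/ e = d') -> smooth_in N (fibre_coord j e k).
  by case=> ->; apply: smooth_in_sub (fibre_coord_smooth j _) => y [].
pose f := coord_map idfun d d'.
have cz y : N y -> coord_dom setT idfun d d' (fibre_coord j d k y).
  move=> [[_ dy] [_ d'y]]; split=> //; first by exists (fib j (k y)).
  by rewrite /fibre_coord /= (ch_mapK cF) // inE.
have fE y : N y -> (f \o fibre_coord j d k) y = fibre_coord j d' k y.
  by move=> [[_ dy] _]; rewrite /f /coord_map /fibre_coord /= (ch_mapK cF) // inE.
have oD : open (coord_dom setT (idfun : F -> F) d d' : set 'rV[R]_p).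
  by apply: coord_dom_open => //; [exact: openT|move=> x _; exact: cvg_id].
have sf : smooth_in (coord_dom setT idfun d d') f by have [_] := mfd_compat mF.
have JE : 'J (fibre_coord j d' k) z = 'J (fibre_coord j d k) z *m 'J f (fibre_coord j d k z).
  rewrite -(jacobian_comp oN oD (sN _ (or_introl erefl)) sf Nz (cz _ Nz)).
  apply/esym/(eq_jacobian oN _ Nz fE).
  exact: smooth_in_comp oN oD (sN _ (or_introl erefl)) sf cz.
rewrite /vertical_term (metric_compat hg (cz _ Nz)) -/f JE -(fE z Nz) /=.
by rewrite trmx_mul !mulmxA.
Qed.

End OnePlot.

Lemma base_jacobian_comp m l (W : set 'rV[R]_m) (k : 'rV[R]_m -> M)
    (W' : set 'rV[R]_l) (phi : 'rV[R]_l -> 'rV[R]_m) b z :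
  is_plot AM W k -> open W' -> smooth_in W' phi -> (forall y, W' y -> W (phi y)) ->
  W' z -> chart_dom AB b (pi (k (phi z))) ->
  'J (base_coord b (k \o phi)) z = 'J phi z *m 'J (base_coord b k) (phi z).
Proof.
move=> pk oW' sphi WW' W'z bz.
exact: (jacobian_comp oW' (base_dom_open pk (b := b)) sphi (base_coord_smooth pk b) W'z (conj
  (WW' _ W'z) bz)).
Qed.

Lemma fibre_jacobian_comp m l (W : set 'rV[R]_m) (k : 'rV[R]_m -> M)
    (W' : set 'rV[R]_l) (phi : 'rV[R]_l -> 'rV[R]_m) j d z :
  is_plot AM W k -> open W' -> smooth_in W' phi -> (forall y, W' y -> W (phi y)) ->
  W' z -> fibre_dom j d k W (phi z) ->
  'J (fibre_coord j d (k \o phi)) z = 'J phi z *m 'J (fibre_coord j d k) (phi z).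
Proof.
move=> pk oW' sphi WW' W'z dz.
exact: (jacobian_comp oW' (fibre_dom_open pk (j := j) (d := d)) sphi (fibre_coord_smooth pk j d)
  W'z dz).
Qed.

Variables (T : finType) (tau : T -> triv_ix E) (c : T -> chart_ix AB)
  (rho : T -> B -> R).
Hypothesis hrho : forall i, good_bump (triv_dom E (tau i)) (c i) (rho i).

Definition some_chart (f : F) : chart_ix AF := sval (cid (ch_cover cF f)).

Lemma some_chartP f : chart_dom AF (some_chart f) f.
Proof. exact: svalP (cid (ch_cover cF f)). Qed.

(* [hor + e ^+ 2 *: ver] is the sum of the pullbacks, by the local trivializations, of the
   products of a coordinate metric of the base and of [ghat], weighted by [rho]. The
   weights need not add up to 1: by invariance of [ghat], [ver] is on each fibre a
   multiple of [ghat]. The choice of [some_chart] is immaterial, by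
   [vertical_term_indep]. *)
Definition hor m (k : 'rV[R]_m -> M) z : 'M[R]_m :=
  \sum_i rho i (pi (k z)) *: horizontal_term k (c i) z.

Definition ver m (k : 'rV[R]_m -> M) z : 'M[R]_m :=
  \sum_i rho i (pi (k z)) *:
    vertical_term k (tau i) (some_chart (fib (tau i) (k z))) z.

Lemma rho_supp i x : rho i x != 0 ->
  triv_dom E (tau i) x /\ chart_dom AB (c i) x.
Proof. by have [K [_ KD rK]] := gb_supp (hrho i); move=> /rK /KD. Qed.

Lemma fibre_dom_some m (W : set 'rV[R]_m) (k : 'rV[R]_m -> M) j z : W z ->
  triv_dom E j (pi (k z)) -> fibre_dom j (some_chart (fib j (k z))) k W z.
Proof. by move=> Wz jz; split=> //; exact: some_chartP. Qed.

Section Naturality.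
Variables (m l : nat) (W : set 'rV[R]_m) (k : 'rV[R]_m -> M)
    (W' : set 'rV[R]_l) (phi : 'rV[R]_l -> 'rV[R]_m).
Hypotheses (pk : is_plot AM W k) (oW' : open W') (sphi : smooth_in W' phi)
  (WW' : forall y, W' y -> W (phi y)).

(** Naturality in the plot yields both the compatibility between charts of [M] and the passage to
    trivialization coordinates. Where a weight vanishes its term may be meaningless, hence the case
    distinction. *)
Lemma hor_comp z : W' z ->
  hor (k \o phi) z = 'J phi z *m hor k (phi z) *m ('J phi z)^T.
Proof.
move=> W'z; rewrite /hor mulmx_sumr mulmx_suml; apply: eq_bigr => i _ /=.
rewrite -scalemxAr -scalemxAl.
have [->|r0] := eqVneq (rho i (pi (k (phi z)))) 0; first by rewrite !scale0r.
have [_ cz] := rho_supp r0; congr (_ *: _); rewrite /horizontal_term.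
by rewrite (base_jacobian_comp pk oW' sphi WW' W'z cz) trmx_mul !mulmxA.
Qed.

Lemma ver_comp z : W' z ->
  ver (k \o phi) z = 'J phi z *m ver k (phi z) *m ('J phi z)^T.
Proof.
move=> W'z; rewrite /ver mulmx_sumr mulmx_suml; apply: eq_bigr => i _ /=.
rewrite -scalemxAr -scalemxAl.
have [->|r0] := eqVneq (rho i (pi (k (phi z)))) 0; first by rewrite !scale0r.
have [tz _] := rho_supp r0; congr (_ *: _); rewrite /vertical_term.
have dz := fibre_dom_some (WW' W'z) tz.
by rewrite (fibre_jacobian_comp pk oW' sphi WW' W'z dz) trmx_mul !mulmxA.
Qed.

End Naturality.

(** Plots are total functions with arbitrary values outside [W], so two expressions of the same
    parametrization agree on [W] only; the Jacobian at a point of the open set [W] sees no more. *)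
Lemma eq_hor m (W : set 'rV[R]_m) (k k' : 'rV[R]_m -> M) z :
  is_plot AM W k -> W z -> (forall y, W y -> k y = k' y) -> hor k z = hor k' z.
Proof.
move=> pk Wz kk'; apply: eq_bigr => i _.
transitivity (rho i (pi (k z)) *: horizontal_term k' (c i) z); last first.
  congr (rho i (pi _) *: _); exact: kk'.
have [r0|r0] := eqVneq (rho i (pi (k z))) 0.
  rewrite r0; exact: (etrans (scale0r _) (esym (scale0r _))).
have [_ cz] := rho_supp r0; rewrite /horizontal_term.
suff -> : 'J (base_coord (c i) k) z = 'J (base_coord (c i) k') z by [].
apply: (eq_jacobian (base_dom_open pk (b := c i)) (base_coord_smooth pk (c i)) (conj Wz cz)).
by move=> y [Wy _]; congr (chart_map AB _ (pi _)); exact: kk'.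
Qed.

Lemma eq_ver m (W : set 'rV[R]_m) (k k' : 'rV[R]_m -> M) z :
  is_plot AM W k -> W z -> (forall y, W y -> k y = k' y) -> ver k z = ver k' z.
Proof.
move=> pk Wz kk'; apply: eq_bigr => i _.
transitivity (rho i (pi (k z)) *:
    vertical_term k' (tau i) (some_chart (fib (tau i) (k z))) z); last first.
  congr (rho i (pi _) *: vertical_term _ _ (some_chart (fib _ _)) _); exact: kk'.
have [r0|r0] := eqVneq (rho i (pi (k z))) 0.
  rewrite r0; exact: (etrans (scale0r _) (esym (scale0r _))).
have [tz _] := rho_supp r0; have dz := fibre_dom_some Wz tz.
set d := some_chart _ in dz *; rewrite /vertical_term.
have fz : fibre_coord (tau i) d k z = fibre_coord (tau i) d k' z.
  by congr (chart_map AF d (fib _ _)); exact: kk'.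
suff -> : 'J (fibre_coord (tau i) d k) z = 'J (fibre_coord (tau i) d k') z by rewrite fz.
apply: (eq_jacobian (fibre_dom_open pk (d := d)) (fibre_coord_smooth pk (tau i) d) dz).
by move=> y [[Wy _] _]; congr (chart_map AF d (fib _ _)); exact: kk'.
Qed.

Section Smoothness.
Variables (m : nat) (W : set 'rV[R]_m) (k : 'rV[R]_m -> M).
Hypothesis pk : is_plot AM W k.

Let base_dom i : set 'rV[R]_m :=
  (W `&` k @^-1` (pi @^-1` triv_dom E (tau i))) `&` (pi \o k) @^-1` chart_dom AB (c i).

(** [W] is covered by two open sets: one on which [f] is smooth, and the preimage of the complement
    of the support [K], on which the product is 0. *)
Lemma smooth_in_cutoff i (f : 'rV[R]_m -> R) :
  smooth_in (base_dom i) f -> smooth_in W (fun z => rho i (pi (k z)) * f z).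
Proof.
move=> sf; have [K [clK KD rK]] := gb_supp (hrho i); have oW := plot_open pk.
have pb := plot_base pk.
apply: smooth_in_near => z Wz; have [Kz|nKz] := pselect (K (pi (k z))).
  exists (base_dom i); have oD : open (base_dom i).
    have -> : base_dom i = W `&` (pi \o k) @^-1` (triv_dom E (tau i) `&` chart_dom AB (c i)).
      by apply/seteqP; split=> y; [move=> [[? ?] ?]; split|move=> [? [? ?]]; split; [split|]].
    apply: open_preimage => //; first exact: plot_cont pb.
    by apply: openI; [exact: triv_open hE _|exact: ch_dom_open].
  have [tz cz] := KD _ Kz; split=> //.
  apply: (smooth_inM oD) => //.
  by apply: smooth_in_sub (gb_smooth (hrho i) pb) => y [[Wy _] _].
exists (W `&` (pi \o k) @^-1` (~` K)).
have oN : open (W `&` (pi \o k) @^-1` (~` K)).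
  by apply: open_preimage => //; [exact: plot_cont pb|exact: closed_openC].
split=> //; apply: (@eq_smooth_in _ _ _ _ (cst (0 : R))) => //.
  move=> y [_ nK] /=; have [->|/rK //] := eqVneq (rho i (pi (k y))) 0.
  by rewrite mul0r.
by move=> s; exact: class_C_cst.
Qed.

Lemma hor_smooth : smooth_in W (hor k).
Proof.
have oW := plot_open pk; apply/smooth_in_mxP => // a b.
apply: (@eq_smooth_in _ _ _ _ (fun z => \sum_i rho i (pi (k z)) * horizontal_term k (c i) z a
  b)) => //.
  by move=> z _; rewrite /hor summxE; apply: eq_bigr => i _; rewrite [RHS]mxE.
apply: smooth_in_sum => // i; apply: smooth_in_cutoff.
apply: (@smooth_in_sub _ _ _ (W `&` (pi \o k) @^-1` chart_dom AB (c i))).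
  by move=> y [[]].
have oD := base_dom_open pk (b := c i).
have sJ := smooth_in_jacobian oD (base_coord_smooth pk (c i)).
exact: ((smooth_in_mxP _ oD).1 (smooth_in_mulmx oD sJ (smooth_in_trmx oD sJ)) a b).
Qed.

Lemma ver_smooth : smooth_in W (ver k).
Proof.
have oW := plot_open pk; apply/smooth_in_mxP => // a b.
apply: (@eq_smooth_in _ _ _ _ (fun z => \sum_i rho i (pi (k z)) *
   vertical_term k (tau i) (some_chart (fib (tau i) (k z))) z a b)) => //.
  by move=> z _; rewrite /ver summxE; apply: eq_bigr => i _; rewrite [RHS]mxE.
apply: smooth_in_sum => // i; apply: smooth_in_cutoff.
apply: smooth_in_near => z [[Wz tz] _].
(* [some_chart] may jump from point to point. The chart chosen at [z] is frozen on a neighbourhood,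
   where [vertical_term_indep] shows that the value is unchanged. *)
have dz := fibre_dom_some Wz tz; set d := some_chart _ in dz.
have oD := fibre_dom_open pk (j := tau i) (d := d).
exists (fibre_dom (tau i) d k W); split; [exact: oD|exact: dz|].
apply: (eq_smooth_in (f := fun z => vertical_term k (tau i) d z a b) oD) => [y dy|].
  have Wy : W y by case: dy => -[].
  have ty : triv_dom E (tau i) (pi (k y)) by case: dy => -[].
  by have -> := vertical_term_indep pk dy (fibre_dom_some Wy ty).
have sJ := smooth_in_jacobian oD (fibre_coord_smooth pk (tau i) d).
have sG : smooth_in (fibre_dom (tau i) d k W) (ghat d \o fibre_coord (tau i) d k).
  have oI : open (chart_img d) by exact: ch_img_open.
  apply: (smooth_in_comp oD oI (fibre_coord_smooth pk (tau i) d) (metric_smooth hg d)).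
  by move=> y [_ dy]; exists (fib (tau i) (k y)).
have sV := smooth_in_mulmx oD (smooth_in_mulmx oD sJ sG) (smooth_in_trmx oD sJ).
exact: ((smooth_in_mxP _ oD).1 sV a b).
Qed.

Lemma hor_sym z : (hor k z)^T = hor k z.
Proof.
rewrite /hor linear_sum; apply: eq_bigr => i _ /=; rewrite linearZ /=.
by rewrite trmx_mul trmxK.
Qed.

Lemma ver_sym z : W z -> (ver k z)^T = ver k z.
Proof.
move=> Wz; rewrite /ver linear_sum; apply: eq_bigr => i _ /=; rewrite linearZ /=.
have [->|r0] := eqVneq (rho i (pi (k z))) 0; first by rewrite !scale0r.
have [tz _] := rho_supp r0; have [_ dz] := fibre_dom_some Wz tz.
set d := some_chart _ in dz *.
have gs : (ghat d (fibre_coord (tau i) d k z))^T = ghat d (fibre_coord (tau i) d k z).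
  by apply: (Defs.metric_sym hg); exists (fib (tau i) (k z)).
by rewrite /vertical_term !trmx_mul trmxK gs mulmxA.
Qed.

End Smoothness.

End BundleMetric.

(** * Coordinates adapted to a local trivialization *)

Section TrivCoordinates.
Variables (R : realType) (n q p r : nat) (M B F : topologicalType)
  (G : topologicalGroupType) (AM : atlas R n M) (AB : atlas R q B)
  (AF : atlas R p F) (AG : atlas R r G) (act : G -> F -> F)
  (pi : M -> B) (E : bundle_atlas M B F G).
Hypotheses (mM : is_manifold AM) (mB : is_manifold AB) (mF : is_manifold AF)
  (hE : is_fibre_bundle AM AB AF AG act pi E).

Let cM := charted_manifold mM.
Let cB := charted_manifold mB.
Let cF := charted_manifold mF.

Lemma smooth_lsubmx U : open U -> smooth_in U (@lsubmx R 1 q p).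
Proof.
move=> oU; apply/smooth_in_mxP => // a b.
apply: (@eq_smooth_in _ _ _ _ (fun z : 'rV[R]_(q + p) => z 0 (lshift p b))) => //.
  by move=> z _; rewrite mxE (ord1 a).
by move=> k; exact: class_C_coord.
Qed.

Lemma smooth_rsubmx U : open U -> smooth_in U (@rsubmx R 1 q p).
Proof.
move=> oU; apply/smooth_in_mxP => // a b.
apply: (@eq_smooth_in _ _ _ _ (fun z : 'rV[R]_(q + p) => z 0 (rshift q b))) => //.
  by move=> z _; rewrite mxE (ord1 a).
by move=> k; exact: class_C_coord.
Qed.

Variables (j : triv_ix E) (b : chart_ix AB) (d : chart_ix AF).

Definition triv_param (z : 'rV[R]_(q + p)) : M :=
  triv_inv E j (chart_inv AB b (lsubmx z), chart_inv AF d (rsubmx z)).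

Definition triv_param_base : set 'rV[R]_q :=
  chart_img b `&` chart_inv AB b @^-1` triv_dom E j.

Definition triv_param_dom : set 'rV[R]_(q + p) :=
  [set z | triv_param_base (lsubmx z) /\ chart_img d (rsubmx z)].

Lemma triv_param_base_open : open triv_param_base.
Proof.
apply: open_preimage; [exact: ch_img_open|exact: ch_inv_cont|].
exact: triv_open hE j.
Qed.

Lemma triv_param_dom_open : open triv_param_dom.
Proof.
apply: openI.
  apply: open_comp => [z _|]; last exact: triv_param_base_open.
  exact/differentiable_continuous/differentiable_lsubmx.
apply: open_comp => [z _|]; last exact: ch_img_open.
exact/differentiable_continuous/differentiable_rsubmx.
Qed.

Lemma triv_param_plot : is_plot AM triv_param_dom triv_param.
Proof.
have oW := triv_param_dom_open.
have pB : is_plot AB triv_param_dom (chart_inv AB b \o lsubmx).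
  apply: (plot_reparam cB (plot_chart b mB) oW (smooth_lsubmx oW)).
  by move=> z [[]].
have pF : is_plot AF triv_param_dom (chart_inv AF d \o rsubmx).
  apply: (plot_reparam cF (plot_chart d mF) oW (smooth_rsubmx oW)).
  by move=> z [].
have oU : open (triv_dom E j `*` [set: F]).
  rewrite openE => -[x y] [/= jx _].
  exists (triv_dom E j, setT) => //=; split; last exact: filterT.
  by apply: open_nbhs_nbhs; split=> //; exact: triv_open hE j.
have pm := plot_comp (charted_prod cB cF) cM oU (triv_inv_smooth hE j)
  (plot_pair cB cF pB pF).
apply: plot_sub oW _ pm => z Wz; split=> //.
by have [[_ jz] _] := Wz.
Qed.

Lemma pi_triv_param z : triv_param_dom z -> pi (triv_param z) = chart_inv AB b (lsubmx z).
Proof. by move=> [[_ jz] _]; rewrite (proj_triv_inv hE). Qed.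

Lemma triv_param_dom_triv z : triv_param_dom z -> triv_dom E j (pi (triv_param z)).
Proof. by move=> Wz; rewrite pi_triv_param //; have [[]] := Wz. Qed.

Lemma fib_triv_param i z : triv_param_dom z -> triv_dom E i (pi (triv_param z)) ->
  fib i (triv_param z) =
  act (trans E i j (chart_inv AB b (lsubmx z))) (chart_inv AF d (rsubmx z)).
Proof.
move=> Wz; rewrite pi_triv_param // => iz; have [[_ jz] _] := Wz.
by rewrite /fib (transE hE).
Qed.

Lemma fib_triv_param_self z : triv_param_dom z ->
  fib j (triv_param z) = chart_inv AF d (rsubmx z).
Proof. by move=> [[_ jz] _]; rewrite /fib (trivK hE). Qed.

Variable a : chart_ix AM.

Definition triv_coord (y : 'rV[R]_n) : 'rV[R]_(q + p) :=
  row_mx (base_coord pi b (chart_inv AM a) y) (fibre_coord j d (chart_inv AM a) y).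

Definition triv_coord_dom : set 'rV[R]_n :=
  fibre_dom pi j d (chart_inv AM a) (chart_img a) `&`
  (chart_img a `&` (pi \o chart_inv AM a) @^-1` chart_dom AB b).

Definition chart_param : 'rV[R]_(q + p) -> 'rV[R]_n := chart_map AM a \o triv_param.

Definition chart_param_dom : set 'rV[R]_(q + p) :=
  triv_param_dom `&` triv_param @^-1` chart_dom AM a.

Let pa := plot_chart a mM.

Lemma triv_coord_dom_open : open triv_coord_dom.
Proof.
apply: openI; first exact: (fibre_dom_open mM mB mF hE pa).
exact: (base_dom_open mM mB hE pa).
Qed.

Lemma triv_coord_smooth : smooth_in triv_coord_dom triv_coord.
Proof.
apply: smooth_in_row_mx; first exact: triv_coord_dom_open.
  by apply: smooth_in_sub (base_coord_smooth mM mB hE pa b) => y [].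
by apply: smooth_in_sub (fibre_coord_smooth mM mB mF hE pa j d) => y [].
Qed.

Lemma chart_param_dom_open : open chart_param_dom.
Proof. exact: plot_chart_open cM triv_param_plot. Qed.

Lemma chart_param_smooth : smooth_in chart_param_dom chart_param.
Proof. exact: plot_smooth triv_param_plot a. Qed.

Lemma triv_coord_in y : triv_coord_dom y -> triv_param_dom (triv_coord y).
Proof.
move=> [[[ya jy] dy] [_ by_]]; rewrite /triv_coord /triv_param_dom /=.
rewrite row_mxKl row_mxKr; split; first split.
- by exists (pi (chart_inv AM a y)).
- by rewrite /base_coord /= (ch_mapK cB) // inE.
- by exists (fib j (chart_inv AM a y)).
Qed.

Lemma triv_coordK y : triv_coord_dom y -> triv_param (triv_coord y) = chart_inv AM a y.
Proof.
move=> [[[ya jy] dy] [_ by_]].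
rewrite /triv_param /triv_coord row_mxKl row_mxKr /base_coord /fibre_coord /=.
rewrite (ch_mapK cB) ?inE // (ch_mapK cF) ?inE //.
by rewrite /fib -(triv_proj hE jy) -surjective_pairing (triv_invK hE).
Qed.

Lemma triv_coord_chart y : triv_coord_dom y -> chart_param_dom (triv_coord y).
Proof.
move=> yD; split; first exact: triv_coord_in.
rewrite /= triv_coordK //; case: yD => [[[ya _] _] _].
by have [] := chart_imgP cM ya.
Qed.

Lemma chart_param_in z : chart_param_dom z -> triv_coord_dom (chart_param z).
Proof.
move=> [Wz az]; have jz := triv_param_dom_triv Wz; have [[bz _] dz] := Wz.
have E1 : chart_inv AM a (chart_param z) = triv_param z.
  by rewrite /chart_param /= (ch_mapK cM) // inE.
have iz : chart_img a (chart_param z) by exists (triv_param z).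
split; split=> //=.
- by split=> //=; rewrite E1.
- by rewrite E1 fib_triv_param_self //; have [] := chart_imgP cF dz.
- by rewrite E1 pi_triv_param //; have [] := chart_imgP cB bz.
Qed.

Lemma chart_paramK z : chart_param_dom z -> triv_coord (chart_param z) = z.
Proof.
move=> [Wz az]; have [[bz _] dz] := Wz.
have E1 : chart_inv AM a (chart_param z) = triv_param z.
  by rewrite /chart_param /= (ch_mapK cM) // inE.
rewrite /triv_coord /base_coord /fibre_coord /= E1 pi_triv_param //.
rewrite fib_triv_param_self //.
have [_ ->] := chart_imgP cB bz; have [_ ->] := chart_imgP cF dz.
exact: hsubmxK.
Qed.

Lemma triv_coordKV y : triv_coord_dom y -> chart_param (triv_coord y) = y.
Proof.
move=> yD; rewrite /chart_param /= triv_coordK //.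
by case: yD => [[[ya _] _] _]; have [] := chart_imgP cM ya.
Qed.

(** Here [n] and [q + p] are not yet known to agree, so the Jacobians are rectangular and the two
    products are computed separately. Together they force the dimensions to be equal. *)
Lemma jacobian_triv_coord y : triv_coord_dom y ->
  'J triv_coord y *m 'J chart_param (triv_coord y) = 1%:M.
Proof.
move=> yD; have oN := triv_coord_dom_open; have oN' := chart_param_dom_open.
rewrite -(jacobian_comp oN oN' triv_coord_smooth chart_param_smooth yD (triv_coord_chart yD)).
rewrite -(jacobian_id y); apply: (eq_jacobian oN _ yD triv_coordKV).
exact: (smooth_in_comp oN oN' triv_coord_smooth chart_param_smooth triv_coord_chart).
Qed.

Lemma jacobian_chart_param z : chart_param_dom z ->
  'J chart_param z *m 'J triv_coord (chart_param z) = 1%:M.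
Proof.
move=> zD; have oN := triv_coord_dom_open; have oN' := chart_param_dom_open.
rewrite -(jacobian_comp oN' oN chart_param_smooth triv_coord_smooth zD (chart_param_in zD)).
rewrite -(jacobian_id z); apply: (eq_jacobian oN' _ zD chart_paramK).
exact: (smooth_in_comp oN' oN chart_param_smooth triv_coord_smooth chart_param_in).
Qed.

End TrivCoordinates.

Section Dimension.
Variables (R : realType) (n q p r : nat) (M B F : topologicalType)
  (G : topologicalGroupType) (AM : atlas R n M) (AB : atlas R q B)
  (AF : atlas R p F) (AG : atlas R r G) (act : G -> F -> F)
  (pi : M -> B) (E : bundle_atlas M B F G).
Hypotheses (mM : is_manifold AM) (mB : is_manifold AB) (mF : is_manifold AF)
  (hE : is_fibre_bundle AM AB AF AG act pi E).

Lemma triv_coord_at (x : M) j b d a : triv_dom E j (pi x) -> chart_dom AB b (pi x) ->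
  chart_dom AF d (fib j x) -> chart_dom AM a x ->
  triv_coord_dom pi j b d a (chart_map AM a x).
Proof.
move=> jx bx dx ax; have cM := charted_manifold mM.
have E1 : chart_inv AM a (chart_map AM a x) = x by rewrite (ch_mapK cM) // inE.
have ix : chart_img a (chart_map AM a x) by exists x.
by split; split=> //=; rewrite ?E1 //; split=> //=; rewrite E1.
Qed.

(* The dimension of the total space is not part of [is_fibre_bundle]. *)
Lemma bundle_dimension : [set: M] !=set0 -> n = (q + p)%N.
Proof.
move=> [x _]; have [j jx] := triv_cover hE (pi x).
have [b bx] := ch_cover (charted_manifold mB) (pi x).
have [d dx] := ch_cover (charted_manifold mF) (fib j x).
have [a ax] := ch_cover (charted_manifold mM) x.
have yD := triv_coord_at jx bx dx ax.
have J1 := jacobian_triv_coord mM mB mF hE yD.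
have J2 := jacobian_chart_param mM mB mF hE (triv_coord_chart mM mB mF hE yD).
by apply/eqP; rewrite eqn_leq (mulmx1_min J1) (mulmx1_min J2).
Qed.

End Dimension.

(** * Invariance of positivity under coordinate changes *)

Section PullbackPositivity.
Variables (R : realType) (n : nat).
Local Notation V := ('rV[R]_n).
Variables (phi : V -> V) (h h' : V -> 'M[R]_n) (U U' : set V) (t : R).
Hypotheses (oU : open U) (oU' : open U').
Hypotheses (Cphi : class_C 3 U phi) (Ch : class_C 2 U' h).
Hypotheses (UU' : forall y, U y -> U' (phi y)).
Hypotheses (uJ : forall y, U y -> 'J phi y \in unitmx).
Hypotheses (sym_h : forall x, U' x -> (h x)^T = h x).
Hypotheses (uh : forall x, U' x -> h x \in unitmx).
Hypotheses (h'E : forall y, U y -> h' y = 'J phi y *m h (phi y) *m ('J phi y)^T).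

Let curvE' y : U y -> (fun i j k l => curv h' i j k l y) =
  (fun i j k l => ctr4 (fun a b c d => curv h a b c d (phi y))
    ('J phi y i) ('J phi y j) ('J phi y k) ('J phi y l)).
Proof.
move=> Uy; do 4!(apply/funext => ?).
exact: (curv_pullback oU oU' Cphi Ch UU' uJ sym_h uh h'E).
Qed.

Lemma scal_pullback y : U y -> scal h' y = scal h (phi y).
Proof.
move=> Uy; rewrite !scalE curvE' // jscal_pull h'E // conj_invmx ?uJ //.
by apply: uh; exact: UU'.
Qed.

Lemma riem_form_pullback y : U y ->
  posdef_bivectors (riem_form t h (phi y)) -> posdef_bivectors (riem_form t h' y).
Proof.
move=> Uy; set K := fun i j k l => curv h i j k l (phi y).
have U'y := UU' Uy.
have aK : biv_antisym K.
  apply: (curv_antisym (g := invmx (h (phi y)))).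
    by rewrite trmx_inv sym_h.
  by move=> i j k l; exact: (curvE oU' Ch sym_h uh _ _ _ _ U'y).
have aK' : biv_antisym (fun i j k l => curv h' i j k l y).
  rewrite curvE' //; case: aK => K12 K34; split=> i j k l.
    rewrite ctr4C12 -mulN1r -ctr4Z; apply: eq_ctr4 => a b c d.
    by rewrite mulN1r -K12.
  rewrite ctr4C34 -mulN1r -ctr4Z; apply: eq_ctr4 => a b c d.
  by rewrite mulN1r -K34.
move=> /(posdef_bivectorsP (jform_antisym t (h (phi y)) aK)) pos.
apply/(posdef_bivectorsP (jform_antisym t (h' y) aK')) => w wa w0.
have uJy := uJ Uy; set J := 'J phi y in uJy *.
have -> : jform t (h' y) (fun i j k l => curv h' i j k l y) =
    (fun i j k l => ctr4 (jform t (h (phi y)) K) (J i) (J j) (J k) (J l)).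
  do 4!(apply/funext => ?); rewrite curvE' // h'E // jform_pull //.
  exact: uh.
rewrite biv_form_pull; apply: pos.
  by rewrite !trmx_mul trmxK wa mulNmx mulmxN mulmxA.
apply: contra w0 => /eqP W0.
have -> : w = invmx J^T *m (J^T *m w *m J) *m invmx J.
  by rewrite !mulmxA mulVmx ?unitmx_tr // mul1mx mulmxK.
by rewrite W0 mulmx0 mul0mx.
Qed.

End PullbackPositivity.

(** * Quadratic forms and explicit Jacobians *)

Section QuadraticForm.
Variables (R : realType) (n : nat).
Implicit Types (A : 'M[R]_n) (v : 'rV[R]_n).

Definition quad A v : R := (v *m A *m v^T) 0 0.

Lemma quadD A A' v : quad (A + A') v = quad A v + quad A' v.
Proof. by rewrite /quad mulmxDr mulmxDl mxE. Qed.

Lemma quadZ c A v : quad (c *: A) v = c * quad A v.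
Proof. by rewrite /quad -scalemxAr -scalemxAl mxE. Qed.

Lemma quad_sum (T : finType) (f : T -> 'M[R]_n) v :
  quad (\sum_i f i) v = \sum_i quad (f i) v.
Proof. by rewrite /quad mulmx_sumr mulmx_suml summxE. Qed.

Lemma quad_conj m (J : 'M[R]_(n, m)) (A : 'M[R]_m) v :
  quad (J *m A *m J^T) v = (v *m J *m A *m (v *m J)^T) 0 0.
Proof. by rewrite /quad trmx_mul !mulmxA. Qed.

Lemma quad_gram m (J : 'M[R]_(n, m)) v :
  quad (J *m J^T) v = \sum_k (v *m J) 0 k ^+ 2.
Proof.
rewrite /quad mulmxA -[_ *m J^T *m _]mulmxA -trmx_mul mxE; apply: eq_bigr => k _.
by rewrite [X in _ * X]mxE -expr2.
Qed.

Lemma quad_gram_ge0 m (J : 'M[R]_(n, m)) v : 0 <= quad (J *m J^T) v.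
Proof. by rewrite quad_gram; apply: sumr_ge0 => k _; exact: sqr_ge0. Qed.

Lemma quad_gram_gt0 m (J : 'M[R]_(n, m)) v : v *m J != 0 -> 0 < quad (J *m J^T) v.
Proof.
move=> vJ; rewrite lt_def quad_gram_ge0 andbT quad_gram; apply: contra vJ => /eqP E.
apply/eqP/rowP => k; rewrite [RHS]mxE; apply/eqP; rewrite -sqrf_eq0; apply/eqP.
by apply: (psumr_eq0P _ E) => // l _; exact: sqr_ge0.
Qed.

End QuadraticForm.

Section MoreJacobians.
Variable R : realType.

Lemma jacobian_row_mx n m l (U : set 'rV[R]_n) (f : 'rV[R]_n -> 'rV[R]_m)
    (g : 'rV[R]_n -> 'rV[R]_l) x : open U -> smooth_in U f -> smooth_in U g -> U x ->
  'J (fun y => row_mx (f y) (g y)) x = row_mx ('J f x) ('J g x).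
Proof.
move=> oU sf sg Ux; have sfg := smooth_in_row_mx oU sf sg.
apply/matrixP => i k; apply: (etrans (jacobianE i k oU (sfg 1) Ux)).
case: (split_ordP k) => k' ->; [rewrite row_mxEl|rewrite row_mxEr].
  apply: (etrans _ (esym (jacobianE i k' oU (sf 1) Ux))).
  by apply: eq_partial; apply: (near_in_open oU Ux) => y _; rewrite row_mxEl.
apply: (etrans _ (esym (jacobianE i k' oU (sg 1) Ux))).
by apply: eq_partial; apply: (near_in_open oU Ux) => y _; rewrite row_mxEr.
Qed.

Lemma jacobian_cst n m (a : 'rV[R]_m) (x : 'rV[R]_n) : 'J (cst a) x = 0.
Proof.
apply/row_matrixP => i; rewrite row0 rowE -deriveEjacobian; last exact: differentiable_cst.
exact: derive_cst.
Qed.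

Lemma jacobian_lsubmx q p (z : 'rV[R]_(q + p)) :
  'J (@lsubmx R 1 q p) z = col_mx 1%:M 0.
Proof.
have cl : continuous (@lsubmx R 1 q p).
  by move=> y; exact/differentiable_continuous/differentiable_lsubmx.
apply/row_matrixP => i; rewrite !rowE /jacobian mul_rV_lin1.
have -> : 'd (@lsubmx R 1 q p) z = @lsubmx R 1 q p :> (_ -> _) by rewrite diff_lin.
case: (split_ordP i) => i' ->.
  by apply/rowP => k; rewrite -rowE rowKu row1 !mxE eq_lshift.
by apply/rowP => k; rewrite -rowE rowKd row0 !mxE eq_lrshift andbF.
Qed.

Lemma smooth_row_mx_cst q p (l : 'rV[R]_q) (U : set 'rV[R]_p) : open U ->
  smooth_in U (fun x => row_mx l x).
Proof.
move=> oU; apply: (smooth_in_row_mx (f := cst l) (g := idfun)) => //.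
  by move=> k; exact: class_C_cst.
by move=> k; apply/(class_C_mxP _ _ oU) => a b; rewrite (ord1 a); exact: class_C_coord.
Qed.

Lemma jacobian_row_mx_cst q p (l : 'rV[R]_q) (x : 'rV[R]_p) :
  'J (fun x => row_mx l x) x = row_mx 0 1%:M.
Proof.
rewrite -(jacobian_cst l x) -(jacobian_id x).
apply: (jacobian_row_mx (U := setT) openT) => // k.
  exact: class_C_cst openT.
apply/(class_C_mxP _ _ openT) => a b; rewrite (ord1 a).
exact: (class_C_coord _ _ openT).
Qed.

(** The inverse is the Jacobian of the reverse transition. A right inverse suffices to see that no
    nonzero row vector is killed. *)
Lemma jacobian_transition m (T : topologicalType) (A : atlas R m T) (a b : chart_ix A) y :
  is_manifold A -> coord_dom setT idfun a b y ->
  exists Q, 'J (coord_map idfun a b) y *m Q = 1%:M.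
Proof.
move=> mA Dy; have cA := charted_manifold mA.
have oD (a' b' : chart_ix A) : open (coord_dom setT (idfun : T -> T) a' b' : set 'rV[R]_m).
  by apply: coord_dom_open => //; [exact: openT|move=> x _; exact: cvg_id].
have sD (a' b' : chart_ix A) : smooth_in (coord_dom setT idfun a' b') (coord_map idfun a' b').
  by have [_] := mfd_compat mA.
have DD z : coord_dom setT idfun a b z -> coord_dom setT idfun b a (coord_map idfun a b z).
  move=> [az _ bz]; split=> //; first by exists (chart_inv A a z).
  by rewrite /coord_map /= (ch_mapK cA) ?inE //; have [] := chart_imgP cA az.
have DK z : coord_dom setT idfun a b z ->
    (coord_map idfun b a \o coord_map idfun a b) z = idfun z.
  move=> [az _ bz]; rewrite /coord_map /= (ch_mapK cA) ?inE //.
  by have [] := chart_imgP cA az.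
exists ('J (coord_map idfun b a) (coord_map idfun a b y)).
rewrite -(jacobian_comp (oD _ _) (oD _ _) (sD _ _) (sD _ _) Dy (DD _ Dy)) -(jacobian_id y).
apply: (eq_jacobian (oD a b) _ Dy DK).
exact: (smooth_in_comp (oD _ _) (oD _ _) (sD _ _) (sD _ _) DD).
Qed.

End MoreJacobians.

(** * Positivity of the bundle metric *)

Lemma class_CZ (R : realType) n l k j (U : set 'rV[R]_n) (f : 'rV[R]_n -> 'M[R]_(l, k)) (e : R) :
  open U -> class_C j U f -> class_C j U (fun x => e *: f x).
Proof.
move=> oU Cf; apply/(class_C_mxP _ _ oU) => a b.
apply: (eq_class_C (f := cst e \* (fun x => f x a b)) oU).
  by move=> x _; rewrite /= [RHS]mxE.
apply: (class_CM oU); first exact: class_C_cst.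
exact: (class_C_mxP _ _ oU).1.
Qed.

Lemma quad_combination_gt0 (R : realType) n (T : finType) (w : T -> R) (f : T -> 'M[R]_n) v i :
  (forall k, 0 <= w k * quad (f k) v) -> 0 < w i * quad (f i) v ->
  0 < quad (\sum_k w k *: f k) v.
Proof.
move=> w_ge0 wi; rewrite quad_sum (bigD1 i) //= quadZ; apply: ltr_wpDr => //.
by apply: sumr_ge0 => k _; rewrite quadZ.
Qed.

Section BundleMetricPositivity.
Variables (R : realType) (n q p r : nat) (M B F : topologicalType)
  (G : topologicalGroupType) (AM : atlas R n M) (AB : atlas R q B)
  (AF : atlas R p F) (AG : atlas R r G) (act : G -> F -> F)
  (pi : M -> B) (E : bundle_atlas M B F G) (ghat : metric_field AF).
Hypotheses (mM : is_manifold AM) (mB : is_manifold AB) (mF : is_manifold AF)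
  (hE : is_fibre_bundle AM AB AF AG act pi E) (hg : is_riemannian ghat).
Variables (T : finType) (tau : T -> triv_ix E) (c : T -> chart_ix AB)
  (rho : T -> B -> R).
Hypothesis hrho : forall i, good_bump (triv_dom E (tau i)) (c i) (rho i).
Hypothesis rho_cover : forall b, exists i, 0 < rho i b.

Let cM := charted_manifold mM.
Let cB := charted_manifold mB.
Let cF := charted_manifold mF.

Definition bundle_metric (e : R) : metric_field AM := fun a y =>
  hor pi c rho (chart_inv AM a) y + e ^+ 2 *: ver pi ghat mF tau rho (chart_inv AM a) y.

Lemma hor_term_ge0 m (k : 'rV[R]_m -> M) z v i :
  0 <= rho i (pi (k z)) * quad (horizontal_term pi k (c i) z) v.
Proof. by apply: mulr_ge0; [exact: gb_ge0 (hrho i) _|exact: quad_gram_ge0]. Qed.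

Lemma hor_ge0 m (k : 'rV[R]_m -> M) z v : 0 <= quad (hor pi c rho k z) v.
Proof.
rewrite quad_sum; apply: sumr_ge0 => i _; rewrite quadZ; exact: hor_term_ge0.
Qed.

Implicit Types (j : triv_ix E) (b : chart_ix AB) (d : chart_ix AF).

Lemma metric_quad_ge0 (d : chart_ix AF) y (v : 'rV[R]_p) : chart_img d y -> 0 <= (v *m ghat d y
  *m v^T) 0 0.
Proof.
move=> dy; have [->|v0] := eqVneq v 0; first by rewrite !mul0mx mxE.
exact/ltW/(metric_posdef hg dy).
Qed.

Lemma ver_term_ge0 m (W : set 'rV[R]_m) (k : 'rV[R]_m -> M) z v i : W z ->
  0 <= rho i (pi (k z)) *
    quad (vertical_term ghat k (tau i) (some_chart mF (fib (tau i) (k z))) z) v.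
Proof.
move=> Wz; have [->|r0] := eqVneq (rho i (pi (k z))) 0; first by rewrite mul0r.
have [tz _] := rho_supp hrho r0.
apply: mulr_ge0; first exact: gb_ge0 (hrho i) _.
rewrite quad_conj; apply: metric_quad_ge0; have dz := some_chartP mF (fib (tau i) (k z)).
by exists (fib (tau i) (k z)).
Qed.

Lemma ver_ge0 m (W : set 'rV[R]_m) (k : 'rV[R]_m -> M) z v : W z ->
  0 <= quad (ver pi ghat mF tau rho k z) v.
Proof.
move=> Wz; rewrite quad_sum; apply: sumr_ge0 => i _; rewrite quadZ.
exact: ver_term_ge0 Wz.
Qed.

(** One index [i] with positive weight is enough: a vector killed by both the base and the fibre
    coordinates of that trivialization is 0, since together they form a coordinate system. *)
Lemma bundle_metric_posdef (e : R) a y : 0 < e -> chart_img a y -> pdmx (bundle_metric e a y).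
Proof.
move=> e0 ya v v0; rewrite -/(quad _ v) quadD quadZ.
have [i ri] := rho_cover (pi (chart_inv AM a y)).
have [tz cz] := rho_supp hrho (lt0r_neq0 ri).
have dz : fibre_dom pi (tau i) (some_chart mF (fib (tau i) (chart_inv AM a y)))
    (chart_inv AM a) (chart_img a) y by exact: fibre_dom_some.
set d := some_chart _ _ in dz.
have yD : triv_coord_dom pi (tau i) (c i) d a y by split.
have J1 := jacobian_triv_coord mM mB mF hE yD.
have pa := plot_chart a mM.
have vJ : v *m 'J (triv_coord pi (tau i) (c i) d a) y != 0.
  apply: contra v0 => /eqP vJ0.
  by rewrite -[v]mulmx1 -J1 mulmxA vJ0 mul0mx.
have JE : 'J (triv_coord pi (tau i) (c i) d a) y =
    row_mx ('J (base_coord pi (c i) (chart_inv AM a)) y)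
           ('J (fibre_coord (tau i) d (chart_inv AM a)) y).
  apply: (jacobian_row_mx (triv_coord_dom_open mM mB mF hE (j := tau i) (b := c i) (d := d) (a
    := a)) _ _ yD).
    by apply: smooth_in_sub (base_coord_smooth mM mB hE pa (c i)) => x [].
  by apply: smooth_in_sub (fibre_coord_smooth mM mB mF hE pa (tau i) d) => x [].
have e2 : 0 < e ^+ 2 by rewrite exprn_gt0.
rewrite JE mul_mx_row in vJ.
(* A vector with nonzero base part is detected by the horizontal term [i]; otherwise its fibre part
   is nonzero and the vertical term [i] detects it. All other terms are nonnegative. *)
have [vb|vb] := eqVneq (v *m 'J (base_coord pi (c i) (chart_inv AM a)) y) 0; last first.
  apply: ltr_wpDr; first by apply: mulr_ge0; [exact: ltW|exact: (ver_ge0 _ _ ya)].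
  apply: (quad_combination_gt0 (i := i)) => [k|]; first exact: hor_term_ge0.
  by apply: mulr_gt0 => //; exact: quad_gram_gt0.
have vf : v *m 'J (fibre_coord (tau i) d (chart_inv AM a)) y != 0.
  by apply: contra vJ => /eqP ->; rewrite vb row_mx0.
apply: ltr_wpDl; first exact: hor_ge0.
apply: mulr_gt0 => //; apply: (quad_combination_gt0 (i := i)) => [k|].
  exact: ver_term_ge0 ya.
apply: mulr_gt0 => //; rewrite quad_conj; apply: (metric_posdef hg) => //.
by have [_ dy] := dz; exists (fib (tau i) (chart_inv AM a y)).
Qed.

Lemma bundle_metric_riemannian (e : R) : 0 < e -> is_riemannian (bundle_metric e).
Proof.
move=> e0; split.
- move=> a k; have oW : open (chart_img a) by exact: mfd_img_open.
  have pa := plot_chart a mM.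
  apply: (class_CD oW); first exact: (hor_smooth mM mB hE hrho pa).
  exact: (class_CZ (e ^+ 2) oW (ver_smooth mM mB mF hE hg hrho pa k)).
- move=> a y ya; rewrite /bundle_metric linearD linearZ /=.
  by rewrite hor_sym (ver_sym pi mF hg hrho _ ya).
- by move=> a y ya v v0; exact: bundle_metric_posdef.
move=> a b y Dy /=; rewrite /bundle_metric.
have pa := plot_chart a mM; have pb := plot_chart b mM.
pose D := coord_dom setT (idfun : M -> M) a b : set 'rV[R]_n.
have oD : open D by apply: coord_dom_open => //; [exact: openT|move=> x _; exact: cvg_id].
have sD : smooth_in D (coord_map idfun a b) by have [_ sc] := mfd_compat mM; exact: sc.
have Db z : D z -> chart_img b (coord_map idfun a b z).
  by move=> [az _ bz]; exists (chart_inv AM a z).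
have pD : is_plot AM D (chart_inv AM a) by apply: plot_sub oD _ pa => z [].
have kE z : D z -> chart_inv AM a z = (chart_inv AM b \o coord_map idfun a b) z.
  by move=> [_ _ bz]; rewrite /coord_map /= (ch_mapK cM) // inE.
rewrite mulmxDr mulmxDl -scalemxAr -scalemxAl.
rewrite (eq_hor mM mB hE hrho pD Dy kE) (eq_ver ghat mM mB mF hE hrho pD Dy kE).
by rewrite (hor_comp mM mB hE hrho pb oD sD Db Dy) (ver_comp ghat mM mB mF hE hrho pb oD sD Db Dy).
Qed.

End BundleMetricPositivity.

(** * The bundle metric in a local trivialization *)

Section LocalStructure.
Variables (R : realType) (q p r : nat) (M B F : topologicalType)
  (G : topologicalGroupType) (AM : atlas R (q + p) M) (AB : atlas R q B)
  (AF : atlas R p F) (AG : atlas R r G) (act : G -> F -> F)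
  (pi : M -> B) (E : bundle_atlas M B F G) (ghat : metric_field AF).
Hypotheses (mM : is_manifold AM) (mB : is_manifold AB) (mF : is_manifold AF)
  (hE : is_fibre_bundle AM AB AF AG act pi E) (hg : is_riemannian ghat)
  (hinv : forall a : G, preserves_metric ghat (act a)).
Variables (T : finType) (tau : T -> triv_ix E) (c : T -> chart_ix AB)
  (rho : T -> B -> R).
Hypothesis hrho : forall i, good_bump (triv_dom E (tau i)) (c i) (rho i).
Hypothesis rho_cover : forall b, exists i, 0 < rho i b.

Let cM := charted_manifold mM.
Let cB := charted_manifold mB.
Let cF := charted_manifold mF.

Variables (j : triv_ix E) (b : chart_ix AB) (d : chart_ix AF).
Let k : 'rV[R]_(q + p) -> M := triv_param j b d.
Let W := triv_param_dom j b d.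
Let pk : is_plot AM W k := triv_param_plot mM mB mF hE j b d.
Let P i y := 'J (coord_map (idfun : B -> B) b (c i)) y.

Definition base_block y : 'M[R]_q :=
  \sum_i rho i (chart_inv AB b y) *: (P i y *m (P i y)^T).

Definition base_weight y : R := \sum_i rho i (chart_inv AB b y).

Lemma base_weight_gt0 y : 0 < base_weight y.
Proof.
have [i ri] := rho_cover (chart_inv AB b y).
rewrite /base_weight (bigD1 i) //=; apply: ltr_wpDr => //.
by apply: sumr_ge0 => l _; exact: gb_ge0 (hrho l) _.
Qed.

Lemma base_block_posdef y : chart_img b y -> pdmx (base_block y).
Proof.
move=> yb v v0; have [i ri] := rho_cover (chart_inv AB b y).
have [_ ci] := rho_supp hrho (lt0r_neq0 ri).
apply: (quad_combination_gt0 (i := i)) => [l|].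
  by apply: mulr_ge0; [exact: gb_ge0 (hrho l) _|exact: quad_gram_ge0].
apply: mulr_gt0 => //; apply: quad_gram_gt0.
have Dy : coord_dom setT (idfun : B -> B) b (c i) y by split.
have [Q PQ] := jacobian_transition mB Dy.
by apply: contra v0 => /eqP vP; rewrite -[v]mulmx1 -PQ mulmxA vP mul0mx.
Qed.

Lemma horizontal_jacobian i z : W z -> chart_dom AB (c i) (pi (k z)) ->
  'J (base_coord pi (c i) k) z = col_mx (P i (lsubmx z)) 0.
Proof.
move=> Wz cz; pose f := coord_map (idfun : B -> B) b (c i).
have oN := base_dom_open mM mB hE pk (b := c i).
have fE y : (W `&` (pi \o k) @^-1` chart_dom AB (c i)) y ->
    base_coord pi (c i) k y = (f \o lsubmx) y.
  move=> [Wy _]; have piy := pi_triv_param hE Wy.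
  by rewrite /base_coord /f /coord_map /= piy.
have -> : 'J (base_coord pi (c i) k) z = 'J (f \o lsubmx) z.
  exact: (eq_jacobian oN (base_coord_smooth mM mB hE pk (c i)) (conj Wz cz) fE).
have oD : open (coord_dom setT (idfun : B -> B) b (c i) : set 'rV[R]_q).
  by apply: coord_dom_open => //; [exact: openT|move=> x _; exact: cvg_id].
have sf : smooth_in (coord_dom setT (idfun : B -> B) b (c i)) f.
  by have [_ sc] := mfd_compat mB; exact: sc.
have Dz : coord_dom setT (idfun : B -> B) b (c i) (lsubmx z).
  by have [[bz _] _] := Wz; move: cz; rewrite /k (pi_triv_param hE Wz); split.
rewrite (jacobian_comp openT oD (smooth_lsubmx openT) sf I Dz) jacobian_lsubmx.
by rewrite mul_col_mx mul1mx mul0mx.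
Qed.

Lemma hor_triv_param z : W z -> hor pi c rho k z = block_mx (base_block (lsubmx z)) 0 0 0.
Proof.
move=> Wz; pose bl (A : 'M[R]_q) : 'M[R]_(q + p) := block_mx A 0 0 0.
have blD A A' : bl (A + A') = bl A + bl A' by rewrite /bl add_block_mx !addr0.
have bl0 : bl 0 = 0 by exact: block_mx0.
rewrite -/(bl _) /base_block (big_morph bl blD bl0); apply: eq_bigr => i _.
have piz : pi (k z) = chart_inv AB b (lsubmx z) := pi_triv_param hE Wz.
rewrite -piz /bl.
have [r0|r0] := eqVneq (rho i (pi (k z))) 0; first by rewrite r0 !scale0r block_mx0.
have [_ cz] := rho_supp hrho r0.
rewrite /horizontal_term (horizontal_jacobian Wz cz) tr_col_mx mul_col_row.
by rewrite trmx0 !mulmx0 !mul0mx scale_block_mx !scaler0.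
Qed.

(* Along a fibre, the local trivialization [tau i] differs from [j] by the action of an
   element of the structure group, which preserves [ghat]. *)
Lemma ver_fibre l y : triv_param_base j b l -> chart_img d y ->
  ver pi ghat mF tau rho (k \o row_mx l) y = base_weight l *: ghat d y.
Proof.
move=> jl dy; have oU : open (chart_img d) by exact: mfd_img_open mF d.
have Wl x : chart_img d x -> W (row_mx l x).
  by move=> dx; rewrite /W /triv_param_dom /= row_mxKl row_mxKr.
have pl : is_plot AM (chart_img d) (k \o row_mx l).
  exact: (plot_reparam cM pk oU (smooth_row_mx_cst l oU) Wl).
have pil x : chart_img d x -> pi ((k \o row_mx l) x) = chart_inv AB b l.
  by move=> dx; rewrite /= (pi_triv_param hE (Wl x dx)) row_mxKl.
rewrite /base_weight scaler_suml; apply: eq_bigr => i _; rewrite (pil y dy).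
have [->|r0] := eqVneq (rho i (chart_inv AB b l)) 0; first by rewrite !scale0r.
have [tl _] := rho_supp hrho r0; congr (_ *: _).
have ty : triv_dom E (tau i) (pi ((k \o row_mx l) y)) by rewrite pil.
have Dy : fibre_dom pi (tau i) (some_chart mF (fib (tau i) ((k \o row_mx l) y)))
    (k \o row_mx l) (chart_img d) y by exact: fibre_dom_some.
set d' := some_chart _ _ in Dy *.
pose g := trans E (tau i) j (chart_inv AB b l); pose f := coord_map (act g) d d'.
have fibE x : fibre_dom pi (tau i) d' (k \o row_mx l) (chart_img d) x ->
    fib (tau i) ((k \o row_mx l) x) = act g (chart_inv AF d x).
  move=> [[dx tx] _]; have := fib_triv_param hE (Wl x dx) tx.
  by rewrite row_mxKl row_mxKr.
have fE x : fibre_dom pi (tau i) d' (k \o row_mx l) (chart_img d) x ->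
    fibre_coord (tau i) d' (k \o row_mx l) x = f x.
  by move=> /fibE Dx; rewrite /fibre_coord /f /coord_map /= -Dx.
have JE : 'J (fibre_coord (tau i) d' (k \o row_mx l)) y = 'J f y.
  have sm := fibre_coord_smooth mM mB mF hE pl (tau i) d'.
  exact: (eq_jacobian (fibre_dom_open mM mB mF hE pl (j := tau i) (d := d')) sm Dy fE).
have Cy : coord_dom setT (act g) d d' y.
  have [_ dd] := Dy; split; [exact: dy|exact: I|].
  exact: (eq_ind _ (chart_dom AF d') dd _ (fibE y Dy)).
by rewrite /vertical_term JE (fE y Dy); exact: (esym (hinv Cy)).
Qed.

(** The fibre block is the pullback along the inclusion of one fibre, whose Jacobian [row_mx 0 1%:M]
    selects it. Along that inclusion the transition element of the group is constant, so its
    derivatives in base directions never appear. *)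
Lemma ver_triv_param z : W z ->
  drsubmx (ver pi ghat mF tau rho k z) = base_weight (lsubmx z) *: ghat d (rsubmx z).
Proof.
move=> Wz; have [jl dz] := Wz; have oU : open (chart_img d) by exact: mfd_img_open mF d.
have Wl x : chart_img d x -> W (row_mx (lsubmx z) x).
  by move=> dx; rewrite /W /triv_param_dom /= row_mxKl row_mxKr.
rewrite -(ver_fibre jl dz).
have := ver_comp ghat mM mB mF hE hrho pk oU (smooth_row_mx_cst (lsubmx z) oU) Wl dz.
move=> ->; rewrite hsubmxK jacobian_row_mx_cst.
move: (ver _ _ _ _ _ _ _) => A; rewrite -{2}(submxK A) mul_row_block tr_row_mx mul_row_col.
by rewrite trmx0 trmx1 !mul0mx !mulmx0 !add0r mul1mx mulmx1.
Qed.

Definition triv_metric (e : R) z : 'M[R]_(q + p) :=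
  hor pi c rho k z + e ^+ 2 *: ver pi ghat mF tau rho k z.

Lemma triv_metric_adiabatic t z0 : W z0 -> scal_pos ghat -> riem_pos t ghat ->
  \forall z \near z0 & e \near 0^'+,
    0 < scal (triv_metric e) z /\ posdef_bivectors (riem_form t (triv_metric e) z).
Proof.
move=> Wz0 sg rg; have [[bz0 _] dz0] := Wz0.
have oU : open (chart_img d) by exact: mfd_img_open mF d.
apply: (adiabatic (plot_open pk) oU (hor_smooth mM mB hE hrho pk 2)
  (ver_smooth mM mB mF hE hg hrho pk 2) (metric_smooth hg d 2) _ _ _ _
  hor_triv_param ver_triv_param _ Wz0).
- by move=> z _; exact: hor_sym.
- by move=> z Wz; exact: (ver_sym pi mF hg hrho k Wz).
- by move=> x dx; exact: Defs.metric_sym hg _ _ dx.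
- by move=> x dx; exact: metric_posdef hg _ _ dx.
- by move=> z [].
- exact: base_block_posdef.
- exact: base_weight_gt0.
- exact: sg.
- exact: rg.
Qed.

End LocalStructure.

(** * Conclusion *)

Section Transfer.
Variables (R : realType) (q p r : nat) (M B F : topologicalType)
  (G : topologicalGroupType) (AM : atlas R (q + p) M) (AB : atlas R q B)
  (AF : atlas R p F) (AG : atlas R r G) (act : G -> F -> F)
  (pi : M -> B) (E : bundle_atlas M B F G) (ghat : metric_field AF).
Hypotheses (mM : is_manifold AM) (mB : is_manifold AB) (mF : is_manifold AF)
  (hE : is_fibre_bundle AM AB AF AG act pi E) (hg : is_riemannian ghat)
  (hinv : forall a : G, preserves_metric ghat (act a)).
Variables (T : finType) (tau : T -> triv_ix E) (c : T -> chart_ix AB)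
  (rho : T -> B -> R).
Hypothesis hrho : forall i, good_bump (triv_dom E (tau i)) (c i) (rho i).
Hypothesis rho_cover : forall b, exists i, 0 < rho i b.

Let cM := charted_manifold mM.
Let cB := charted_manifold mB.
Let cF := charted_manifold mF.

Local Notation bm := (bundle_metric (AM := AM) pi ghat mF tau c rho).

Section OneTrivialization.
Variables (j : triv_ix E) (b : chart_ix AB) (d : chart_ix AF).
Local Notation W := (triv_param_dom j b d).
Local Notation tm := (triv_metric pi ghat mF tau c rho j b d).
Let pk := triv_param_plot mM mB mF hE j b d.

Lemma triv_coord_unit (a : chart_ix AM) y : triv_coord_dom pi j b d a y ->
  'J (triv_coord pi j b d a) y \in unitmx.
Proof. by move=> /(jacobian_triv_coord mM mB mF hE) J1; exact: (mulmx1_unit J1).1. Qed.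

Lemma bundle_metricE (e : R) (a : chart_ix AM) y : triv_coord_dom pi j b d a y ->
  bm e a y = 'J (triv_coord pi j b d a) y *m tm e (triv_coord pi j b d a y)
    *m ('J (triv_coord pi j b d a) y)^T.
Proof.
move=> Dy; have oD := triv_coord_dom_open mM mB mF hE (j := j) (b := b) (d := d) (a := a).
have sD := triv_coord_smooth mM mB mF hE j b d a.
have DW z : triv_coord_dom pi j b d a z -> W (triv_coord pi j b d a z).
  exact: triv_coord_in.
have pD : is_plot AM (triv_coord_dom pi j b d a) (chart_inv AM a).
  by apply: plot_sub oD _ (plot_chart a mM) => z [_ []].
have kE z : triv_coord_dom pi j b d a z ->
    chart_inv AM a z = (triv_param j b d \o triv_coord pi j b d a) z.
  by move=> Dz; exact: (esym (triv_coordK mB mF hE Dz)).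
rewrite /bundle_metric /triv_metric mulmxDr mulmxDl -scalemxAr -scalemxAl.
rewrite (eq_hor mM mB hE hrho pD Dy kE) (eq_ver ghat mM mB mF hE hrho pD Dy kE).
by rewrite (hor_comp mM mB hE hrho pk oD sD DW Dy) (ver_comp ghat mM mB mF hE hrho pk oD sD DW Dy).
Qed.

Lemma triv_metric_sym (e : R) z : W z -> (tm e z)^T = tm e z.
Proof.
by move=> Wz; rewrite /triv_metric linearD linearZ /= hor_sym (ver_sym pi mF hg hrho _ Wz).
Qed.

(** Definiteness is known in the charts of [M]; the inverse Jacobian carries it back to the
    trivialization coordinates. *)
Lemma triv_metric_unit (e : R) z : 0 < e -> W z -> tm e z \in unitmx.
Proof.
move=> e0 Wz; apply: (pdmx_unit (triv_metric_sym e Wz)).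
have [a az] := ch_cover cM (triv_param j b d z).
have zD : chart_param_dom j b d a z by split.
have J1 := jacobian_chart_param mM mB mF hE zD.
have yD := chart_param_in mM mB mF hE zD.
have ya : chart_img a (chart_param j b d a z) by case: yD => _ [].
have pos := bundle_metric_posdef mM mB mF hE hg hrho rho_cover e0 ya.
have hE' := bundle_metricE e yD; rewrite (chart_paramK mM mB mF hE zD) in hE'.
rewrite hE' in pos; have [uQ _] := mulmx1_unit J1.
move: (pdmx_conj uQ pos); set Q := 'J (chart_param _ _ _ _) _ in J1 *.
set J := 'J (triv_coord _ _ _ _ _) _ in J1 *.
by rewrite !mulmxA J1 mul1mx -mulmxA -trmx_mul J1 trmx1 mulmx1.
Qed.

Lemma bundle_curvature (t e : R) (a : chart_ix AM) y : 0 < e -> triv_coord_dom pi j b d a y ->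
  0 < scal (tm e) (triv_coord pi j b d a y) /\
    posdef_bivectors (riem_form t (tm e) (triv_coord pi j b d a y)) ->
  0 < scal (bm e a) y /\ posdef_bivectors (riem_form t (bm e a) y).
Proof.
move=> e0 Dy; have oD := triv_coord_dom_open mM mB mF hE (j := j) (b := b) (d := d) (a := a).
have oW := plot_open pk; have sD := triv_coord_smooth mM mB mF hE j b d a 3.
have DW z : triv_coord_dom pi j b d a z -> W (triv_coord pi j b d a z).
  exact: triv_coord_in.
have Ct : class_C 2 W (tm e).
  apply: (class_CD oW (hor_smooth mM mB hE hrho pk 2)).
  exact: (class_CZ (e ^+ 2) oW (ver_smooth mM mB mF hE hg hrho pk 2)).
have uJ := @triv_coord_unit a; have sy := @triv_metric_sym e.
have uh z := triv_metric_unit e0 (z := z).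
have h'E := @bundle_metricE e a.
have sE := @scal_pullback R (q + p) (triv_coord pi j b d a) (tm e) (bm e a)
  (triv_coord_dom pi j b d a) W oD oW sD Ct DW uJ sy uh h'E y Dy.
have rE := @riem_form_pullback R (q + p) (triv_coord pi j b d a) (tm e) (bm e a)
  (triv_coord_dom pi j b d a) W t oD oW sD Ct DW uJ sy uh h'E y Dy.
move=> [sc rf]; split; last exact: rE rf.
by rewrite sE.
Qed.

End OneTrivialization.

(** [scal_pos] and [riem_pos] quantify over all charts of [M], of which there may be infinitely
    many. One trivialization serves near [x0], and its coordinates depend on the point alone, so the
    neighbourhood does not depend on the chart [a]. *)
Lemma bundle_curvature_near (t : R) (x0 : M) : scal_pos ghat -> riem_pos t ghat ->
  \forall x \near x0 & e \near 0^'+, forall (a : chart_ix AM) y,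
    chart_img a y -> chart_inv AM a y = x ->
    0 < scal (bm e a) y /\ posdef_bivectors (riem_form t (bm e a) y).
Proof.
move=> sg rg; have [j jx] := triv_cover hE (pi x0).
have [b bx] := ch_cover cB (pi x0); have [d dx] := ch_cover cF (fib j x0).
have [a0 ax] := ch_cover cM x0.
have yD := triv_coord_at mM jx bx dx ax; set y0 := chart_map _ _ _ in yD.
have Wz := triv_coord_in mB yD.
have [[A S] /= [nA nS] AS] :=
  triv_metric_adiabatic mM mB mF hE hg hinv hrho rho_cover Wz sg rg.
have cc : {for x0, continuous (chart_map AM a0)}.
  by apply: (mfd_map_cont mM); rewrite inE.
have ct : {for y0, continuous (triv_coord pi j b d a0)}.
  by have [ct _] := triv_coord_smooth mM mB mF hE j b d a0 0; apply: ct; rewrite inE.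
have nD : nbhs y0 (triv_coord_dom pi j b d a0).
  by apply: open_nbhs_nbhs; split=> //; exact: (triv_coord_dom_open mM mB mF hE).
pose N := chart_map AM a0 @^-1` (triv_coord_dom pi j b d a0 `&` triv_coord pi j b d a0 @^-1` A)
  `&` chart_dom AM a0.
exists (N, S `&` [set e | 0 < e]) => /=.
  split; last by apply: filterI => //; exact: nbhs_right_gt.
  apply: filterI; last by apply: open_nbhs_nbhs; split=> //; exact: ch_dom_open.
  by apply: cc; apply: filterI => //; exact: ct.
move=> [x e] /= [[[Dx Ax] a0x] [Se e0]] a y ya yx.
have xK : chart_inv AM a0 (chart_map AM a0 x) = x by rewrite (ch_mapK cM) // inE.
have Dy : triv_coord_dom pi j b d a y.
  by move: Dx => [[[_ jx'] dx'] [_ bx']]; rewrite /= xK -yx in jx' dx' bx'; split.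
apply: (bundle_curvature e0 Dy).
have -> : triv_coord pi j b d a y = triv_coord pi j b d a0 (chart_map AM a0 x).
  by rewrite /triv_coord /base_coord /fibre_coord /= xK yx.
exact: (AS (_, _)).
Qed.

Lemma bundle_curvature_pos (t : R) : compact [set: M] -> scal_pos ghat -> riem_pos t ghat ->
  exists g : metric_field AM, [/\ is_riemannian g, scal_pos g & riem_pos t g].
Proof.
move=> cpt sg rg; have /compact_near_coveringP cov := cpt.
(* Compactness is applied with [e] as parameter: one right neighbourhood of 0 then works for all
   points of [M]. *)
have pos := cov R (0^'+) (fun e x => forall (a : chart_ix AM) y,
    chart_img a y -> chart_inv AM a y = x ->
    0 < scal (bm e a) y /\ posdef_bivectors (riem_form t (bm e a) y)) _
  (fun x _ => bundle_curvature_near x sg rg).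
have [e [e0 He]] : exists e : R, 0 < e /\ [set: M] `<=` (fun x => forall (a : chart_ix AM) y,
    chart_img a y -> chart_inv AM a y = x ->
    0 < scal (bm e a) y /\ posdef_bivectors (riem_form t (bm e a) y)).
  by apply: (@filter_ex _ (0^'+ : set_system R)); apply: filterI; [exact: nbhs_right_gt|exact: pos].
exists (bm e); split.
- exact: (bundle_metric_riemannian mM mB mF hE hg hrho rho_cover e0).
- by move=> a y ya; exact: (He _ I a y ya erefl).1.
- by move=> a y ya; exact: (He _ I a y ya erefl).2.
Qed.

End Transfer.

(** * The invariants as suprema *)

Section RiemBounds.
Variables (R : realType) (n : nat) (T : topologicalType) (A : atlas R n T).
Implicit Types g : metric_field A.

Lemma dim_bound_ge0 : 0 <= n%:R * (n%:R - 1) / 2 :> R.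
Proof.
case: n => [|k]; first by rewrite !mul0r.
by rewrite divr_ge0 // mulr_ge0 // -natr1 addrK.
Qed.

Lemma riem_le g : riem g <= n%:R * (n%:R - 1) / 2.
Proof.
rewrite /riem; case: asboolP => _; last exact: dim_bound_ge0.
set S := [set t | _]; have [->|S0] := eqVneq S set0; first by rewrite sup0 dim_bound_ge0.
apply: ge_sup; first exact/set0P.
by move=> t [/andP[_ /ltW]].
Qed.

Lemma le_riem g t : 0 < t < n%:R * (n%:R - 1) / 2 -> scal_pos g -> riem_pos t g ->
  t <= riem g.
Proof.
move=> tb sg rg; rewrite /riem asboolT //; apply: ub_le_sup => //.
by exists (n%:R * (n%:R - 1) / 2) => s [/andP[_ /ltW]].
Qed.

(** [0 <= t] rules out both default values: [riem g = 0] when the scalar curvature is not positive,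
    and [sup set0 = 0]. *)
Lemma lt_riemP g t : 0 <= t -> t < riem g ->
  scal_pos g /\ exists2 s, t < s & 0 < s < n%:R * (n%:R - 1) / 2 /\ riem_pos s g.
Proof.
move=> t0; rewrite /riem; case: asboolP => [sg|_] ts; last by rewrite ltNge t0 in ts.
split=> //; move: ts; set S := [set t | _] => ts.
have S0 : S !=set0.
  by apply/set0P/eqP => E; rewrite E sup0 ltNge t0 in ts.
by have [s Ss ts'] := sup_gt S0 ts; exists s.
Qed.

Lemma riem_le_smooth_riem g : is_riemannian g -> riem g <= smooth_riem A.
Proof.
move=> hg; apply: ub_le_sup; last by exists g.
by exists (n%:R * (n%:R - 1) / 2) => _ [h _ <-]; exact: riem_le.
Qed.

End RiemBounds.

(** Parameters admissible on the fibre are thus admissible on the total space. The case [p = 0] is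
    apart because [p%:R - 1] is then negative. *)
Lemma dim_bound_le (R : realType) (q p : nat) :
  p%:R * (p%:R - 1) / 2 <= (q + p)%:R * ((q + p)%:R - 1) / 2 :> R.
Proof.
case: p => [|p]; first by rewrite mul0r mul0r addn0; exact: dim_bound_ge0.
rewrite ler_pM2r // addnS -!natr1 !addrK natrD.
have := ler0n R p; have := ler0n R q; nra.
Qed.

Theorem theoremA (R : realType) (n q p r : nat)
    (M B F : topologicalType) (G : topologicalGroupType)
    (AM : atlas R n M) (AB : atlas R q B) (AF : atlas R p F)
    (AG : atlas R r G) (act : G -> F -> F)
    (pi : M -> B) (E : bundle_atlas M B F G)
    (hM : is_closed_manifold AM) (hB : is_closed_manifold AB)
    (hF : is_closed_manifold AF) (hG : is_lie_group AG)
    (hact : is_smooth_action AG AF act)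
    (hE : is_fibre_bundle AM AB AF AG act pi E)
    (t : R) (ht0 : 0 <= t) (ht1 : t < p%:R * (p%:R - 1) / 2)
    (ghat : metric_field AF) (hghat : is_riemannian ghat)
    (hinv : forall a : G, preserves_metric ghat (act a))
    (hriem : t < riem ghat) :
  t < smooth_riem AM.
Proof.
have mM := cmfd_manifold hM; have mB := cmfd_manifold hB; have mF := cmfd_manifold hF.
have nE := bundle_dimension mM mB mF hE (cmfd_nonempty hM); subst n.
(* The margin between [t] and [s] makes the conclusion strict: [s] itself is transported to [M],
   where it becomes a lower bound for the supremum. *)
have [sg [s ts [/andP[s0 sp] rg]]] := lt_riemP ht0 hriem.
have [T [tau [c [rho [hrho cover]]]]] := bump_cover hB (triv_open hE) (triv_cover hE).
have [g [hg scg rsg]] :=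
  bundle_curvature_pos mM mB mF hE hghat hinv hrho cover (cmfd_compact hM) sg rg.
apply: (lt_le_trans ts); apply: le_trans (riem_le_smooth_riem hg).
apply: le_riem => //; rewrite s0; exact: lt_le_trans sp (dim_bound_le R q p).
Qed.
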